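(* Let $(X,d)$ be a compact metric space such that $\mathcal J_{AR}(X,d)\ne\emptyset$. Then the Ahlfors regular conformal dimension of $(X,d)$ is equal to the critical exponent $Q_N$ of the combinatorial modulus: $\dim_{AR}(X,d)=Q_N$.
   Context: Gauge. Two distances on $X$ are quasisymmetrically equivalent if the identity map between them is a quasisymmetric homeomorphism. A distance $\theta$ on $X$ is Ahlfors regular of dimension $q>0$ if there are a Radon measure $\mu$ on $X$ and $K\ge1$ with $K^{-1}\le\mu(B_r)/r^q\le K$ for every $\theta$-ball $B_r$ of radius $0<r\le\mathrm{diam}_\theta X$ (then $q=\dim_H(X,\theta)$). $\mathcal J_{AR}(X,d)$ is the set of all distances on $X$ quasisymmetrically equivalent to $d$ and Ahlfors regular of some dimension, and $\dim_{AR}(X,d)=\inf\{\dim_H(X,\theta):\theta\in\mathcal J_{AR}(X,d)\}$. ($\mathcal J_{AR}(X,d)\ne\emptyset$ iff $(X,d)$ is doubling and uniformly perfect.) Coverings. $B(x,r)$ denotes the open ball. Fix $\kappa>1$, $b>1$ and $\lambda\ge32$. For each $k\ge1$, $\mathcal U_k$ is a finite covering of $X$ such that each $B\in\mathcal U_k$ has a chosen center $x_B\in X$ with $B(x_B,\kappa^{-1}b^{-k})\subset B\subset B(x_B,\kappa b^{-k})$, and the balls $B(x_B,\kappa^{-1}b^{-k})$, $B\in\mathcal U_k$, are pairwise disjoint. $\mathcal U=\bigsqcup_k\mathcal U_k$, and $|B|=k$ if $B\in\mathcal U_k$. For $\mu>0$ and $B\in\mathcal U_k$, $\mu\cdot B:=B(x_B,\mu\kappa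 b^{-k})$. $G_k$ is the graph with vertex set $\mathcal U_k$ and an edge between distinct $B,B'$ whenever $\lambda\cdot B\cap\lambda\cdot B'\ne\emptyset$. Combinatorial modulus. For a family $\Gamma$ of paths (viewed as sets of vertices) in a graph $G$ with vertex set $V$ and $p>0$, $\mathrm{Mod}_p(\Gamma,G)=\inf_\rho\sum_{v\in V}\rho(v)^p$, the infimum over all $\rho:V\to[0,\infty)$ with $\sum_{v\in\gamma}\rho(v)\ge1$ for every $\gamma\in\Gamma$ (so it is $0$ if $\Gamma=\emptyset$). For $B\in\mathcal U$ and $k\ge1$, $\Gamma_{k}(B)$ is the family of paths $\gamma=\{B_i\}_{i=1}^N$ of $G_{|B|+k}$ such that the center of $B_1$ belongs to $B$ and the center of $B_N$ belongs to $X\setminus 2\cdot B$. Put $M_{p,k}=\sup_{B\in\mathcal U}\mathrm{Mod}_p(\Gamma_{k}(B),G_{|B|+k})$, $M_p=\liminf_{k\to\infty}M_{p,k}$, and $Q_N=\inf\{p>0:M_p=0\}$. *)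

(* Defs.v *)
From HB Require Import structures.
From mathcomp Require Import all_boot all_order all_algebra.
From mathcomp Require Import all_classical all_reals all_analysis.

Set Implicit Arguments.
Unset Strict Implicit.
Unset Printing Implicit Defensive.

Import Order.TTheory GRing.Theory Num.Theory.
Import numFieldNormedType.Exports.

Local Open Scope classical_set_scope.
Local Open Scope ring_scope.

(* Nonempty metric spaces: the library's [g_sigma_algebraType] needs a point. *)
#[short(type="pmetricType")]
HB.structure Definition PointedMetric (R : numDomainType) :=
  {T of Pointed T & Metric R T}.

Record distance (R : realType) (X : Type) := Distance {
  dist :> X -> X -> R;
  distxx : forall x, dist x x = 0;
  dist_eq0 : forall x y, dist x y = 0 -> x = y;
  distC : forall x y, dist x y = dist y x;
  dist_triangle : forall y x z, dist x z <= dist x y + dist y z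
}.

(* [mspace theta] is the set X endowed with the distance theta and with the
   topology of theta; several distances on the same X thus coexist. *)
Definition mspace (R : realType) (X : pointedType) (theta : distance R X)
  : Type := X.

Section mspace_instances.
Variables (R : realType) (X : pointedType) (theta : distance R X).

HB.instance Definition _ := Pointed.on (mspace theta).
HB.instance Definition _ := @isMetric.Build R (mspace theta) (dist theta)
  (distxx theta) (dist_eq0 (d := theta)) (distC theta) (@dist_triangle _ _ theta).

End mspace_instances.

Definition homeomorphism (S T : topologicalType) (f : S -> T) : Prop :=
  continuous f /\ exists g : T -> S, [/\ cancel f g, cancel g f & continuous g].

(* eta restricts to a homeomorphism of [0, +oo[ onto itself; its values at
   negative reals are irrelevant. *)
Definition halfline_homeomorphism (R : realType) (eta : R -> R) : Prop :=
  exists zeta : R -> R,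
    [/\ {homo eta : t / 0 <= t}, {homo zeta : t / 0 <= t},
        {in `[0, +oo[, cancel eta zeta}, {in `[0, +oo[, cancel zeta eta} &
        {within `[0, +oo[, continuous eta} /\
        {within `[0, +oo[, continuous zeta}].

Definition quasisymmetric (R : realType) (S T : metricType R) (f : S -> T)
    : Prop :=
  homeomorphism f /\
  exists2 eta : R -> R, halfline_homeomorphism eta &
    forall x y z : S, x <> z ->
      mdist (f x) (f y) / mdist (f x) (f z) <= eta (mdist x y / mdist x z).

Definition qs_equivalent (R : realType) (X : pointedType)
    (d theta : distance R X) : Prop :=
  quasisymmetric (fun x : mspace d => x : mspace theta).

(* The added 0 gives the empty set diameter 0 instead of -oo. *)
Definition diam (R : realType) (T : metricType R) (A : set T) : \bar R :=
  ereal_sup (0%E |` [set (mdist x y)%:E | x in A & y in A]).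

Definition hausdorff_content (R : realType) (T : metricType R)
    (s delta : R) (A : set T) : \bar R :=
  ereal_inf [set (\sum_(0 <= i <oo) diam (F i) `^ s)%E | F in
    [set F : nat -> set T |
      A `<=` \bigcup_i F i /\ forall i, (diam (F i) <= delta%:E)%E]].

Definition hausdorff_measure (R : realType) (T : metricType R)
    (s : R) (A : set T) : \bar R :=
  ereal_sup [set hausdorff_content s delta A | delta in [set delta | 0 < delta]].

(* Restricting to s > 0 does not change the infimum, and avoids any convention
   on 0 to the power 0. *)
Definition hausdorff_dim (R : realType) (T : metricType R) : \bar R :=
  ereal_inf [set s%:E | s in
    [set s : R | 0 < s /\ hausdorff_measure s [set: T] = 0%E]].

Definition borel (T : ptopologicalType) := g_sigma_algebraType (@open T).

Definition radon (R : realType) (T : ptopologicalType)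
    (mu : {measure set (borel T) -> \bar R}) : Prop :=
  [/\ forall K : set T, compact K -> (mu K < +oo)%E,
      forall A : set (borel T), measurable A ->
        mu A = ereal_inf [set mu V | V in [set V : set T | open V /\ A `<=` V]] &
      forall V : set T, open V ->
        mu V = ereal_sup
          [set mu K | K in [set K : set T | compact K /\ K `<=` V]]].

Definition ahlfors_regular (R : realType) (T : pmetricType R) (q : R) : Prop :=
  exists (mu : {measure set (borel T) -> \bar R}) (K : R),
    [/\ radon mu, 1 <= K &
        forall (x : T) (r : R), 0 < r -> (r%:E <= diam [set: T])%E ->
          (K^-1%:E <= mu (ball x r) * (r `^ q)^-1%:E <= K%:E)%E].

Definition ar_gauge (R : realType) (X : pointedType) (d : distance R X)
    : set (distance R X) :=
  [set theta | qs_equivalent d theta /\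
    exists2 q : R, 0 < q & ahlfors_regular (mspace theta) q].

Definition dimAR (R : realType) (X : pointedType) (d : distance R X) : \bar R :=
  ereal_inf [set hausdorff_dim (mspace theta) | theta in ar_gauge d].

(* Only the restriction of [adj] to [vertices] matters. *)
Record graph (V : Type) := Graph {
  vertices : set V;
  adj : V -> V -> Prop
}.

(* The path v :: s; paths have at least one vertex. *)
Definition is_path (V : choiceType) (G : graph V) (v : V) (s : seq V) : Prop :=
  [set` v :: s] `<=` vertices G /\ path (fun u w => `[< adj G u w >]) v s.

Definition admissible (R : realType) (V : choiceType) (Gamma : set (set V))
    (G : graph V) : set (V -> R) :=
  [set rho | (forall v, vertices G v -> 0 <= rho v) /\
    forall gamma, Gamma gamma -> 1 <= \sum_(v \in gamma) rho v].

(* Meant for graphs with finitely many vertices, and p > 0. *)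
Definition Mod (R : realType) (V : choiceType) (p : R) (Gamma : set (set V))
    (G : graph V) : \bar R :=
  ereal_inf [set (\sum_(v \in vertices G) rho v `^ p)%:E
    | rho in admissible Gamma G].

(* A center depends on the level, as the same set may belong to several U k. *)
Record ball_coverings (R : realType) (T : metricType R) (kappa b : R)
    (U : nat -> set (set T)) (c : nat -> set T -> T) : Prop := BallCoverings {
  bc_finite : forall k, (1 <= k)%N -> finite_set (U k);
  bc_cover : forall k, (1 <= k)%N -> \bigcup_(B in U k) B = [set: T];
  bc_ball : forall k B, (1 <= k)%N -> U k B ->
    ball (c k B) (kappa^-1 * b ^- k) `<=` B /\
    B `<=` ball (c k B) (kappa * b ^- k);
  bc_disjoint : forall k, (1 <= k)%N ->
    trivIset (U k) (fun B => ball (c k B) (kappa^-1 * b ^- k))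
}.

Section critical_exponent.
Variables (R : realType) (T : metricType R) (kappa b lambda : R).
Variables (U : nat -> set (set T)) (c : nat -> set T -> T).

(* m . B for B in U k *)
Definition dilate (m : R) (k : nat) (B : set T) : set T :=
  ball (c k B) (m * kappa * b ^- k).

Definition covering_graph (k : nat) : graph (set T) :=
  Graph (U k)
    (fun B B' => B <> B' /\ dilate lambda k B `&` dilate lambda k B' !=set0).

(* Gamma_k(B) for B in U j *)
Definition crossing_paths (k j : nat) (B : set T) : set (set (set T)) :=
  [set gamma | exists (B1 : set T) (s : seq (set T)),
    [/\ is_path (covering_graph (j + k)) B1 s,
        B (c (j + k) B1),
        ~ dilate 2 j B (c (j + k) (last B1 s)) &
        gamma = [set` B1 :: s]]].

Definition sup_modulus (p : R) (k : nat) : \bar R :=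
  ereal_sup [set m | exists (j : nat) (B : set T),
    [/\ (1 <= j)%N, U j B &
        m = Mod p (crossing_paths k j B) (covering_graph (j + k))]].

Definition liminf_modulus (p : R) : \bar R := limn_einf (sup_modulus p).

Definition critical_exponent : \bar R :=
  ereal_inf [set p%:E | p in [set p : R | 0 < p /\ liminf_modulus p = 0%E]].

End critical_exponent.

(* Main.v *)
(* For [critical_exponent <= dimAR], let theta be a q-regular distance of the
   gauge and p > q.  Weighting the balls of level j + k near B by their
   theta-diameter relative to that of B is admissible by the triangle
   inequality; since small theta-balls inside these balls are disjoint, the q-th
   powers of the weights have bounded sum, while the weights tend to 0 as k grows,
   uniformly in B, by quasisymmetry.  Hence the sum of their p-th powers tends to 0.

   Conversely, let M_p = 0 and fix k such that M_{p,k} is tiny.  Nearly optimal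
   weights yield, for each ball v of level nk, numbers tau(v, w) of small sum
   whose p-th roots add up to at least 1 along every path leaving 2.v.  Smearing
   tau with an exponential kernel of large cut-off radius turns it into a Markov
   kernel dominating tau, and makes the masses m it produces comparable at
   neighbouring balls.  Then m(v)^(1/p) is at most the sum of m(w)^(1/p) over the
   balls w of a crossing path, and going up the scales one at a time gives the
   same inequality for arbitrary chains.  So if F is a limit of the masses
   (finitely additive, along an ultrafilter), F(B(x, d(x,y)))^(1/p) is comparable
   to the largest distance below it.  This distance is quasisymmetric to d because F
   is doubling and d is uniformly perfect, and it is p-regular for the Radon
   measure built from F.  The two inequalities follow, as a compact q-regular
   space has Hausdorff dimension q. *)
Require Import Defs.
From HB Require Import structures.
From mathcomp Require Import all_boot all_order all_algebra.
From mathcomp Require Import all_classical all_reals all_analysis.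
From mathcomp Require Import ring lra zify.
Set Implicit Arguments.
Unset Strict Implicit.
Unset Printing Implicit Defensive.
Import Order.TTheory GRing.Theory Num.Theory.
Import numFieldNormedType.Exports.
Local Open Scope classical_set_scope.
Local Open Scope ring_scope.

(** * Radon measures from finitely additive contents *)

(** The nonempty gauge enters the converse through one regular distance: its measure, read on
    [d]-balls, makes [d] doubling and uniformly perfect, and doubling bounds the sums of an
    exponential kernel over the centers of one level, uniformly in the level. Dividing [tau] by its
    sum would already give a Markov kernel dominating [tau], but neighbouring balls could receive
    incomparable masses. Hence the smearing, which costs a factor [C] in the sum of [tau], and the
    cut-off, which keeps each step within a multiple of its scale. The order of the constants
    matters: the required smallness of the modulus depends on [C], [L] and [p] only; then [k] is
    chosen, as large as needed, because a liminf vanishes; the floor of [tau] and the cut-off radius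
    depend on [k] and come last. Crossings are charged without their exit vertex, so that the next
    run may start there without paying twice. Countable additivity is restored only at the end, when
    factors no longer matter. *)

Lemma mball_open (R : realType) (T : metricType R) (x : T) (r : R) :
  open (ball x r).
Proof.
rewrite openE => y; rewrite ballEmdist /= => xyr.
apply/nbhs_ballP; exists (r - mdist x y) => /=; first by rewrite subr_gt0.
move=> z; rewrite !ballEmdist /= => yz.
by have := metric_triangle x y z; lra.
Qed.

Section radon_of_content.
Context {R : realType} {T : pmetricType R} (L : set T -> R).
Hypothesis cT : compact [set: T].
Hypothesis L_ge0 : forall A, 0 <= L A.
Hypothesis L_add : forall A B, A `&` B = set0 -> L (A `|` B) = L A + L B.

Let L0 : L set0 = 0.
Proof.
have := L_add (setI0 set0); rewrite setU0 => /eqP.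
by rewrite -subr_eq subrr eq_sym => /eqP.
Qed.

Let le_L A B : A `<=` B -> L A <= L B.
Proof. by move=> AB; rewrite -(setDUK AB) L_add ?lerDl// setDIK. Qed.

Let L_subU A B : L B <= L (B `\` A) + L A.
Proof.
rewrite -L_add; first by apply: le_L => x Bx /=; have := pselect (A x); tauto.
by apply/seteqP; split => // x [[_]].
Qed.

Let L_bigsub (F : nat -> set T) N A :
  (forall x, A x -> exists2 i, (i < N)%N & F i x) ->
  L A <= \sum_(i < N) L (F i).
Proof.
elim: N A => [|N ih] A AF.
  by rewrite big_ord0 (_ : A = set0) ?L0// -subset0 => x /AF[].
rewrite big_ord_recr /= (le_trans (L_subU (F N) A))// lerD2r.
apply: ih => x [/AF[i]]; rewrite ltnS leq_eqVlt => /predU1P[->//|iN Fi] _.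
by exists i.
Qed.

(** Finite additivity alone gives no countable subadditivity on open sets. Asking that [closure W]
    lie in [V] leaves a margin: these closures are compact, and countable open covers of them reduce
    to finite covers by slightly smaller sets. *)
Let inner (V : set T) : \bar R :=
  ereal_sup [set (L W)%:E | W in [set W | open W /\ closure W `<=` V]].

Let innerP V W : open W -> closure W `<=` V -> ((L W)%:E <= inner V)%E.
Proof. by move=> oW cW; apply: ereal_sup_ubound; exists W. Qed.

Let inner_ge0 V : (0 <= inner V)%E.
Proof.
by have := @innerP V set0 open0; rewrite L0 closure0; apply; exact: sub0set.
Qed.

Let inner_le V : (inner V <= (L V)%:E)%E.
Proof.
apply: ge_ereal_sup => _ [W [oW cWV] <-]; rewrite lee_fin le_L//.
exact: subset_trans (@subset_closure _ W) cWV.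
Qed.

(* Infinite on non-open sets, so that only open covers count in [mu_ext]. *)
Let oinner (V : set (borel T)) : \bar R :=
  if `[< open (V : set T) >] then inner V else +oo%E.

Let oinner_ge0 V : (0 <= oinner V)%E.
Proof. by rewrite /oinner; case: ifP => _; [exact: inner_ge0|exact: leey]. Qed.

Let oinner0 : oinner set0 = 0%E.
Proof.
apply/eqP; rewrite eq_le oinner_ge0 andbT /oinner asboolT; last exact: open0.
by rewrite (le_trans (inner_le _))// L0.
Qed.

Let mu : set (borel T) -> \bar R := mu_ext oinner.

Let mu_ge0 A : (0 <= mu A)%E. Proof. exact: (mu_ext_ge0 oinner_ge0). Qed.
Let mu0 : mu set0 = 0%E. Proof. exact: (mu_ext0 oinner0 oinner_ge0). Qed.
Let mu_le : {homo mu : A B / A `<=` B >-> (A <= B)%E}.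
Proof. exact: le_mu_ext. Qed.
Let mu_sub : sigma_subadditive mu.
Proof. exact: (mu_ext_sigma_subadditive oinner_ge0). Qed.

HB.instance Definition _ := isOuterMeasure.Build R (borel T) mu
  mu0 mu_ge0 mu_le mu_sub.

Let mu_open (V : set T) : open V -> (mu V <= inner V)%E.
Proof.
move=> oV; apply: ereal_inf_lbound.
exists (fun i => if i is 0%N then V else set0).
  split; first by case=> [|i]; [exact: sub_sigma_algebra|exact: measurable0].
  by move=> x Vx; exists 0%N.
rewrite nneseries_recl//= eseries_cond/= eseries0 ?adde0; last by case.
by rewrite /oinner asboolT.
Qed.

Let shrink (r : R) (V : set T) : set T :=
  \bigcup_(x in [set x | ball x (r + r) `<=` V]) ball x r.

Let shrink_open r V : open (shrink r V).
Proof. by apply: bigcup_open => x _; exact: mball_open. Qed.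

Let shrink_closure r V : 0 < r -> closure (shrink r V) `<=` V.
Proof.
move=> r0 y /(_ (ball y r)) []; first exact: nbhsx_ballx.
move=> z [[x /= xV xz] yz]; apply: xV.
by apply: ball_triangle xz (ball_sym yz).
Qed.

(** A Lebesgue number and a finite subcover at once: compactness in its near-covering form is
    applied to the product of the filters of [r] tending to 0 from the right and [N] tending to
    infinity. *)
Let shrink_cover (K : set T) (V : nat -> set T) : compact K ->
  (forall i, open (V i)) -> K `<=` \bigcup_i V i ->
  exists2 r, 0 < r & exists N, forall x, K x ->
    exists2 i, (i < N)%N & shrink r (V i) x.
Proof.
move=> /compact_near_coveringP cK oV KV.
pose F := filter_prod (0^'+ : set_system R) \oo.
have FF : Filter F by exact: filter_prod_filter.
have := cK _ F (fun rN x => exists2 i, (i < rN.2)%N & ball x (rN.1 + rN.1) `<=` V i) FF.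
have near_le e : 0 < e -> \forall r \near (0:R)^'+, 0 < r < e.
  move=> e0; near=> r; apply/andP; split=> //; near: r; exact: nbhs_right_lt.
case.
  move=> x /KV [i _ Vix].
  have /nbhs_ballP[e /= e0 eV] : nbhs x (V i) by apply: open_nbhs_nbhs.
  exists (ball x (e / 2), [set rN | (0 < rN.1 < e / 4) /\ (i < rN.2)%N]).
    split; first by apply: nbhsx_ballx; rewrite divr_gt0.
    exists ([set r | 0 < r < e / 4], [set N | (i < N)%N]).
      split=> /=; first by apply: near_le; rewrite divr_gt0.
      by exists i.+1.
    by move=> [r N] /=.
  move=> [y [r N]] /= [xy [re iN]]; exists i => // z yz; apply: eV.
  move: xy yz; rewrite !ballEmdist /= => xy yz.
  by have := metric_triangle x y z; lra.
move=> [A B] /= [A0 [N _ NB]] AB.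
have [r /= [Ar r0]] : exists r : R, A r /\ 0 < r.
  by near (0:R)^'+ => r; exists r; split => //; near: r.
exists r => //; exists N => x Kx.
have [i /= iN bV] := AB (r, N) (conj Ar (NB N (leqnn _))) x Kx.
exists i => //; exists x => //.
exact: ballxx.
Unshelve. all: by end_near. Qed.

Let closure_compact (W : set T) : compact (closure W).
Proof. by apply: (subclosed_compact _ cT) => //; exact: closed_closure. Qed.

Let inner_bigcup (V : nat -> set T) : (forall i, open (V i)) ->
  (inner (\bigcup_i V i) <= \sum_(i <oo) inner (V i))%E.
Proof.
move=> oV; apply: ge_ereal_sup => _ [W [oW cWV] <-].
have [r r0 [N WN]] := shrink_cover (closure_compact (W := W)) oV cWV.
apply: (@le_trans _ _ (\sum_(0 <= i < N) inner (V i))%E); last first.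
  by apply: nneseries_lim_ge => i _ _; exact: inner_ge0.
apply: (@le_trans _ _ (\sum_(i < N) L (shrink r (V i)))%:E).
  rewrite lee_fin; apply: (L_bigsub (F := fun i => shrink r (V i))).
  by move=> x /subset_closure /WN.
rewrite big_mkord -sumEFin; apply: lee_sum => i _; apply: innerP => //.
exact: shrink_closure.
Qed.

(** A lower bound on [mu] can be tested on single open sets: by [inner_bigcup], the union of a
    countable open cover costs no more than the cover. *)
Let mu_leP A (x : \bar R) : (forall V : set T, open V -> A `<=` V -> (x <= inner V)%E) ->
  (x <= mu A)%E.
Proof.
move=> AV; apply: le_ereal_inf_tmp => _ [B [mB AB] <-].
have [[i nB]|allB] := pselect (exists i, ~ open (B i : set T)).
  have -> : (\sum_(k <oo) oinner (B k))%E = +oo%E; last by rewrite leey.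
  apply: (eseries_pinfty (k := i)) => //; last by rewrite /oinner asboolF.
  by move=> n _; rewrite -ltNye (lt_le_trans _ (oinner_ge0 _)).
have {}allB i : open (B i : set T) by apply: contrapT => nB; apply: allB; exists i.
rewrite (eq_eseriesr (g := fun i => inner (B i))); last first.
  by move=> i _; rewrite /oinner asboolT.
apply: le_trans (inner_bigcup allB); apply: AV => //.
by apply: bigcup_open.
Qed.

Let mu_closed K : closed (K : set T) -> ((L K)%:E <= mu K)%E.
Proof.
move=> cK; apply: mu_leP => V oV KV.
have kK : compact (K : set T) by apply: (subclosed_compact cK cT).
have [||r r0 [N WN]] := shrink_cover kK (V := fun=> V); first by [].
  by move=> x /KV; exists 0%N.
apply: (@le_trans _ _ (L (shrink r V))%:E); last first.
  by apply: innerP => //; exact: shrink_closure.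
by rewrite lee_fin le_L// => x /WN [].
Qed.

(** [W1] nearly exhausts [B] inside [V], and [W2] nearly exhausts what [closure W1] leaves of [B];
    they are disjoint, so additivity of [L] bounds both parts by [inner B]. Removing [closure W1]
    instead of [V] keeps the remaining set open. *)
Let caratheodory_open (V : set T) : open V -> caratheodory_measurable mu V.
Proof.
move=> oV; apply: le_caratheodory_measurable => A; apply: mu_leP => B oB AB.
apply/lee_addgt0Pr => e e0.
have e2 : 0 < e / 2 by rewrite divr_gt0.
have innerf C : inner C \is a fin_num.
  by rewrite ge0_fin_numE// (le_lt_trans (inner_le C))// ltry.
have [_ [W1 [oW1 W1BV] <-] h1] := ub_ereal_sup_adherent e2 (innerf (B `&` V)).
have [_ [W2 [oW2 W2B] <-] h2] :=
  ub_ereal_sup_adherent e2 (innerf (B `\` closure W1)).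
have le1 : (mu (A `&` V) <= inner (B `&` V))%E.
  apply: le_trans (mu_open (openI oB oV)); apply: mu_le; exact: setSI.
have oD : open (B `\` closure W1).
  by apply: openI => //; apply: closed_openC; exact: closed_closure.
have le2 : (mu (A `&` ~` V) <= inner (B `\` closure W1))%E.
  apply: le_trans (mu_open oD); apply: mu_le => x [Ax Vx]; split; first exact: AB.
  by move=> /W1BV[].
apply: le_trans (leeD le1 le2) _.
have W12 : W1 `&` W2 = set0.
  apply/seteqP; split => // x [x1 x2].
  by have [_] := W2B _ (subset_closure x2); apply; exact: subset_closure.
have : ((L (W1 `|` W2))%:E <= inner B)%E.
  apply: innerP; first exact: openU.
  by rewrite closureU => x [/W1BV[]|/W2B[]].
rewrite L_add//.
move: h1 h2; rewrite -!/(inner _).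
move: (innerf (B `&` V)) (innerf (B `\` closure W1)) (innerf B).
move: (inner _) (inner _) (inner _) => [a||] [b||] [c||]//= _ _ _.
rewrite -!EFinB -!EFinD !lte_fin !lee_fin; lra.
Qed.

Let cara_sub (A : set (borel T)) : measurable A -> caratheodory_measurable mu A.
Proof.
apply: smallest_sub; last exact: caratheodory_open.
split.
- exact: caratheodory_measurable_set0.
- by move=> B mB; rewrite setTD; exact: caratheodory_measurable_setC.
- by move=> F mF; exact: caratheodory_measurable_bigcup.
Qed.

Let mu_sigma : semi_sigma_additive mu.
Proof.
move=> F mF tF mUF.
apply: (caratheodory_measure_sigma_additive (mu := mu)) => //; last exact: cara_sub.
by move=> i; exact: (cara_sub (mF i)).
Qed.

HB.instance Definition _ := isMeasure.Build _ (borel T) R mu mu0 mu_ge0 mu_sigma.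

(** Equality with [L] cannot be expected, as [L] need not be countably additive. The two one-sided
    bounds suffice for Ahlfors regularity, whose constants are free. *)
Lemma radon_of_content : exists m : {measure set (borel T) -> \bar R},
  [/\ radon m, forall V : set T, open V -> (m V <= (L V)%:E)%E &
     forall K : set T, closed K -> ((L K)%:E <= m K)%E].
Proof.
exists mu; split; last exact: mu_closed.
- split.
  + move=> K _; apply: (@le_lt_trans _ _ (inner setT)); last first.
      by rewrite (le_lt_trans (inner_le _))// ltry.
    by apply: le_trans (mu_open openT); exact: mu_le.
  + move=> A mA; apply/eqP; rewrite eq_le; apply/andP; split.
      by apply: le_ereal_inf_tmp => _ [V [oV AV] <-]; exact: mu_le.
    apply: mu_leP => V oV AV; apply: le_trans (mu_open oV).
    by apply: ereal_inf_lbound; exists V.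
  + move=> V oV; apply/eqP; rewrite eq_le; apply/andP; split; last first.
      by apply: ge_ereal_sup => _ [K [_ KV] <-]; exact: mu_le.
    apply: (le_trans (mu_open oV)); apply: ge_ereal_sup => _ [W [oW cW] <-].
    apply: (@le_trans _ _ (mu (closure W))).
      apply: le_trans (mu_closed (closed_closure (A := W))).
      by rewrite lee_fin le_L//; exact: subset_closure.
    apply: ereal_sup_ubound; exists (closure W) => //; split => //.
- by move=> V oV; apply: le_trans (mu_open oV) (inner_le V).
Qed.

End radon_of_content.

(** * Chains of balls *)

Lemma split_prefix (T : Type) (P : pred T) (s : seq T) :
  exists p q, [/\ s = p ++ q, all P p & forall z q', q = z :: q' -> ~~ P z].
Proof.
elim: s => [|x s [p [q [-> Pp Pq]]]]; first by exists [::], [::].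
have [Px|nPx] := boolP (P x); first by exists (x :: p), q; rewrite /= Px.
by exists [::], (x :: p ++ q); split => // _ _ [<- _].
Qed.

Fixpoint chain_sum (R : realType) (X : Type) (q : X -> X -> R) (x : X)
    (xs : seq X) : R :=
  if xs is y :: ys then q x y + chain_sum q y ys else 0.

Fixpoint chain_all (X : Type) (P : X -> X -> Prop) (x : X) (xs : seq X)
    : Prop :=
  if xs is y :: ys then P x y /\ chain_all P y ys else True.

Section chain_descent.
Context {R : realType} {X : Type} (d : distance R X) {I : eqType}.
Variables (S : nat -> seq I) (ctr : nat -> I -> X) (inn : nat -> I -> X -> Prop).
Variables (r : nat -> R) (a : R) (cost : nat -> I -> R).
Hypothesis a6 : 6 <= a.
Hypothesis r_gt0 : forall n, 0 < r n.
Hypothesis rS : forall n, r n = a * r n.+1.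
Hypothesis S_cover : forall n x, exists2 v, v \in S n & inn n v x.
Hypothesis inn_dist : forall n v x, v \in S n -> inn n v x -> d (ctr n v) x < r n.
Hypothesis cost_ge0 : forall n v, 0 <= cost n v.
Hypothesis cost_cross : forall n v w0 ws z,
  v \in S n -> {subset w0 :: rcons ws z <= S n.+1} -> inn n v (ctr n.+1 w0) ->
  path (fun w w' => d (ctr n.+1 w) (ctr n.+1 w') <= 16 * r n.+1) w0 (rcons ws z) ->
  all (fun w => d (ctr n v) (ctr n.+1 w) < 2 * r n) (w0 :: ws) ->
  2 * r n <= d (ctr n v) (ctr n.+1 z) ->
  cost n v <= \sum_(w <- w0 :: ws) cost n.+1 w.

Let center (e : nat * I) : X := ctr e.1 e.2.
Let total (s : seq (nat * I)) : R := \sum_(e <- s) cost e.1 e.2.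
(** Each 4 is 1 + 3: from a center to the start of its edge, then along the edge. The 8 absorbs the
    jump over a dropped run: at most [4 * r l] inside [2 . v], plus 24 radii of level [l.+1], which
    6 <= a bounds by [4 * r l]. Between two vertices of level [l] the sum is [16 * r l], the
    adjacency that [cost_cross] accepts. *)
Let link l (e e' : nat * I) :=
  d (center e) (center e') <= 4 * r e.1 + 4 * r e'.1 + 8 * r l.
Let good n l (e : nat * I) := [&& (n <= e.1)%N, (e.1 <= l)%N & e.2 \in S e.1].

Let le_r l : 6 * r l.+1 <= r l.
Proof. by rewrite (rS l) ler_pM2r. Qed.

Let link_weak l e e' : link l.+1 e e' -> link l e e'.
Proof. by rewrite /link => /le_trans; apply; have := le_r l; have := r_gt0 l.+1; lra. Qed.

(* Each maximal run of vertices of level [l.+1] inside [2 . v] is replaced by [v],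
   whose cost is at most that of the run by [cost_cross]. *)
Lemma chain_step n l s u u' : (n <= l)%N -> (u.1 <= l)%N -> (u'.1 <= l)%N ->
  all (good n l.+1) s -> path (link l.+1) u (rcons s u') ->
  exists s', [/\ all (good n l) s', path (link l) u (rcons s' u') &
    total s' <= total s].
Proof.
move=> nl + u'l; have [k] := ubnP (size s); elim: k s u => // k ih s u.
have rl := r_gt0 l; have rSl := r_gt0 l.+1; have r6 := le_r l.
case: s => [_ _ _ /= /andP[/link_weak uu' _]|e s].
  by exists [::]; split => //=; rewrite uu'.
rewrite /= ltnS => sk ul /andP[ge gs] /andP[ue pes].
have [el|] := leqP e.1 l.
  have [s' [gs' ps' cs']] := ih s e sk el gs pes.
  exists (e :: s'); split.
  - rewrite /= gs' andbT; move: ge; rewrite /good el => /and3P[-> _ ->] //.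
  - by rewrite /= link_weak.
  - by rewrite /total !big_cons lerD2l.
move=> le; have {}le : e.1 = l.+1.
  by apply/eqP; rewrite eqn_leq le andbT; case/and3P: ge.
have [v vS vin] := S_cover l (center e).
have vd := inn_dist vS vin.
pose P (x : nat * I) := (x.1 == l.+1) && (d (ctr l v) (center x) < 2 * r l).
have Pe : P e by rewrite /P le eqxx /=; lra.
have [p [q [ps Pp Pq]]] := split_prefix P s.
have dP x : x \in e :: p -> d (ctr l v) (center x) < 2 * r l.
  rewrite inE => /predU1P[->|/(allP Pp)/andP[_]//].
  by case/andP: Pe.
have lP x : x \in e :: p -> x.1 = l.+1.
  by rewrite inE => /predU1P[->//|/(allP Pp)/andP[/eqP]].
move: pes; rewrite ps rcons_cat cat_path => /andP[pp pq].
have lastp := mem_last e p.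
have dv x : d (ctr l v) x <= d (ctr l v) (center (last e p)) + d (center (last e p)) x.
  exact: dist_triangle.
have gsp : all (good n l.+1) p /\ all (good n l.+1) q.
  by move: gs; rewrite ps all_cat => /andP.
have sq : (size q <= size s)%N by rewrite ps size_cat leq_addl.
(* A run that never leaves [2 . v] is dropped: [u] jumps over it to [z]. *)
have skip z : link l.+1 (last e p) z -> link l u z.
  rewrite /link => h.
  have h1 := dist_triangle d (center e) (center u) (center z).
  have h2 := dist_triangle d (ctr l v) (center e) (center z).
  have h3 := dv (center z); have h4 := dP _ lastp.
  have h5 := dP _ (mem_head e p).
  have h6 := distC d (ctr l v) (center e).
  move: ue h; rewrite /link le (lP _ lastp); lra.
case qE : q => [|z q'].
  move: pq; rewrite qE /= andbT => h.
  exists [::]; split => //=; first by rewrite skip.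
  by rewrite /total big_nil sumr_ge0.
move: pq; rewrite qE /= => /andP[pz pq'].
have [gp gq] := gsp; move: gq; rewrite qE /= => /andP[gz gq'].
have [zl|lz] := leqP z.1 l.
  have q'k : (size q' < k)%N by apply: leq_trans _ (ltnW sk); move: sq; rewrite qE.
  have [s' [gs' ps' cs']] := ih q' z q'k zl gq' pq'.
  exists (z :: s'); split.
  - rewrite /= gs' andbT; move: gz; rewrite /good zl => /and3P[-> _ ->] //.
  - by rewrite /= skip.
  - rewrite /total !big_cons big_cat /= big_cons.
    rewrite -[X in X <= _]add0r lerD// addrCA lerD2l.
    by rewrite -[X in X <= _]add0r lerD// sumr_ge0.
have {}lz : z.1 = l.+1.
  by apply/eqP; rewrite eqn_leq lz andbT; case/and3P: gz.
have dz : 2 * r l <= d (ctr l v) (center z).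
  by have := Pq _ _ qE; rewrite /P lz eqxx /= leNgt.
(* [z] has left [2 . v] but stays in the sequence to open the next run, now reached from [v];
   [cost_cross] does not charge it. *)
have [|//|||s' [gs' ps' cs']] := ih (z :: q') (l, v).
- by apply: leq_ltn_trans sk; move: sq; rewrite qE.
- by rewrite /= gz.
- rewrite /= pq' andbT /link /= lz.
  have := dv (center z); have := dP _ lastp; move: pz; rewrite /link (lP _ lastp) lz; lra.
exists ((l, v) :: s'); split.
- by rewrite /= gs' andbT /good /= nl leqnn vS.
- rewrite /= ps' andbT /link /=.
  have := dist_triangle d (center e) (center u) (ctr l v).
  have h6 := distC d (ctr l v) (center e).
  move: ue; rewrite /link le; lra.
have cc : cost l v <= \sum_(w <- e.2 :: map snd p) cost l.+1 w.
  apply: (cost_cross (z := z.2)) => //.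
  - move=> w; rewrite -map_rcons -(map_cons snd e) => /mapP[x xin ->].
    have : good n l.+1 x.
      move: xin; rewrite inE mem_rcons inE => /or3P[/eqP->//|/eqP->//|].
      exact: (allP gp).
    have -> : l.+1 = x.1.
      move: xin; rewrite inE mem_rcons inE => /or3P[/eqP->//|/eqP->//|xp].
      by rewrite lP// inE xp orbT.
    by case/and3P.
  - by move: vin; rewrite /center le.
  - rewrite -map_rcons path_map.
    have : path (link l.+1) e (rcons p z) by rewrite rcons_path pp pz.
    apply: (sub_in_path (P := fun x => x.1 == l.+1)).
      move=> x y /eqP xl /eqP yl; rewrite /relpre /= /link /center xl yl.
      lra.
    rewrite /= le eqxx all_rcons lz eqxx /=.
    by apply/allP => x xp; rewrite lP// inE xp orbT.
  - rewrite -(map_cons snd e) all_map; apply/allP => x xp /=.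
    by have := dP _ xp; rewrite /center lP.
  - by move: dz; rewrite /center lz.
rewrite /total big_cons /= big_cons big_cat /= addrA.
apply: lerD => //; apply: le_trans cc _.
rewrite big_cons big_map le le_eqVlt; apply/orP; left; apply/eqP; congr (_ + _).
by rewrite big_seq [RHS]big_seq; apply: eq_bigr => x xp; rewrite lP// inE xp orbT.
Qed.

Lemma chain_descent n k s u u' : u.1 = n -> u'.1 = n ->
  all (good n (n + k)) s -> path (link (n + k)) u (rcons s u') ->
  16 * r n < d (center u) (center u') ->
  exists2 v, v \in S n & d (center u) (ctr n v) <= 16 * r n /\ cost n v <= total s.
Proof.
move=> un u'n; elim: k s => [|k ih] s; last first.
  rewrite addnS => gs ps uu'.
  have [s' [gs' ps' cs']] : exists s', [/\ all (good n (n + k)) s',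
      path (link (n + k)) u (rcons s' u') & total s' <= total s].
    by apply: chain_step => //; rewrite ?un ?u'n leq_addr.
  have [v vS [uv vs]] := ih s' gs' ps' uu'.
  by exists v => //; split => //; exact: le_trans cs'.
(* At level [n] linked centers are within [16 * r n], so the chain cannot be empty, and its first
   vertex is the witness. *)
rewrite addn0; case: s => [_|e s] /=.
  by rewrite /link un u'n andbT; have := r_gt0 n; lra.
move=> /andP[/and3P[ne en eS] _] /andP[ue _] _.
have {ne en}ne : e.1 = n by apply/eqP; rewrite eqn_leq en ne.
exists e.2; first by rewrite -ne.
split.
  by move: ue; rewrite /link /center un ne; have := r_gt0 n; lra.
by rewrite /total big_cons ne lerDl sumr_ge0.
Qed.

Variable q : X -> X -> R.
Hypothesis q_ge0 : forall x y, 0 <= q x y.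

Let fine_edge n y y' := y <> y' ->
  exists m v, [/\ (n <= m)%N, v \in S m, inn m v y, d y y' <= 3 * r m &
    cost m v <= q y y'].

(** The ends [u] and [u'] stay free so that the induction can take the vertex of the first edge as
    the next [u]. The slack [8 * r l] is not consumed, hence every [l] is allowed. *)
Let chain_vertices n x xs : chain_all (fine_edge n) x xs ->
  exists s k, [/\ all (good n (n + k)) s, total s <= chain_sum q x xs &
    forall u u' l, d (center u) x <= 4 * r u.1 ->
      d (last x xs) (center u') <= r u'.1 -> path (link l) u (rcons s u')].
Proof.
elim: xs x => [x _|y ys ih x /= [xy /ih[s [k [gs ss ps]]]]].
  exists [::], 0%N; split => //; first by rewrite /total big_nil.
  move=> u u' l /= ux xu'; rewrite andbT /link.
  have := dist_triangle d x (center u) (center u').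
  by have := r_gt0 l; have := r_gt0 u'.1; lra.
have [xy0|/xy[m [v [nm vS vin xm cv]]]] := pselect (x = y).
  exists s, k; split => //; last by rewrite xy0.
  by rewrite (le_trans ss)// lerDr.
exists ((m, v) :: s), (k + m)%N; split.
- rewrite /= /good /= nm vS /= andbT; apply/andP; split; first by lia.
  by apply: sub_all gs => e /and3P[h1 h2 ->]; rewrite h1 andbT; lia.
- by rewrite /total big_cons lerD.
move=> u u' l ux yu' /=; have vd := inn_dist vS vin.
rewrite ps ?andbT //=.
  rewrite /link -[center (m, v)]/(ctr m v) /=.
  have := dist_triangle d x (center u) (ctr m v).
  have := distC d (ctr m v) x; have := r_gt0 l; have := r_gt0 m; lra.
rewrite -[center (m, v)]/(ctr m v).
by have := dist_triangle d x (ctr m v) y; lra.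
Qed.

Lemma chain_cost n x xs : chain_all (fine_edge n) x xs ->
  18 * r n < d x (last x xs) ->
  exists2 v, v \in S n &
    d x (ctr n v) <= 17 * r n /\ cost n v <= chain_sum q x xs.
Proof.
move=> /chain_vertices[s [k [gs ss ps]]] xl.
(* Replacing both ends by vertices of level [n] loses [2 * r n]: 18 - 2 = 16 keeps them too far
   apart to be linked, and 16 + 1 = 17 bounds the distance from [x] to the vertex found. *)
have [v vS /(inn_dist vS) vx] := S_cover n x.
have [v' v'S /(inn_dist v'S) vl] := S_cover n (last x xs).
have lv := distC d (ctr n v') (last x xs).
have t1 := dist_triangle d (ctr n v) x (last x xs).
have t2 := dist_triangle d (ctr n v') (ctr n v) (last x xs).
have xv := distC d (ctr n v) x.
have rn := r_gt0 n.
have pu : path (link (n + k)) (n, v) (rcons s (n, v')).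
  by apply: ps; rewrite /center /=; lra.
have far : 16 * r n < d (center (n, v)) (center (n, v')).
  by rewrite /center /=; lra.
have [w wS [vw cw]] := @chain_descent n k s (n, v) (n, v') (erefl _) (erefl _) gs pu far.
exists w => //; split; last exact: le_trans ss.
have := dist_triangle d (ctr n v) x (ctr n w); move: vw; rewrite /center /=; lra.
Qed.

End chain_descent.

(** * Masses satisfying a Harnack inequality *)

(** A subsequence could not serve uncountably many sets at once; along an ultrafilter every bounded
    sequence converges, and the limits respect sums and eventual bounds. *)
Lemma ultra_limit (R : realType) (X : Type) (L : nat -> set X -> R) (M : R) :
  (forall n A, 0 <= L n A <= M) ->
  (forall n A B, A `&` B = set0 -> L n (A `|` B) = L n A + L n B) ->
  exists F : set X -> R, [/\
    forall A B, A `&` B = set0 -> F (A `|` B) = F A + F B,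
    forall A c N, (forall n, (N <= n)%N -> c <= L n A) -> c <= F A &
    forall A c N, (forall n, (N <= n)%N -> L n A <= c) -> F A <= c].
Proof.
move=> LM Ladd.
have [G [GU Goo]] := ultraFilterLemma (eventually_filter : ProperFilter \oo).
have GP : ProperFilter G by exact: ultra_proper.
have cvgL A : exists l : R, L n A @[n --> G] --> l.
  have : (L^~ A @ G) `[0, M]%classic.
    by apply: nearW => n /=; rewrite in_itv /=.
  move=> /(segment_compact (a := 0) (b := M) _)[l [_ lcl]].
  exists l => B Bl.
  have [//|nB] := in_ultra_setVsetC (L^~ A @^-1` B) GU.
  by have [x []] := lcl (~` B) B nB Bl.
have [F FP] := choice cvgL.
exists F; split.
- move=> A B AB; apply: (cvg_unique _ (FP _)) => //.
  rewrite (_ : (fun n => _) = (fun n => L n A + L n B)); last first.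
    by apply/funext => n; exact: Ladd.
  by apply: cvgD; exact: FP.
- move=> A c N cN; have h : \forall n \near G, c <= L n A by apply: Goo; exists N.
  exact: (@closed_cvg _ _ G GP (L^~ A) (fun y : R => c <= y) (@closed_ge _ c) h _ (FP A)).
- move=> A c N cN; have h : \forall n \near G, L n A <= c by apply: Goo; exists N.
  exact: (@closed_cvg _ _ G GP (L^~ A) (fun y : R => y <= c) (@closed_le _ c) h _ (FP A)).
Qed.

(** * Transport of mass by a smeared Markov kernel *)

Section masses.
Context {R : realType} {X : Type} (d : distance R X) {I : eqType}.
Variables (S : nat -> seq I) (ctr : nat -> I -> X) (r : nat -> R).
Variables (a L C eta Q : R) (tau : nat -> I -> I -> R).
Hypothesis a14 : 14 <= a.
Hypothesis r_gt0 : forall n, 0 < r n.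
Hypothesis rS : forall n, r n = a * r n.+1.
Hypothesis S_cover : forall n x, exists2 v, v \in S n & d (ctr n v) x < r n.
Hypothesis L_gt0 : 0 < L.
Hypothesis C_ge1 : 1 <= C.
Hypothesis sum_expR : forall n x,
  \sum_(v <- S n) expR (- (L * (d x (ctr n v) / r n))) <= C.
Hypothesis eta_gt0 : 0 < eta.
Hypothesis tau_ge0 : forall n v w, 0 <= tau n v w.
Hypothesis tau_far : forall n v w,
  2 * r n <= d (ctr n v) (ctr n.+1 w) -> tau n v w = 0.
Hypothesis tau_near : forall n v w,
  d (ctr n v) (ctr n.+1 w) < 2 * r n -> eta <= tau n v w.
Hypothesis tau_sum : forall n v, v \in S n ->
  C * (\sum_(w <- S n.+1) tau n v w) <= 1.
Hypothesis Q2 : 2 <= Q.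
Hypothesis Q_large : 2 * C / eta ^+ 2 <= expR (L * ((a - 13) * Q - 2 * a)).

Let le_r n : 14 * r n.+1 <= r n.
Proof. by rewrite (rS n) ler_pM2r. Qed.

Let le_sum1 (J : eqType) (s : seq J) (f : J -> R) j :
  (forall i, 0 <= f i) -> j \in s -> f j <= \sum_(i <- s) f i.
Proof.
move=> f0 js; rewrite (perm_big _ (perm_to_rem js)) big_cons lerDl.
exact: sumr_ge0.
Qed.

(* The smeared kernel is log-Lipschitz at scale [r n.+1], and the cut-off bounds
   how far mass moves in one step. *)
Definition smear n v w : R :=
  \sum_(w' <- S n.+1) tau n v w' *
    expR (- (L * (d (ctr n.+1 w) (ctr n.+1 w') / r n.+1))).

Definition cut_smear n v w : R :=
  if d (ctr n v) (ctr n.+1 w) <= Q * r n then smear n v w else 0.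

Definition smear_mass n v : R := \sum_(w <- S n.+1) cut_smear n v w.

Definition transition n v w : R := cut_smear n v w / smear_mass n v.

Fixpoint mass n w {struct n} : R :=
  if n is k.+1 then \sum_(v <- S k) mass k v * transition k v w else 1.

Let smear_ge0 n v w : 0 <= smear n v w.
Proof. by apply: sumr_ge0 => w' _; rewrite mulr_ge0// expR_ge0. Qed.

Let cut_ge0 n v w : 0 <= cut_smear n v w.
Proof. by rewrite /cut_smear; case: ifP. Qed.

Let smear_lip n v w w' t : d (ctr n.+1 w) (ctr n.+1 w') <= t * r n.+1 ->
  smear n v w <= expR (L * t) * smear n v w'.
Proof.
move=> ww'; rewrite /smear mulr_sumr; apply: ler_sum => w'' _.
rewrite [leRHS]mulrCA ler_wpM2l// -expRD ler_expR.
have h := dist_triangle d (ctr n.+1 w) (ctr n.+1 w') (ctr n.+1 w'').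
have : d (ctr n.+1 w') (ctr n.+1 w'') / r n.+1 <=
    t + d (ctr n.+1 w) (ctr n.+1 w'') / r n.+1.
  rewrite -(ler_pM2r (r_gt0 n.+1)) mulrDl !divfK ?gt_eqF//.
  by rewrite distC in ww'; lra.
by move=> /(ler_wpM2l (ltW L_gt0)); rewrite mulrDr; lra.
Qed.

Let tau_le_smear n v w : w \in S n.+1 -> tau n v w <= smear n v w.
Proof.
move=> wS; apply: le_trans (le_sum1 _ wS).
  by rewrite distxx mul0r mulr0 oppr0 expR0 mulr1.
by move=> w'; rewrite mulr_ge0// expR_ge0.
Qed.

Let tau_le_cut n v w : w \in S n.+1 -> tau n v w <= cut_smear n v w.
Proof.
move=> wS; rewrite /cut_smear; case: ifPn => [_|]; first exact: tau_le_smear.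
rewrite -ltNge => h; rewrite tau_far//.
have : 2 * r n <= Q * r n by rewrite ler_pM2r.
lra.
Qed.

Let smear_mass_le1 n v : v \in S n -> smear_mass n v <= 1.
Proof.
move=> vS; apply: le_trans (tau_sum vS).
apply: (@le_trans _ _ (\sum_(w <- S n.+1) smear n v w)).
  by apply: ler_sum => w _; rewrite /cut_smear; case: ifP.
rewrite exchange_big /= mulr_sumr; apply: ler_sum => w' _.
rewrite -mulr_sumr mulrC ler_wpM2r//.
apply: le_trans (sum_expR n.+1 (ctr n.+1 w')).
by apply: ler_sum => w _; rewrite distC.
Qed.

Let smear_mass_ge n v : eta <= smear_mass n v.
Proof.
have [w wS wv] := S_cover n.+1 (ctr n v).
apply: (@le_trans _ _ (cut_smear n v w)); last exact: le_sum1.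
apply: le_trans (tau_le_cut _ wS); apply: tau_near.
by rewrite distC; have := le_r n; have := r_gt0 n.+1; lra.
Qed.

Let smear_mass_gt0 n v : 0 < smear_mass n v.
Proof. exact: lt_le_trans (smear_mass_ge n v). Qed.

Let transition_ge0 n v w : 0 <= transition n v w.
Proof. by rewrite divr_ge0// ltW. Qed.

Let transition_sum n v : \sum_(w <- S n.+1) transition n v w = 1.
Proof. by rewrite /transition -mulr_suml -/(smear_mass n v) divff// gt_eqF. Qed.

Let transition_le1 n v w : w \in S n.+1 -> transition n v w <= 1.
Proof. by move=> wS; rewrite -(transition_sum n v); exact: le_sum1. Qed.

(** The kernel sums to at most [C], a factor already present in [tau_sum]; so [smear_mass] is at
    most 1 and normalising only increases the weights. The cut-off spares the support of [tau]
    because 2 <= Q. *)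
Let tau_le_transition n v w : v \in S n -> w \in S n.+1 ->
  tau n v w <= transition n v w.
Proof.
move=> vS wS; rewrite ler_pdivlMr//.
apply: le_trans (tau_le_cut v wS); rewrite -[leRHS]mulr1.
by rewrite ler_wpM2l// smear_mass_le1.
Qed.

Let transition_far n v w : Q * r n < d (ctr n v) (ctr n.+1 w) ->
  transition n v w = 0.
Proof. by move=> h; rewrite /transition /cut_smear leNgt h mul0r. Qed.

Let mass_ge0 n v : 0 <= mass n v.
Proof.
elim: n v => [|n ih] v //=; apply: sumr_ge0 => w _; exact: mulr_ge0.
Qed.

Lemma mass_tau n v w : v \in S n -> w \in S n.+1 ->
  mass n v * tau n v w <= mass n.+1 w.
Proof.
move=> vS wS /=; apply: (@le_trans _ _ (mass n v * transition n v w)).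
  by rewrite ler_wpM2l// tau_le_transition.
apply: (@le_sum1 _ (S n) (fun v => mass n v * transition n v w)) => //.
by move=> v'; exact: mulr_ge0.
Qed.

Lemma mass_near n v w : v \in S n -> w \in S n.+1 ->
  d (ctr n v) (ctr n.+1 w) < 2 * r n -> eta * mass n v <= mass n.+1 w.
Proof.
move=> vS wS vw; apply: le_trans (mass_tau vS wS).
by rewrite mulrC ler_wpM2l// tau_near.
Qed.

Lemma mass_gt0 n v : v \in S n -> 0 < mass n v.
Proof.
elim: n v => [|n ih] w wS; first by rewrite /=.
have [v vS vw] := S_cover n (ctr n.+1 w).
apply: lt_le_trans (mass_near vS wS _); last by have := r_gt0 n; lra.
by rewrite mulr_gt0// ih.
Qed.

(** Each counted center contributes at least [expR (- (L * t))] to a sum bounded by [C]. *)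
Let sum_near n x t (c : R) : 0 <= c ->
  \sum_(v <- S n | d x (ctr n v) <= t * r n) c <= C * expR (L * t) * c.
Proof.
move=> c0; rewrite big_mkcond /=.
have h : \sum_(v <- S n) expR (- (L * (d x (ctr n v) / r n))) * (expR (L * t) * c)
    <= C * expR (L * t) * c.
  by rewrite -mulr_suml -mulrA ler_wpM2r// mulr_ge0// expR_ge0.
apply: le_trans h; apply: ler_sum => v _; case: ifP => [vx|_]; last first.
  by rewrite !mulr_ge0// expR_ge0.
rewrite mulrA -expRD ler_peMl// -expR0 ler_expR addrC subr_ge0 ler_pM2l//.
by rewrite ler_pdivrMr.
Qed.

Let H := expR (L * (6 * Q)) + 1.

Let near_Q n w : w \in S n.+1 -> mass n.+1 w <=
  \sum_(v <- S n | d (ctr n v) (ctr n.+1 w) <= Q * r n) mass n v.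
Proof.
move=> wS /=; rewrite [leRHS]big_mkcond /=; apply: ler_sum => v _.
case: ifPn => [_|]; first by rewrite ler_piMr// transition_le1.
by rewrite -ltNge => h; rewrite transition_far// mulr0.
Qed.

(* [Q] is so large that the exponentially small mass lost by cutting the
   kernel off is absorbed into the summand [1] of [H]. *)
Lemma mass_harnack n v v' : v \in S n -> v' \in S n ->
  d (ctr n v) (ctr n v') <= 6 * Q * r n -> mass n v <= H * mass n v'.
Proof.
have L0 := ltW L_gt0; have H0 : 0 < expR (L * (6 * Q)) by exact: expR_gt0.
elim: n v v' => [|n ih] w w' wS w'S ww'.
  by rewrite /= mulr1 /H lerDr ltW.
have rn := r_gt0 n; have rn1 := r_gt0 n.+1; have r14 := le_r n.
have [v0 v0S v0w] := S_cover n (ctr n.+1 w').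
have m0 : eta * mass n v0 <= mass n.+1 w' by apply: mass_near => //; lra.
pose far v := Q * r n < d (ctr n v) (ctr n.+1 w').
rewrite [leLHS]/= (bigID far) /= addrC /H mulrDl mul1r; apply: lerD.
  apply: (@le_trans _ _ (\sum_(v <- S n) expR (L * (6 * Q)) *
      (mass n v * transition n v w'))); last by rewrite -mulr_sumr.
  rewrite big_mkcond /=; apply: ler_sum => v _.
  case: ifPn => [nf|_]; last by apply: mulr_ge0; [exact: ltW|exact: mulr_ge0].
  rewrite [leRHS]mulrCA ler_wpM2l// /transition [leRHS]mulrA.
  rewrite ler_wpM2r ?invr_ge0 ?(ltW (smear_mass_gt0 _ _))//.
  move: nf; rewrite /far -leNgt /cut_smear => ->.
  case: ifP => _; last by rewrite mulr_ge0// ltW.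
  exact: smear_lip.
have Q0 : 0 <= Q by exact: le_trans Q2.
have Qr : Q * (14 * r n.+1) <= Q * r n by rewrite ler_wpM2l.
have Q2r : 2 * r n <= Q * r n by rewrite ler_pM2r.
(* [tau n v] lives within [2 * r n] of [v], that is 2 a radii of level [n.+1]; a far [v] is more
   than a Q such radii from [w'], which is within 6 Q of [w]. So the kernel between [w] and this
   support is at most [E]. *)
pose E := expR (- (L * ((a - 6) * Q - 2 * a))).
have E0 : 0 < E by exact: expR_gt0.
have H_ge0 : 0 <= H by rewrite addr_ge0// ltW.
have small v : v \in S n -> far v -> d (ctr n v) (ctr n.+1 w) <= Q * r n ->
    mass n v * transition n v w <= (H * mass n v0) * (E / eta).
  move=> vS fv vw.
  (* Going up one level divides the distance from [w] to [w'], in radii, by at least 14; so vertices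
     near them are again within 6 Q radii, and the induction closes with the same [H]. *)
  have vv0 : mass n v <= H * mass n v0.
    apply: ih => //.
    have := dist_triangle d (ctr n.+1 w) (ctr n v) (ctr n.+1 w').
    have := dist_triangle d (ctr n.+1 w') (ctr n v) (ctr n v0).
    by have := distC d (ctr n.+1 w') (ctr n v0); lra.
  apply: ler_pM => //.
  rewrite /transition ler_pM ?invr_ge0 ?(ltW (smear_mass_gt0 _ _))//; last first.
    by rewrite lef_pV2 ?posrE//.
  rewrite /cut_smear vw.
  apply: (@le_trans _ _ (\sum_(w'' <- S n.+1) tau n v w'' * E)).
    apply: ler_sum => w'' _.
    have [vw''|vw''] := leP (2 * r n) (d (ctr n v) (ctr n.+1 w'')).
      by rewrite tau_far// !mul0r.
    rewrite ler_wpM2l// ler_expR lerN2 ler_pM2l//.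
    rewrite ler_pdivlMr//.
    have := distC d (ctr n.+1 w'') (ctr n.+1 w).
    have := dist_triangle d (ctr n.+1 w) (ctr n.+1 w'') (ctr n.+1 w').
    have := dist_triangle d (ctr n.+1 w'') (ctr n v) (ctr n.+1 w').
    move: fv; rewrite /far (rS n).
    move: vw''; rewrite (rS n); lra.
  rewrite -mulr_suml -[leRHS]mul1r ler_wpM2r ?(ltW E0)//.
  apply: le_trans (tau_sum vS); rewrite ler_peMl// sumr_ge0//.
apply: (@le_trans _ _ (\sum_(v <- S n | d (ctr n.+1 w) (ctr n v) <= Q * r n)
    (H * mass n v0) * (E / eta))).
  rewrite big_mkcond [leRHS]big_mkcond /= big_seq [leRHS]big_seq.
  apply: ler_sum => v vS; rewrite [d (ctr n.+1 w) _]distC.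
  case: ifPn => [fv|_].
    case: ifPn => [vw|]; first exact: small.
    by rewrite -ltNge => vw; rewrite transition_far// mulr0.
  by case: ifP => _ //; apply: mulr_ge0; [exact: mulr_ge0|rewrite divr_ge0// ltW].
apply: le_trans (sum_near _ _ _ _) _.
  by apply: mulr_ge0; [exact: mulr_ge0|rewrite divr_ge0// ltW].
apply: le_trans m0.
set c := mass n v0; have c0 : 0 <= c by exact: mass_ge0.
have H2 : H <= 2 * expR (L * (6 * Q)).
  have : expR 0 <= expR (L * (6 * Q)).
    by rewrite ler_expR mulr_ge0// mulr_ge0.
  by rewrite expR0 /H; lra.
rewrite (_ : _ * _ = (C * expR (L * Q) * H * E / eta ^+ 2) * (eta * c)); last first.
  by field; rewrite gt_eqF.
apply: ler_piMl; first by rewrite mulr_ge0// ltW.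
apply: (@le_trans _ _ (C * expR (L * Q) * (2 * expR (L * (6 * Q))) * E / eta ^+ 2)).
  rewrite ler_wpM2r ?invr_ge0 ?sqr_ge0// ler_wpM2r ?(ltW E0)// ler_wpM2l//.
  by rewrite mulr_ge0 ?expR_ge0// (le_trans _ C_ge1).
rewrite (_ : _ / _ = (2 * C / eta ^+ 2) * (expR (L * Q) * expR (L * (6 * Q)) * E)); last first.
  by field; rewrite gt_eqF.
(* From the exponent (a - 6) Q - 2 a of [E], counting the vertices near [w] takes Q and [H] takes 6
   Q. What remains is the (a - 13) Q - 2 a of [Q_large], which a large [Q] can satisfy because [a]
   exceeds 13. *)
rewrite /E -!expRD.
apply: le_trans (ler_wpM2r (expR_ge0 _) Q_large) _.
by rewrite -expRD [X in expR X](_ : _ = 0) ?expR0//; ring.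
Qed.

Let content n (A : set X) : R := \sum_(v <- S n | `[< A (ctr n v) >]) mass n v.

Let content_step_up n (A B : set X) : (forall v w, A (ctr n.+1 w) ->
    d (ctr n v) (ctr n.+1 w) <= Q * r n -> B (ctr n v)) ->
  content n.+1 A <= content n B.
Proof.
move=> AB; rewrite /content /= exchange_big /= [leRHS]big_mkcond /=.
apply: ler_sum => v _; rewrite -mulr_sumr; case: ifPn => [_|nB].
  rewrite ler_piMr// -(transition_sum n v) [leLHS]big_mkcond /=.
  by apply: ler_sum => w _; case: ifP.
rewrite big1 ?mulr0// => w /asboolP Aw; apply: transition_far.
by rewrite ltNge; apply: contra nB => vw; apply/asboolP; exact: AB vw.
Qed.

Let content_step_down n (A B : set X) : (forall v w, A (ctr n v) ->
    d (ctr n v) (ctr n.+1 w) <= Q * r n -> B (ctr n.+1 w)) ->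
  content n A <= content n.+1 B.
Proof.
move=> AB; rewrite /content /= exchange_big /= [leLHS]big_mkcond /=.
apply: ler_sum => v _; rewrite -mulr_sumr; case: ifPn => [/asboolP Av|_].
  rewrite -[leLHS]mulr1 ler_wpM2l// -(transition_sum n v) [leRHS]big_mkcond /=.
  apply: ler_sum => w _; case: ifPn => // nB; rewrite transition_far// ltNge.
  by apply: contra nB => vw; apply/asboolP; exact: AB vw.
by rewrite mulr_ge0// sumr_ge0.
Qed.

Let cball x rho : set X := [set y | d x y < rho].

Let le_content n (A B : set X) : A `<=` B -> content n A <= content n B.
Proof.
move=> AB; rewrite /content big_mkcond [leRHS]big_mkcond /=.
apply: ler_sum => v _; case: ifPn => [/asboolP/AB/asboolP->//|_].
by case: ifP.
Qed.

(** The step at level i moves mass by at most [Q * r i], which is below 2 Q (r i - r i.+1) because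
    the radii at least halve; in this form the displacements telescope. *)
Let content_up n k x rho : content (n + k) (cball x rho) <=
  content n (cball x (rho + 2 * Q * (r n - r (n + k)))).
Proof.
have Q0 : 0 <= Q by exact: le_trans Q2.
elim: k rho => [|k ih] rho; first by rewrite addn0 subrr mulr0 addr0.
rewrite addnS.
apply: (@le_trans _ _ (content (n + k) (cball x (rho + Q * r (n + k))))).
  apply: content_step_up => v w; rewrite /cball /= => xw vw.
  have := dist_triangle d (ctr (n + k).+1 w) x (ctr (n + k) v).
  by have := distC d (ctr (n + k).+1 w) (ctr (n + k) v); lra.
apply: le_trans (ih _) _; apply: le_content => y; rewrite /cball /=.
have := ler_wpM2l Q0 (le_r (n + k)).
have : 0 <= Q * r (n + k).+1 by rewrite mulr_ge0// ltW.
by lra.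
Qed.

Let content_down n k x rho : content n (cball x rho) <=
  content (n + k) (cball x (rho + 2 * Q * (r n - r (n + k)))).
Proof.
have Q0 : 0 <= Q by exact: le_trans Q2.
elim: k => [|k ih]; first by rewrite addn0 subrr mulr0 addr0.
rewrite addnS; apply: le_trans ih _.
apply: content_step_down => v w; rewrite /cball /= => xv vw.
have := dist_triangle d (ctr (n + k) v) x (ctr (n + k).+1 w).
have := ler_wpM2l Q0 (le_r (n + k)).
have : 0 <= Q * r (n + k).+1 by rewrite mulr_ge0// ltW.
by lra.
Qed.

Let content_setT n : content n setT = (size (S 0))%:R.
Proof.
elim: n => [|n <-].
  rewrite /content /= (eq_bigl predT) ?big_const_seq.
    by rewrite count_predT iter_addr addr0.
  by move=> v; rewrite asboolT.
by apply/eqP; rewrite eq_le content_step_up// content_step_down.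
Qed.

(** From level [n] on, mass drifts by less than [2 * Q * r n]. So a ball of 3 Q radii keeps the mass
    that starts within 2 radii of [x], and all it receives starts within 5 Q of [x], hence within 6
    Q of [v], the range of [mass_harnack]. *)
Lemma mass_content : exists F : set X -> R, [/\
  forall A, 0 <= F A,
  forall A B, A `&` B = set0 -> F (A `|` B) = F A + F B,
  F setT = (size (S 0))%:R &
  forall n v x, v \in S n -> d x (ctr n v) <= r n ->
    mass n v <= F [set y | d x y < 3 * Q * r n] <=
    C * expR (L * (5 * Q)) * (H * mass n v)].
Proof.
have Q0 : 0 <= Q by exact: le_trans Q2.
have [||F [Fadd Fge Fle]] := @ultra_limit R X content (size (S 0))%:R.
- move=> n A; rewrite -(content_setT n) le_content// andbT.
  by apply: sumr_ge0.
- move=> n A B AB; rewrite /content !(big_mkcond (fun v => `[< _ >])) /=.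
  rewrite -big_split /=; apply: eq_bigr => v _.
  have [Av|nA] := pselect (A (ctr n v)).
    have nB : ~ B (ctr n v) by move=> Bv; have : set0 (ctr n v) by rewrite -AB.
    by rewrite (asboolT Av) (asboolF nB) addr0 asboolT//; left.
  rewrite (asboolF nA) add0r; congr (if _ then _ else _).
  by apply: asbool_equiv_eq; split => [[]//|]; right.
exists F; split => //.
- by move=> A; apply: (Fge _ _ 0%N) => n _; exact: sumr_ge0.
- apply/eqP; rewrite eq_le (Fle _ _ 0%N) ?(Fge _ _ 0%N)// => n _;
  by rewrite content_setT.
move=> n v x vS xv; have rn := r_gt0 n.
have Q2r : 2 * r n <= Q * r n by rewrite ler_pM2r.
have rk k : 0 < Q * r (n + k) by rewrite mulr_gt0// (lt_le_trans _ Q2).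
apply/andP; split.
  apply: (Fge _ _ n) => k /subnKC <-.
  apply: le_trans (_ : content n (cball x (2 * r n)) <= _).
    rewrite /content [leRHS]big_mkcond /=.
    have -> : mass n v = if `[< cball x (2 * r n) (ctr n v) >] then mass n v else 0.
      by rewrite asboolT// /cball /=; lra.
    apply: (@le_sum1 _ (S n) (fun v => if `[< cball x (2 * r n) (ctr n v) >]
      then mass n v else 0)) => // i.
    by case: ifP.
  apply: le_trans (content_down _ _ _ _) _; apply: le_content => y.
  by rewrite /cball /=; have := rk (k - n)%N; lra.
apply: (Fle _ _ n) => k /subnKC <-; apply: le_trans (content_up _ _ _ _) _.
have H0 : 0 <= H * mass n v by rewrite mulr_ge0// addr_ge0// expR_ge0.
apply: le_trans (sum_near n x (5 * Q) H0).
rewrite /content big_mkcond [leRHS]big_mkcond /= big_seq [leRHS]big_seq.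
apply: ler_sum => v' v'S; case: ifPn => [/asboolP|_]; last by case: ifP.
rewrite /cball /= => xv'; have xv'5 : d x (ctr n v') <= 5 * Q * r n.
  by have := rk (k - n)%N; lra.
rewrite xv'5; apply: mass_harnack => //.
have := dist_triangle d x (ctr n v') (ctr n v).
by have := distC d x (ctr n v'); lra.
Qed.

End masses.

(** * The limit content along chains *)

Lemma exists_exp2_ge (R : realType) (c : R) : exists j, c <= 2 ^+ j.
Proof.
exists (Num.bound `|c|); apply: le_trans (ler_norm c) _.
apply: le_trans (ltW (archi_boundP (normr_ge0 c))) _.
by rewrite -natrX ler_nat ltnW// ltn_expl.
Qed.

Lemma dist_ge0 (R : realType) (X : Type) (d : distance R X) x y : 0 <= d x y.
Proof. by have := dist_triangle d y x x; rewrite distxx [d y x]distC; lra. Qed.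

Lemma dist_gt0 (R : realType) (X : Type) (d : distance R X) x y :
  x <> y -> 0 < d x y.
Proof.
move=> xy; rewrite lt_neqAle dist_ge0 andbT eq_sym.
by apply/eqP => h; exact/xy/(dist_eq0 h).
Qed.

Section chain_extraction.
Context {R : realType} {X : Type} (d : distance R X).

Lemma chain_sum_ge0 (q : X -> X -> R) x xs :
  (forall y y', 0 <= q y y') -> 0 <= chain_sum q x xs.
Proof. by move=> q0; elim: xs x => //= y ys ih x; rewrite addr_ge0. Qed.

Lemma chain_sum_cat (q : X -> X -> R) x xs ys :
  chain_sum q x (xs ++ ys) = chain_sum q x xs + chain_sum q (last x xs) ys.
Proof. by elim: xs x => [|z xs ih] x /=; rewrite ?add0r// ih addrA. Qed.

Lemma chain_first_exit x0 x xs rho : d x0 x < rho -> rho <= d x0 (last x xs) ->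
  exists ys zs, [/\ xs = ys ++ zs, rho <= d x0 (last x ys) &
    chain_all (fun y _ => d x0 y < rho) x ys].
Proof.
elim: xs x => [|y xs ih] x /= x0x; first by move=> /le_lt_trans/(_ x0x); rewrite ltxx.
move=> x0l; have [x0y|yx0] := ltP (d x0 y) rho; last by exists [:: y], xs.
by have [ys [zs [-> h1 h2]]] := ih y x0y x0l; exists (y :: ys), zs.
Qed.

Lemma chain_all_or (P P' : X -> X -> Prop) (q : X -> X -> R) x xs :
  (forall y y', 0 <= q y y') -> chain_all P x xs ->
  chain_all P' x xs \/
  exists y y', [/\ P y y', ~ P' y y' & q y y' <= chain_sum q x xs].
Proof.
move=> q0; elim: xs x => [|y xs ih] x /=; first by left.
move=> [Pxy /ih[h|[z [z' [h1 h2 h3]]]]]; last first.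
  by right; exists z, z'; split => //; rewrite (le_trans h3)// lerDr.
have [h'|h'] := pselect (P' x y); first by left.
by right; exists x, y; split => //; rewrite lerDl chain_sum_ge0.
Qed.

Lemma chain_sum_mul (c : R) (q : X -> X -> R) x xs :
  chain_sum (fun y y' => c * q y y') x xs = c * chain_sum q x xs.
Proof. by elim: xs x => [|y ys ih] x /=; rewrite ?mulr0// ih mulrDr. Qed.

Lemma chain_all_sub (P P' : X -> X -> Prop) x xs :
  (forall y y', P y y' -> P' y y') -> chain_all P x xs -> chain_all P' x xs.
Proof. by move=> PP'; elim: xs x => //= y ys ih x [/PP' ? /ih]. Qed.

End chain_extraction.

Lemma doubling_scale (R : realType) (X : Type) (d : distance R X)
    (F : set X -> R) (D : R) : (forall A, 0 <= F A) ->
  (forall A B, A `<=` B -> F A <= F B) ->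
  (forall x rho, 0 < rho ->
    F [set y | d x y < 2 * rho] <= D * F [set y | d x y < rho]) ->
  forall c, exists2 E, 1 <= E & forall x s t, 0 < t -> s <= c * t ->
    F [set y | d x y < s] <= E * F [set y | d x y < t].
Proof.
move=> F_ge0 F_le FD c; have [j cj] := exists_exp2_ge c.
have D1 : 1 <= `|D| + 1 by rewrite lerDr.
exists ((`|D| + 1) ^+ j); first exact: exprn_ege1.
move=> x s t t0 sc.
apply: (@le_trans _ _ (F [set y | d x y < 2 ^+ j * t])).
  apply: F_le => y /= => /lt_le_trans; apply; apply: (le_trans sc).
  by rewrite ler_wpM2r ?(ltW t0).
elim: {cj}j => [|j ih]; first by rewrite !expr0 !mul1r.
rewrite exprS -mulrA; apply: le_trans (FD _ _ _) _.
  by rewrite mulr_gt0// exprn_gt0.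
apply: (@le_trans _ _ ((`|D| + 1) * F [set y | d x y < 2 ^+ j * t])).
  by rewrite ler_wpM2r// (le_trans (ler_norm D))// lerDl.
by rewrite exprS -[leRHS]mulrA ler_wpM2l// (le_trans _ D1).
Qed.

Section content_chain.
Context {R : realType} {X : Type} (d : distance R X) {I : eqType}.
Variables (S : nat -> seq I) (ctr : nat -> I -> X) (inn : nat -> I -> X -> Prop).
Variables (r : nat -> R) (a eta Q p H C N : R) (m : nat -> I -> R).
Variable F : set X -> R.
Hypothesis a14 : 14 <= a.
Hypothesis r_gt0 : forall n, 0 < r n.
Hypothesis rS : forall n, r n = a * r n.+1.
Hypothesis S_cover : forall n x, exists2 v, v \in S n & inn n v x.
Hypothesis inn_dist : forall n v x, v \in S n -> inn n v x -> d (ctr n v) x < r n.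
Hypothesis eta_gt0 : 0 < eta.
Hypothesis Q3 : 3 <= Q.
Hypothesis p_gt0 : 0 < p.
Hypothesis H_ge0 : 0 <= H.
Hypothesis C_ge0 : 0 <= C.
Hypothesis m0 : forall v, m 0 v = 1.
Hypothesis m_gt0 : forall n v, v \in S n -> 0 < m n v.
Hypothesis m_near : forall n v w, v \in S n -> w \in S n.+1 ->
  d (ctr n v) (ctr n.+1 w) < 2 * r n -> eta * m n v <= m n.+1 w.
Hypothesis m_harnack : forall n v v', v \in S n -> v' \in S n ->
  d (ctr n v) (ctr n v') <= 18 * r n -> m n v <= H * m n v'.
Hypothesis m_cross : forall n v w0 ws z,
  v \in S n -> {subset w0 :: rcons ws z <= S n.+1} -> inn n v (ctr n.+1 w0) ->
  path (fun w w' => d (ctr n.+1 w) (ctr n.+1 w') <= 16 * r n.+1) w0 (rcons ws z) ->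
  all (fun w => d (ctr n v) (ctr n.+1 w) < 2 * r n) (w0 :: ws) ->
  2 * r n <= d (ctr n v) (ctr n.+1 z) ->
  m n v `^ p^-1 <= \sum_(w <- w0 :: ws) m n.+1 w `^ p^-1.
Hypothesis F_ge0 : forall A, 0 <= F A.
Hypothesis F_le : forall A B, A `<=` B -> F A <= F B.
Hypothesis F0 : F set0 = 0.
Hypothesis F_setT : F setT <= N.
Hypothesis F_m : forall n v x, v \in S n -> d x (ctr n v) <= r n ->
  m n v <= F [set y | d x y < 3 * Q * r n] <= C * m n v.

Let B x rho : set X := [set y | d x y < rho].

Let Q_gt0 : 0 < Q. Proof. exact: lt_le_trans Q3. Qed.
Let a6 : 6 <= a. Proof. by apply: le_trans a14; rewrite ler_nat. Qed.
Let a_gt0 : 0 < a. Proof. exact: lt_le_trans a6. Qed.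
Let N_ge0 : 0 <= N. Proof. exact: le_trans F_setT. Qed.

Let near n x : exists2 v, v \in S n & d x (ctr n v) < r n.
Proof.
by have [v vS] := S_cover n x; exists v => //; rewrite distC inn_dist.
Qed.

Let le_r n : 14 * r n.+1 <= r n.
Proof. by rewrite (rS n) ler_pM2r. Qed.

Let r_small e : 0 < e -> exists n, r n < e.
Proof.
move=> e0; have rn n : r n * 2 ^+ n <= r 0%N.
  elim: n => [|n]; first by rewrite mulr1.
  apply: le_trans; rewrite exprS mulrA ler_wpM2r ?exprn_ge0//.
  by have := le_r n; have := r_gt0 n.+1; lra.
have [n hn] := exists_exp2_ge (r 0%N / e + 1); exists n.
rewrite -(ltr_pM2r (x := 2 ^+ n)) ?exprn_gt0//; apply: le_lt_trans (rn n) _.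
rewrite -ltr_pdivrMl// mulrC; lra.
Qed.

Let scale rho : 0 < rho -> 3 * Q * r 0%N <= rho \/
  exists n, 3 * Q * r n.+1 <= rho < 3 * Q * r n.
Proof.
move=> rho0.
have Q3' : 0 < 3 * Q by rewrite mulr_gt0.
have ex : exists n, 3 * Q * r n <= rho.
  have [n rn] := r_small (divr_gt0 rho0 Q3').
  by exists n; rewrite -ler_pdivlMl// mulrC ltW.
have [[|n] hn mn] := ex_minnP ex; [by left|right; exists n].
by rewrite hn ltNge; apply/negP => /mn; rewrite ltnn.
Qed.

(** [C / eta] is the loss over one level; [N] compares the whole space with a ball of the coarsest
    level, where every mass is 1. *)
Let D := C / eta + N + 1.

Let D_ge1 : 1 <= D.
Proof. by rewrite /D lerDr addr_ge0// divr_ge0// ltW. Qed.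

Let D_ge0 : 0 <= D. Proof. exact: le_trans D_ge1. Qed.

Let F_total x : F setT <= D * F (B x (3 * Q * r 0%N)).
Proof.
have [v vS vx] := near 0%N x.
have /andP[h _] := F_m vS (ltW vx); rewrite m0 in h.
apply: le_trans (F_setT) _; apply: (@le_trans _ _ (D * 1)).
  have : 0 <= C / eta by rewrite divr_ge0// ltW.
  by rewrite mulr1 /D; lra.
by rewrite ler_wpM2l.
Qed.

Let F_step x n : F (B x (3 * Q * r n)) <= D * F (B x (3 * Q * r n.+1)).
Proof.
have [v vS vx] := near n x; have [w wS wx] := near n.+1 x.
have /andP[_ h1] := F_m vS (ltW vx); have /andP[h2 _] := F_m wS (ltW wx).
have h3 : eta * m n v <= m n.+1 w.
  apply: m_near => //; have := dist_triangle d x (ctr n v) (ctr n.+1 w).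
  by have := distC d x (ctr n v); have := le_r n; have := r_gt0 n.+1; lra.
apply: le_trans h1 _; apply: (@le_trans _ _ (C / eta * F (B x (3 * Q * r n.+1)))).
  rewrite -mulrA ler_wpM2l// mulrC ler_pdivlMr// mulrC.
  exact: le_trans h2.
by rewrite ler_wpM2r// /D -addrA lerDl addr_ge0.
Qed.

Let F_double x rho : 0 < rho -> F (B x (2 * rho)) <= D ^+ 3 * F (B x rho).
Proof.
move=> rho0.
have up (A : set X) n : F A <= F setT -> 3 * Q * r n <= rho ->
    F (B x (3 * Q * r n)) <= F (B x rho).
  move=> _ h; apply: F_le => y /=; rewrite /B /= => /lt_le_trans; exact.
have mulD k u v : u <= D * v -> v <= D ^+ k * F (B x rho) ->
    u <= D ^+ k.+1 * F (B x rho).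
  by move=> h1 h2; rewrite exprS -mulrA (le_trans h1)// ler_wpM2l.
have FT A : F A <= F setT by apply: F_le.
have one k : F (B x rho) <= D ^+ k * F (B x rho).
  by rewrite ler_peMl// exprn_ege1.
have lift n : 3 * Q * r n <= rho -> F (B x (3 * Q * r n)) <= D ^+ 0 * F (B x rho).
  move=> h; rewrite mul1r; apply: F_le => y; rewrite /B /= => /lt_le_trans; exact.
have mono k l u : (k <= l)%N -> u <= D ^+ k * F (B x rho) -> u <= D ^+ l * F (B x rho).
  by move=> kl /le_trans; apply; rewrite ler_wpM2r// ler_weXn2l.
have [h|[n /andP[h1 h2]]] := scale rho0.
  apply: (mono 1%N) => //; apply: le_trans (FT _) _.
  apply: (mulD 0%N _ _ (F_total x)); exact: lift.
case: n h1 h2 => [|n] h1 h2.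
  apply: (mono 2%N) => //; apply: le_trans (FT _) _.
  apply: (mulD 1%N _ _ (F_total x)).
  by apply: (mulD 0%N _ _ (F_step x 0)); exact: lift.
apply: (mono 2%N) => //; apply: (@le_trans _ _ (F (B x (3 * Q * r n)))).
  apply: F_le => y; rewrite /B /= => /lt_le_trans; apply.
  have := ler_wpM2l (ltW Q_gt0) (le_r n); have := mulr_gt0 Q_gt0 (r_gt0 n.+1); lra.
apply: (mulD 1%N _ _ (F_step x n)).
by apply: (mulD 0%N _ _ (F_step x n.+1)); exact: lift.
Qed.

Let F_scale c : exists2 E, 1 <= E & forall x s t, 0 < t -> s <= c * t ->
  F (B x s) <= E * F (B x t).
Proof. exact: doubling_scale F_ge0 F_le F_double c. Qed.

Let pw (A : set X) := F A `^ p^-1.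

Let pw_le E A A' : 0 <= E -> F A <= E * F A' -> pw A <= E `^ p^-1 * pw A'.
Proof.
move=> E0 h; rewrite /pw -powRM//.
by apply: ge0_ler_powR => //; rewrite ?nnegrE ?invr_ge0 ?(ltW p_gt0)// mulr_ge0.
Qed.

Lemma content_doubling : exists D, forall x rho, 0 < rho ->
  F (B x (2 * rho)) <= D * F (B x rho).
Proof. by exists (D ^+ 3) => x rho; exact: F_double. Qed.

(** The mass of the left-hand ball is read at a level [n] of comparable radius. If all edges are at
    most [3 * r n] long, they are represented by vertices of levels at least [n], and [chain_cost]
    applies; otherwise a single long edge pays, its ball being comparable to the whole by
    doubling. *)
Lemma content_chain : exists2 K, 0 < K & forall x xs,
  F (B x (d x (last x xs))) `^ p^-1 <=
    K * chain_sum (fun y y' => F (B y (d y y')) `^ p^-1) x xs.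
Proof.
(* The factor serves three comparisons: twice the radius rho with [3 * Q * r n], the latter with an
   edge longer than [3 * r n], and the ball at the level of a short edge with the edge itself. *)
have [E E1 FE] := F_scale (36 * a * Q).
have E0 : 0 <= E by exact: le_trans E1.
have CH : 0 <= C * H by exact: mulr_ge0.
have D0 := D_ge0; have Dge1 := D_ge1.
pose G := (D + E) * (E + C * H); pose e := p^-1.
have G0 : 0 < G by rewrite mulr_gt0//; lra.
pose q y y' := E `^ e * pw (B y (d y y')).
have q0 y y' : 0 <= q y y' by rewrite mulr_ge0// powR_ge0.
have cost0 n v : 0 <= m n v `^ e by exact: powR_ge0.
exists (G `^ e * E `^ e); first by rewrite mulr_gt0// powR_gt0//; lra.
move=> x xs; rewrite -[F _ `^ _]/(pw (B x (d x (last x xs)))).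
rewrite -mulrA -(chain_sum_mul (E `^ e)) -/q.
have [l0|l0] := eqVneq (d x (last x xs)) 0.
  rewrite (_ : B x _ = set0).
    by rewrite /pw F0 powR0 ?invr_eq0 ?gt_eqF// mulr_ge0 ?powR_ge0// chain_sum_ge0.
  by rewrite -subset0 => y; rewrite /B /= l0 ltNge dist_ge0.
set rho := d x (last x xs); have rho0 : 0 < rho by rewrite lt_neqAle eq_sym l0 dist_ge0.
(* Cutting at the first exit makes every edge start within [rho] of [x], so that a ball of radius
   [2 * rho] about such a start contains the ball about [x]. *)
have [ys [zs [xsE ysl ysx]]] : exists ys zs, [/\ xs = ys ++ zs,
    rho <= d x (last x ys) & chain_all (fun y _ => d x y < rho) x ys].
  by apply: chain_first_exit => //; rewrite distxx.
apply: (@le_trans _ _ (G `^ e * chain_sum q x ys)); last first.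
  rewrite ler_wpM2l ?powR_ge0// xsE chain_sum_cat lerDl.
  exact: chain_sum_ge0.
have [n nrho nmax] : exists2 n, 18 * r n < rho & (n = 0%N \/ rho <= 18 * a * r n).
  have ex : exists n, 18 * r n < rho.
    have [n hn] := r_small (divr_gt0 rho0 (ltr0n R 18)).
    by exists n; rewrite -ltr_pdivlMl// mulrC.
  have [[|n] hn mn] := ex_minnP ex; first by exists 0%N => //; left.
  exists n.+1 => //; right; rewrite leNgt; apply/negP => h.
  have /mn : 18 * r n < rho by rewrite (rS n) mulrA.
  by rewrite ltnn.
have rn := r_gt0 n.
have aQ : 1 <= a * Q.
  rewrite -[leLHS]mulr1 ler_pM// ?(le_trans _ a14) ?(le_trans _ Q3)//; by rewrite ler1n.
(* For n = 0, [rho] has no upper bound in terms of [r n]; the comparison with the total mass then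
   replaces doubling. *)
have big y : F (B y (2 * rho)) <= (D + E) * F (B y (3 * Q * r n)).
  case: nmax => [n0|h].
    apply: (@le_trans _ _ (D * F (B y (3 * Q * r n)))); last by rewrite ler_wpM2r// lerDl.
    by rewrite n0; apply: le_trans (F_total y); exact: F_le.
  apply: (@le_trans _ _ (E * F (B y (3 * Q * r n)))); last by rewrite ler_wpM2r// lerDr.
  apply: FE; first by rewrite !mulr_gt0.
  apply: (@le_trans _ _ (36 * a * r n)); first by lra.
  have QQ : 1 <= 3 * Q * Q.
    have Q1 : 1 <= Q by rewrite (le_trans _ Q3)// ler1n.
    have : 1 * 1 <= Q * Q by rewrite ler_pM.
    by lra.
  have := ler_wpM2l (ltW (mulr_gt0 (mulr_gt0 (ltr0n R 36) a_gt0) rn)) QQ.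
  lra.
have [small|[y [y' [xy far qs]]]] := @chain_all_or R X _
    (fun y y' => d y y' <= 3 * r n) q x ys q0 ysx; last first.
  apply: (@le_trans _ _ (G `^ e * q y y')); last by rewrite ler_wpM2l ?powR_ge0.
  have {}far : 3 * r n < d y y' by rewrite ltNge; apply/negP.
  apply: (@le_trans _ _ (G `^ e * pw (B y (d y y')))); last first.
    rewrite ler_wpM2l ?powR_ge0// /q ler_peMl ?powR_ge0//.
    by rewrite -(powRr0 E) ler_powR// invr_ge0 ltW.
  apply: pw_le; first exact: ltW.
  apply: (@le_trans _ _ (F (B y (2 * rho)))).
    apply: F_le => z; rewrite /B /= => xz.
    by have := dist_triangle d x y z; have := distC d x y; lra.
  apply: le_trans (big y) _.
  rewrite /G -[leRHS]mulrA ler_wpM2l ?(addr_ge0 D0 E0)//.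
  apply: (@le_trans _ _ (E * F (B y (d y y')))); last first.
    by rewrite ler_wpM2r// lerDl.
  apply: FE; first lra.
  have Qd : Q * (3 * r n) <= Q * d y y' by rewrite ler_pM2l// ltW.
  have a36 : 1 <= 36 * a by have := a14; lra.
  have : 1 * (Q * d y y') <= 36 * a * (Q * d y y').
    by rewrite ler_wpM2r// mulr_ge0 ?dist_ge0// ltW.
  lra.
have fine : chain_all (fun y y' => y <> y' -> exists k v, [/\ (n <= k)%N,
    v \in S k, inn k v y, d y y' <= 3 * r k & m k v `^ e <= q y y']) x ys.
  apply: chain_all_sub small => y y' yn yy'.
  have t0 : 0 < d y y' by exact: dist_gt0.
  have ex : exists k, 3 * r (n + k) < d y y'.
    have [k hk] := r_small (divr_gt0 t0 (ltr0n R 3)).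
    exists k; rewrite -ltr_pdivlMl// mulrC; apply: le_lt_trans hk.
    rewrite addnC; elim: n {nrho nmax rn big yn} => [|n ih]; first by rewrite addn0.
    by rewrite addnS; have := le_r (k + n); have := r_gt0 (k + n).+1; lra.
  have [[|k] hk mk] := ex_minnP ex; first by move: hk; rewrite addn0 ltNge yn.
  have {}mk : d y y' <= 3 * r (n + k).
    by rewrite leNgt; apply/negP => /mk; rewrite ltnn.
  have [v vS vy] := S_cover (n + k) y.
  exists (n + k)%N, v; split => //; first exact: leq_addr.
  have yv : d y (ctr (n + k) v) <= r (n + k) by rewrite distC ltW// inn_dist.
  have /andP[h _] := F_m vS yv.
  rewrite /q /pw -powRM//; apply: ge0_ler_powR.
  - by rewrite invr_ge0 ltW.
  - by rewrite nnegrE ltW// m_gt0.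
  - by rewrite nnegrE mulr_ge0.
  apply: le_trans h _; apply: FE => //.
  move: hk; rewrite addnS => hk; rewrite (rS (n + k)).
  have aQ0 : 0 < a * Q by exact: mulr_gt0.
  have := ler_wpM2l (ltW aQ0) (ltW hk); have := mulr_gt0 aQ0 t0; lra.
have [v vS [xv cv]] := chain_cost a6 r_gt0 rS S_cover inn_dist cost0 m_cross q0
  fine (lt_le_trans nrho ysl).
apply: (@le_trans _ _ (G `^ e * m n v `^ e)); last first.
  by rewrite ler_wpM2l ?powR_ge0.
have mv : 0 <= m n v by rewrite ltW// m_gt0.
rewrite /pw -powRM// ?(ltW G0)//; apply: ge0_ler_powR.
- by rewrite invr_ge0 ltW.
- by rewrite nnegrE.
- by rewrite nnegrE mulr_ge0// ltW.
have [v0 v0S xv0] := near n x.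
have /andP[_ h] := F_m v0S (ltW xv0).
apply: (@le_trans _ _ (F (B x (2 * rho)))).
  by apply: F_le => z; rewrite /B /=; lra.
apply: le_trans (big x) _.
rewrite /G -[leRHS]mulrA ler_wpM2l ?(addr_ge0 D0 E0)//.
(* 17 radii from [chain_cost] and one from the cover make the 18 of [m_harnack]. *)
apply: le_trans h _; apply: (@le_trans _ _ (C * H * m n v)).
  rewrite -mulrA ler_wpM2l// m_harnack//.
  have := dist_triangle d x (ctr n v0) (ctr n v).
  by have := distC d x (ctr n v0); lra.
by rewrite ler_wpM2r// lerDr.
Qed.

End content_chain.

(** * Deformation of the distance *)

Section mspace_topology.
Context {R : realType} {X : pointedType}.
Implicit Types theta : distance R X.

Lemma mspace_ballE theta (x : mspace theta) (e : R) :
  ball x e = [set y | theta x y < e].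
Proof. by rewrite ballEmdist. Qed.

Lemma mspace_continuousP theta theta' :
  continuous (fun x : mspace theta => x : mspace theta') <->
  forall x e, 0 < e -> exists2 s, 0 < s & forall y, theta x y < s -> theta' x y < e.
Proof.
split=> [h x e e0|h x].
  have /cvg_ballP/(_ e e0) := h x.
  by move=> /nbhs_ballP[s s0 sub]; exists s => //; exact: sub.
apply/(@cvg_ballP _ (mspace theta') _ (nbhs (x : mspace theta)) (nbhs_filter _)).
move=> e e0; have [s s0 sub] := h x e e0.
apply/nbhs_ballP; exists s => //= y; rewrite !mspace_ballE /=; exact: sub.
Qed.

Lemma mspace_homeomorphism theta theta' :
  continuous (fun x : mspace theta => x : mspace theta') ->
  continuous (fun x : mspace theta' => x : mspace theta) ->
  homeomorphism (fun x : mspace theta => x : mspace theta').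
Proof. by move=> h h'; split => //; exists (fun x : mspace theta' => x : mspace theta). Qed.

Lemma mspace_closed_ball theta (x : X) (e : R) :
  closed ([set y | theta x y <= e] : set (mspace theta)).
Proof.
rewrite -(setCK [set y | _]); apply: open_closedC; rewrite openE => y /= /negP.
rewrite -ltNge => exy; apply/nbhs_ballP; exists (theta x y - e) => /=.
  by rewrite subr_gt0.
move=> z; rewrite mspace_ballE /= => yz; apply/negP; rewrite -ltNge.
by have := dist_triangle theta z x y; have := distC theta y z; lra.
Qed.

Lemma mspace_bounded theta : compact [set: mspace theta] ->
  exists2 D, 0 < D & forall x y, theta x y < D.
Proof.
move=> /compact_near_coveringP cX.
have := cX nat \oo (fun n (x : X) => theta point x < n%:R) _.
case.
  move=> x _; exists (ball (x : mspace theta) 1, [set n | (Num.bound (theta point x + 1) <= n)%N]).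
    by split; [exact: nbhsx_ballx|exists (Num.bound (theta point x + 1))].
  move=> [y n] /=; rewrite mspace_ballE /= => -[xy bn].
  apply: le_lt_trans (dist_triangle theta x _ _) _.
  apply: (@lt_le_trans _ _ (Num.bound (theta point x + 1))%:R); last by rewrite ler_nat.
  apply: lt_trans (archi_boundP _); last by rewrite addr_ge0// dist_ge0.
  by rewrite ltrD2l.
move=> n _ /(_ n (leqnn n)) h.
have hx x : theta point x < n%:R by exact: h.
exists (n%:R + n%:R).
  have := le_lt_trans (dist_ge0 theta point point) (hx point); lra.
move=> x y; apply: le_lt_trans (dist_triangle theta point x y) _.
by rewrite distC ltrD.
Qed.

End mspace_topology.

(** * Powers as gauges of quasisymmetry *)

Section power_gauge.
Context {R : realType}.

Lemma powR_continuous_pos (e x : R) : 0 < x -> {for x, continuous (fun t : R => t `^ e)}.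
Proof.
move=> x0; have [h _] := is_derive1_powR e x0.
by apply: differentiable_continuous; exact/derivable1_diffP.
Qed.

Lemma powR_continuous_halfline (e : R) : 0 < e ->
  {within `[0, +oo[, continuous (fun t : R => t `^ e)}.
Proof.
move=> e0; apply/continuous_within_itvcyP; split.
  by move=> x; rewrite in_itv /= andbT; exact: powR_continuous_pos.
by rewrite powR0 ?gt_eqF//; exact: powR_cvg0.
Qed.

Lemma within_continuous_max (A : set R) (f g : R -> R) :
  {within A, continuous f} -> {within A, continuous g} ->
  {within A, continuous (fun t => Num.max (f t) (g t))}.
Proof. by move=> cf cg x; apply: continuous_max; [exact: cf|exact: cg]. Qed.

Lemma within_continuous_min (A : set R) (f g : R -> R) :
  {within A, continuous f} -> {within A, continuous g} ->
  {within A, continuous (fun t => Num.min (f t) (g t))}.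
Proof. by move=> cf cg x; apply: continuous_min; [exact: cf|exact: cg]. Qed.

(** Both powers increase, so the inverse of their maximum is the minimum of their inverses. Two
    exponents allow one for ratios above 1 and one for ratios below 1. *)
Lemma max_powR_homeomorphism (M u v : R) : 0 < M -> 0 < u -> 0 < v ->
  halfline_homeomorphism (fun t => M * Num.max (t `^ u) (t `^ v)).
Proof.
move=> M0 u0 v0.
have incr (e s t : R) : 0 < e -> 0 <= s -> s <= t -> s `^ e <= t `^ e.
  move=> e0 s0 st; apply: ge0_ler_powR => //; rewrite ?nnegrE//; first exact: ltW.
  exact: le_trans st.
have inv (e t : R) : 0 < e -> 0 <= t -> (t `^ e) `^ e^-1 = t.
  by move=> e0 t0; rewrite -powRrM divff ?gt_eqF// powRr1.
have inv' (e t : R) : 0 < e -> 0 <= t -> (t `^ e^-1) `^ e = t.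
  by move=> e0 t0; rewrite -powRrM mulVf ?gt_eqF// powRr1.
exists (fun s => Num.min ((M^-1 * s) `^ u^-1) ((M^-1 * s) `^ v^-1)); split.
- by move=> t _; rewrite mulr_ge0 ?(ltW M0)// le_max powR_ge0.
- by move=> t _; rewrite le_min !powR_ge0.
- move=> t; rewrite in_itv /= andbT => t0; rewrite mulKf ?gt_eqF//.
  apply/eqP; rewrite eq_le; apply/andP; split.
    have [h|h] := leP (t `^ u) (t `^ v); last by rewrite inv// ge_min lexx.
    by rewrite [(_ `^ v) `^ v^-1]inv// ge_min lexx orbT.
  rewrite le_min; apply/andP; split.
    by rewrite -[leLHS](inv u)// incr ?invr_gt0 ?powR_ge0// le_max lexx.
  by rewrite -[leLHS](inv v)// incr ?invr_gt0 ?powR_ge0// le_max lexx orbT.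
- move=> s; rewrite in_itv /= andbT => s0.
  rewrite -[RHS](mulVKf (x := M)) ?gt_eqF//; congr (_ * _).
  have {s0} : 0 <= M^-1 * s by rewrite mulr_ge0// invr_ge0 ltW.
  move: (M^-1 * s) => t t0.
  apply/eqP; rewrite eq_le; apply/andP; split.
    rewrite ge_max; apply/andP; split.
      by rewrite -[leRHS](inv' u)// incr ?le_min ?powR_ge0// ge_min lexx.
    by rewrite -[leRHS](inv' v)// incr ?le_min ?powR_ge0// ge_min lexx orbT.
  have [h|h] := leP (t `^ u^-1) (t `^ v^-1); first by rewrite inv'// le_max lexx.
  by rewrite [(_ `^ v^-1) `^ v]inv'// le_max lexx orbT.
split.
  have c1 := within_continuous_max (powR_continuous_halfline u0) (powR_continuous_halfline v0).
  by move=> x; apply: cvgMr; exact: c1.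
pose g := fun t : R => Num.min (t `^ u^-1) (t `^ v^-1).
have cg : {within `[0, +oo[, continuous g}.
  apply: within_continuous_min; apply: powR_continuous_halfline; by rewrite invr_gt0.
have mM : continuous (fun s : R => M^-1 * s) by exact: mulrl_continuous.
move: cg => /continuous_within_itvcyP[cg1 cg2]; apply/continuous_within_itvcyP; split.
  move=> x; rewrite in_itv /= andbT => x0.
  apply: (@continuous_comp _ _ _ (fun s => M^-1 * s) g); first exact: mM.
  by apply: cg1; rewrite in_itv /= andbT mulr_gt0// invr_gt0.
have : {within `[0, +oo[, continuous g} by apply/continuous_within_itvcyP.
move=> _; rewrite mulr0; apply: (@cvg_comp _ _ _ (fun s => M^-1 * s) g _ (0 : R)^'+) => //.
move=> A [e /= e0 eA]; exists (M * e) => /=; first exact: mulr_gt0.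
move=> s /= hs s0; apply: eA; last by rewrite mulr_gt0// invr_gt0.
move: hs; rewrite /= !sub0r !normrN normrM (gtr0_norm (x := M^-1)) ?invr_gt0//.
by rewrite ltr_pdivrMl.
Qed.

End power_gauge.

Lemma powR_exprn (R : realType) (x y e : R) j : 0 <= x -> x `^ e = y ->
  (x ^+ j) `^ e = y ^+ j.
Proof.
move=> x0 <-; elim: j => [|j ih]; first by rewrite !expr0 powR1.
by rewrite !exprS powRM ?exprn_ge0// ih.
Qed.

Lemma powR_log (R : realType) (x y : R) : 0 < x -> x != 1 -> 0 < y ->
  x `^ (ln y / ln x) = y.
Proof.
move=> x0 x1 y0; rewrite /powR gt_eqF// divfK ?lnK ?posrE//.
by rewrite ln_eq0.
Qed.

(** * The deformed distance: quasisymmetry and regularity *)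

Section deformation.
Context {R : realType} {X : pointedType} (d : distance R X).
Variables (F : set X -> R) (p D K sigma rho0 Delta : R).
Hypothesis cX : compact [set: mspace d].
Hypothesis Delta_gt0 : 0 < Delta.
Hypothesis DeltaP : forall x y, d x y < Delta.
Hypothesis F_ge0 : forall A, 0 <= F A.
Hypothesis F_add : forall A B, A `&` B = set0 -> F (A `|` B) = F A + F B.
Hypothesis F_setT : 0 < F setT.
Hypothesis F_double : forall x rho, 0 < rho ->
  F [set y | d x y < 2 * rho] <= D * F [set y | d x y < rho].
Hypothesis sigma_gt0 : 0 < sigma.
Hypothesis rho0_gt0 : 0 < rho0.
Hypothesis perfect : forall x r, 0 < r -> r <= rho0 ->
  exists y, sigma * r <= d x y < r.
Hypothesis p_gt0 : 0 < p.
Hypothesis K_gt0 : 0 < K.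
Hypothesis chain : forall x xs, F [set y | d x y < d x (last x xs)] `^ p^-1 <=
  K * chain_sum (fun y y' => F [set z | d y z < d y y'] `^ p^-1) x xs.

Let e := p^-1.
Let e_gt0 : 0 < e. Proof. by rewrite invr_gt0. Qed.
Let B x rho : set X := [set y | d x y < rho].
Let V x rho := F (B x rho).

Let F0 : F set0 = 0.
Proof.
have := F_add (setI0 set0); rewrite setU0 => /eqP.
by rewrite -subr_eq subrr eq_sym => /eqP.
Qed.

Let F_le A A' : A `<=` A' -> F A <= F A'.
Proof. by move=> AA; rewrite -(setDUK AA) F_add ?lerDl// setDIK. Qed.

Let V_ge0 x rho : 0 <= V x rho. Proof. exact: F_ge0. Qed.

Let V_le x s t : s <= t -> V x s <= V x t.
Proof. by move=> st; apply: F_le => y; rewrite /B /= => /lt_le_trans; apply. Qed.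

Let scale c : exists2 E, 1 <= E & forall x s t, 0 < t -> s <= c * t ->
  V x s <= E * V x t.
Proof. exact: doubling_scale F_ge0 F_le F_double c. Qed.

Let V_total x s : Delta <= s -> V x s = F setT.
Proof.
move=> h; rewrite /V; congr F; apply/seteqP; split => // y _.
by rewrite /B /=; apply: lt_le_trans (DeltaP x y) h.
Qed.

Let V_lower rho : 0 < rho -> exists2 c, 0 < c & forall x, c <= V x rho.
Proof.
move=> rh; have [E E1 VE] := scale (Delta / rho).
have E0 : 0 < E by exact: lt_le_trans E1.
exists (F setT / E); first exact: divr_gt0.
move=> x; rewrite ler_pdivrMr// mulrC -(V_total x (lexx Delta)).
by apply: VE; rewrite // divfK ?gt_eqF.
Qed.

Let V_gt0 x rho : 0 < rho -> 0 < V x rho.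
Proof. by move=> /V_lower[c c0 h]; exact: lt_le_trans (h x). Qed.

Let V_0 x rho : rho <= 0 -> V x rho = 0.
Proof.
move=> h; rewrite /V (_ : B x rho = set0) ?F0// -subset0 => y; rewrite /B /=.
by move=> /lt_le_trans/(_ h); rewrite ltNge dist_ge0.
Qed.

(** By perfectness an annulus about [x] contains the center of a ball which is disjoint from the
    small ball at [x] and, by doubling, holds a fixed share of the mass; the small ball misses that
    share. *)
Let reverse_doubling : exists delta c : R, [/\ 0 < delta, delta <= 2^-1,
  0 < c < 1 & forall x r, 0 < r -> r <= Delta -> V x (delta * r) <= c * V x r].
Proof.
have [E E1 VE] := scale (6 / sigma).
have E0 : 0 < E by exact: lt_le_trans E1.
pose E2 := E + 1; have E20 : 0 < E2 by rewrite addr_gt0.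
have small x r : 0 < r -> r <= rho0 -> V x (sigma * r / 2) <= (1 - E2^-1) * V x (2 * r).
  move=> r0 rr; have [y /andP[y1 y2]] := perfect x r0 rr.
  set s := sigma * r / 2; have s0 : 0 < s by rewrite divr_gt0// mulr_gt0.
  have dis : B x s `&` B y s = set0.
    rewrite -subset0 => z [] /=; rewrite /B /= => xz yz.
    have := dist_triangle d z x y; rewrite [d z y]distC.
    by move: y1 xz yz; rewrite /s; lra.
  have sr : s <= r.
    have := le_lt_trans y1 y2; rewrite /s; have : 0 < sigma * r by rewrite mulr_gt0.
    lra.
  have sub : V x s + V y s <= V x (2 * r).
    rewrite /V -F_add//; apply: F_le => z []; rewrite /B /=; first by move=> ?; lra.
    by have := dist_triangle d y x z; lra.
  have big : V x (2 * r) <= E2 * V y s.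
    apply: (@le_trans _ _ (V y (3 * r))).
      apply: F_le => z; rewrite /B /= => xz.
      by have := dist_triangle d x y z; have := distC d x y; lra.
    apply: (@le_trans _ _ (E * V y s)); last by rewrite ler_wpM2r// lerDl.
    apply: VE => //; rewrite /s.
    by rewrite (_ : _ * _ = 3 * r)//; field; rewrite gt_eqF.
  rewrite mulrBl mul1r lerBrDr; apply: le_trans sub; rewrite lerD2l.
  by rewrite ler_pdivrMl.
have E21 : 0 < 1 - E2^-1 < 1.
  rewrite subr_gt0 invf_lt1// /E2 ltrDr E0 /=.
  by rewrite ltrBlDr ltrDl invr_gt0.
pose r1 := Num.min rho0 Delta; have r10 : 0 < r1 by rewrite lt_min rho0_gt0.
have r1D : r1 <= Delta by rewrite ge_min lexx orbT.
(* [sigma / 4] serves the radii up to [2 * r1], where [small] applies at once; the last term serves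
   the larger ones, up to [Delta], through the fixed radius [r1]. *)
pose delta := Num.min (2^-1) (Num.min (sigma / 4) (sigma * r1 / 2 / Delta)).
have delta0 : 0 < delta.
  by rewrite !lt_min invr_gt0 ltr0n !divr_gt0// mulr_gt0.
have d1 : delta <= sigma / 4 by rewrite !ge_min lexx orbT.
have d2 : delta <= sigma * r1 / 2 / Delta by rewrite !ge_min lexx !orbT.
exists delta, (1 - E2^-1); split => //; first by rewrite ge_min lexx.
move=> x r r0 rD; have /andP[c0 _] := E21.
have [rr|rr] := leP r (2 * r1).
  apply: (@le_trans _ _ (V x (sigma * (r / 2) / 2))).
    by apply: V_le; have := ler_wpM2r (ltW r0) d1; lra.
  have -> : V x r = V x (2 * (r / 2)) by congr V; field.
  apply: small; first by rewrite divr_gt0.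
  have : r1 <= rho0 by rewrite ge_min lexx.
  by lra.
apply: (@le_trans _ _ (V x (sigma * r1 / 2))).
  apply: V_le; rewrite ler_pdivlMr// in d2.
  by apply: le_trans d2; rewrite ler_wpM2l// ltW.
apply: (@le_trans _ _ ((1 - E2^-1) * V x (2 * r1))).
  by apply: small => //; rewrite ge_min lexx.
by rewrite ler_wpM2l ?(ltW c0)// V_le// ltW.
Qed.

Let power_up : exists A al : R, [/\ 0 < A, 0 < al & forall x r t,
  0 < r -> 1 <= t -> V x (t * r) <= A * t `^ al * V x r].
Proof.
pose D2 := `|D| + 2; have D22 : 2 <= D2 by rewrite lerDr.
have D20 : 0 < D2 by exact: lt_le_trans D22.
have double x r j : 0 < r -> V x (2 ^+ j * r) <= D2 ^+ j * V x r.
  move=> r0; elim: j => [|j ih]; first by rewrite !expr0 !mul1r.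
  rewrite exprS -mulrA; apply: le_trans (F_double _ _) _.
    by rewrite mulr_gt0// exprn_gt0.
  apply: (@le_trans _ _ (D2 * V x (2 ^+ j * r))).
    by rewrite ler_wpM2r// (le_trans (ler_norm D))// lerDl.
  by rewrite exprS -[leRHS]mulrA ler_wpM2l// ltW.
pose al := ln D2 / ln 2.
have ln2 : 0 < ln (2 : R) by rewrite ln_gt0// ltr1n.
have al0 : 0 < al by rewrite divr_gt0// ln_gt0// (lt_le_trans _ D22)// ltr1n.
exists D2, al; split => // x r t r0 t1.
have ex : exists j, t < 2 ^+ j.
  have [j tj] := exists_exp2_ge (t + 1); exists j; lra.
have [[|j] hj mj] := ex_minnP ex; first by move: hj; rewrite expr0 ltNge t1.
have jt : 2 ^+ j <= t by rewrite leNgt; apply/negP => /mj; rewrite ltnn.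
apply: (@le_trans _ _ (V x (2 ^+ j.+1 * r))).
  by apply: V_le; rewrite ler_wpM2r// ltW.
apply: (le_trans (double _ _ _ r0)); rewrite ler_wpM2r// exprS ler_wpM2l ?(ltW D20)//.
rewrite -(@powR_exprn _ 2 _ al j)//; last first.
  by rewrite powR_log// gt_eqF// ltr1n.
apply: ge0_ler_powR => //; rewrite ?nnegrE ?exprn_ge0//; first exact: ltW.
exact: le_trans t1.
Qed.

(** Iterates [reverse_doubling]. Together with [power_up] it compares concentric balls by powers of
    the ratio of their radii, which is the quasisymmetry gauge of [deformed]. *)
Let power_down : exists A be : R, [/\ 0 < A, 0 < be & forall x r t,
  0 < r -> r <= Delta -> 0 <= t -> t <= 1 -> V x (t * r) <= A * t `^ be * V x r].
Proof.
have [delta [c [delta0 delta2 /andP[c0 c1] Vc]]] := reverse_doubling.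
have delta1 : delta < 1 by apply: le_lt_trans delta2 _; rewrite invf_lt1// ltr1n.
have iter x r j : 0 < r -> r <= Delta -> V x (delta ^+ j * r) <= c ^+ j * V x r.
  move=> r0 rD; elim: j => [|j ih]; first by rewrite !expr0 !mul1r.
  rewrite !exprS -mulrA; apply: le_trans (Vc _ _ _ _) _.
  - by rewrite mulr_gt0// exprn_gt0.
  - by apply: le_trans rD; rewrite ler_piMl ?(ltW r0)// exprn_ile1 ?(ltW delta0) ?(ltW delta1).
  - by rewrite -[leRHS]mulrA ler_wpM2l// ltW.
pose be := ln c / ln delta.
have be0 : 0 < be.
  by rewrite /be nmulr_rgt0 ?invr_lt0 ?ln_lt0 ?c0 ?delta0.
exists ((delta^-1) `^ be), be; split => //.
  by rewrite powR_gt0// invr_gt0.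
move=> x r t r0 rD t0 t1.
have [->|tn0] := eqVneq t 0.
  by rewrite mul0r V_0// !mulr_ge0 ?powR_ge0.
have {}t0 : 0 < t by rewrite lt_neqAle eq_sym tn0.
have ex : exists j, delta ^+ j < t.
  have [j tj] := exists_exp2_ge (t^-1 + 1); exists j.
  apply: (@le_lt_trans _ _ ((2^-1) ^+ j)).
    by rewrite lerXn2r ?nnegrE ?invr_ge0 ?(ltW delta0).
  rewrite exprVn invf_plt ?posrE ?exprn_gt0//; lra.
have [[|j] hj mj] := ex_minnP ex; first by move: hj; rewrite expr0 ltNge t1.
have jt : t <= delta ^+ j by rewrite leNgt; apply/negP => /mj; rewrite ltnn.
apply: (@le_trans _ _ (V x (delta ^+ j * r))).
  by apply: V_le; rewrite ler_wpM2r// ltW.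
apply: (le_trans (iter _ _ _ r0 rD)); rewrite ler_wpM2r//.
rewrite -(@powR_exprn _ delta _ be j) ?(ltW delta0)//; last first.
  by rewrite powR_log// lt_eqF.
rewrite -powRM ?invr_ge0 ?(ltW delta0) ?(ltW t0)//.
have h : delta ^+ j <= delta^-1 * t by rewrite ler_pdivlMl// -exprS ltW.
apply: ge0_ler_powR h; first exact: ltW.
  by rewrite nnegrE exprn_ge0// ltW.
by rewrite nnegrE mulr_ge0 ?invr_ge0 ?(ltW t0)// ltW.
Qed.

Let q x y := V x (d x y) `^ e + V y (d y x) `^ e.

Let q_ge0 x y : 0 <= q x y.
Proof. by rewrite addr_ge0// powR_ge0. Qed.

Let q_sym x y : q x y = q y x. Proof. by rewrite /q addrC. Qed.

Let chains x y : set R := [set chain_sum q x xs | xs in [set xs | last x xs = y]].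

(* [q] is only a quasi-distance: [chain] says that the largest distance below it
   is comparable to it. *)
Let th x y := inf (chains x y).

Let chains_lb x y : lbound (chains x y) 0.
Proof. by move=> _ [xs _ <-]; exact: chain_sum_ge0. Qed.

Let chains_neq0 x y : chains x y !=set0.
Proof. by exists (chain_sum q x [:: y]); exists [:: y]. Qed.

Let th_le x xs : th x (last x xs) <= chain_sum q x xs.
Proof.
apply: ge_inf; last by exists xs.
by exists 0; exact: chains_lb.
Qed.

Let th_geP c x y : (forall xs, last x xs = y -> c <= chain_sum q x xs) -> c <= th x y.
Proof.
by move=> h; apply: lb_le_inf; [exact: chains_neq0|move=> _ [xs /h ? <-]].
Qed.

Let th_q x y : th x y <= q x y.
Proof. by have := th_le x [:: y]; rewrite /= addr0. Qed.

Let V_sym : exists2 E, 1 <= E & forall x y, V y (d y x) <= E * V x (d x y).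
Proof.
have [E E1 VE] := scale 2; exists E => // x y.
have [xy|xy] := eqVneq (d x y) 0.
  by rewrite V_0 1?distC ?xy// mulr_ge0// (le_trans _ E1).
apply: (@le_trans _ _ (V x (2 * d x y))).
  apply: F_le => z; rewrite /B /= => yz.
  by have := dist_triangle d y x z; have := distC d x y; lra.
by apply: VE => //; rewrite lt_neqAle eq_sym xy dist_ge0.
Qed.

Let q_V : exists2 A, 0 < A & forall x y, q x y <= A * V x (d x y) `^ e.
Proof.
have [E E1 VE] := V_sym; have E0 : 0 <= E by exact: le_trans E1.
exists (1 + E `^ e); first by rewrite ltr_wpDr// powR_ge0.
move=> x y; rewrite /q mulrDl mul1r lerD2l -powRM//.
by apply: ge0_ler_powR; rewrite ?nnegrE ?mulr_ge0// ltW.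
Qed.

Let V_th : exists2 A, 0 < A & forall x y, V x (d x y) `^ e <= A * th x y.
Proof.
exists K => // x y; rewrite -ler_pdivrMl//; apply: th_geP => xs <-.
rewrite ler_pdivrMl//; apply: le_trans (chain x xs) _; rewrite ler_wpM2l ?(ltW K_gt0)//.
elim: xs x {y} => [|z zs ih] x //=; rewrite lerD// /q lerDl powR_ge0//.
Qed.

Let th_ge0 x y : 0 <= th x y.
Proof. by apply: th_geP => xs _; exact: chain_sum_ge0. Qed.

Let th_refl x : th x x = 0.
Proof. by apply/eqP; rewrite eq_le th_ge0 andbT; exact: (th_le x [::]). Qed.

Let th_eq0 x y : th x y = 0 -> x = y.
Proof.
move=> h; have [A A0 /(_ x y)] := V_th; rewrite h mulr0 => V0.
have : V x (d x y) `^ e == 0 by rewrite eq_le V0 powR_ge0.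
rewrite powR_eq0 => /andP[/eqP V0' _].
apply: contrapT => /(dist_gt0 d) /(V_gt0 x); by rewrite V0' ltxx.
Qed.

Let th_sym_le x y : th x y <= th y x.
Proof.
apply: th_geP => xs <-.
have [ys yl <-] : exists2 ys, last (last y xs) ys = y &
    chain_sum q (last y xs) ys = chain_sum q y xs.
  elim: xs y => [|z zs ih] y /=; first by exists [::].
  have [ys h1 h2] := ih z; exists (rcons ys y); first by rewrite last_rcons.
  by rewrite -cats1 chain_sum_cat h1 h2 /= addr0 addrC q_sym.
rewrite -[X in th _ X]yl; exact: th_le.
Qed.

Let th_sym x y : th x y = th y x.
Proof. by apply/eqP; rewrite eq_le !th_sym_le. Qed.

Let th_triangle y x z : th x z <= th x y + th y z.
Proof.
rewrite -lerBlDr; apply: th_geP => xs xsy; rewrite lerBlDr -lerBlDl.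
apply: th_geP => ys ysz; rewrite lerBlDl -xsy.
have := th_le x (xs ++ ys); rewrite last_cat chain_sum_cat xsy ysz//.
Qed.

Definition deformed : distance R X := Distance th_refl th_eq0 th_sym th_triangle.


Let V_small c : 0 < c -> exists2 s, 0 < s & forall x, V x s <= c.
Proof.
move=> c0; have [A [be [A0 be0 VA]]] := power_down.
pose M := A * F setT; have M0 : 0 < M by exact: mulr_gt0.
pose t := Num.min 1 ((c / M) `^ be^-1).
have t0 : 0 < t by rewrite lt_min ltr01 powR_gt0// divr_gt0.
have t1 : t <= 1 by rewrite ge_min lexx.
exists (t * Delta); first exact: mulr_gt0.
move=> x; apply: le_trans (VA x _ t Delta_gt0 (lexx _) (ltW t0) t1) _.
rewrite V_total// mulrAC -/M -ler_pdivlMl// mulrC.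
apply: (@le_trans _ _ (((c / M) `^ be^-1) `^ be)).
  apply: ge0_ler_powR; rewrite ?nnegrE ?powR_ge0 ?(ltW t0)//; first exact: ltW.
  by rewrite ge_min lexx orbT.
by rewrite -powRrM mulVf ?gt_eqF// powRr1// divr_ge0 ?ltW.
Qed.

Let powRK c : 0 <= c -> (c `^ p) `^ e = c.
Proof. by move=> c0; rewrite -powRrM divff ?gt_eqF// powRr1. Qed.

Let powRK' c : 0 <= c -> (c `^ e) `^ p = c.
Proof. by move=> c0; rewrite -powRrM mulVf ?gt_eqF// powRr1. Qed.

Let powRe_le s t : 0 <= s -> s <= t -> s `^ e <= t `^ e.
Proof.
move=> s0 st; apply: ge0_ler_powR => //; rewrite ?nnegrE//; first exact: ltW.
exact: le_trans st.
Qed.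

Let powRp_le s t : 0 <= s -> s <= t -> s `^ p <= t `^ p.
Proof.
move=> s0 st; apply: ge0_ler_powR => //; rewrite ?nnegrE//; first exact: ltW.
exact: le_trans st.
Qed.

Let th_V : exists2 A, 0 < A & forall x y, th x y <= A * V x (d x y) `^ e.
Proof.
by have [A A0 h] := q_V; exists A => // x y; exact: le_trans (th_q x y) (h x y).
Qed.

Let th_small : exists2 A, 0 < A & forall x y s r, 0 < r ->
  V x s <= (r / A) `^ p -> d x y < s -> th x y < r.
Proof.
have [A A0 h] := th_V; exists (2 * A); first exact: mulr_gt0.
move=> x y s r r0 Vs xy; apply: le_lt_trans (h x y) _.
apply: (@le_lt_trans _ _ (A * (r / (2 * A)))).
  rewrite ler_wpM2l ?(ltW A0)// -[leRHS]powRK ?divr_ge0 ?mulr_ge0 ?(ltW A0) ?(ltW r0)//.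
  by apply: powRe_le => //; apply: le_trans Vs; apply: V_le; exact: ltW.
rewrite (_ : _ * _ = r / 2); first lra.
by field; rewrite gt_eqF.
Qed.

Let th_large : exists2 A, 0 < A & forall x y r, th x y < r ->
  V x (d x y) <= (A * r) `^ p.
Proof.
have [A A0 h] := V_th; exists A => // x y r xyr.
rewrite -[leLHS]powRK'//; apply: powRp_le; first exact: powR_ge0.
by apply: (le_trans (h x y)); rewrite ler_wpM2l ?ltW.
Qed.

Let deformed_continuous :
  continuous (fun x : mspace d => x : mspace deformed).
Proof.
apply/mspace_continuousP => x r r0; have [A A0 h] := th_small.
have [s s0 Vs] := V_small (powR_gt0 p (divr_gt0 r0 A0)).
by exists s => // y; apply: h.
Qed.

Let deformed_continuous' :
  continuous (fun x : mspace deformed => x : mspace d).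
Proof.
apply/mspace_continuousP => x r r0; have [A A0 h] := V_th.
have [c c0 cV] := V_lower r0.
exists (c `^ e / A); first by rewrite divr_gt0// powR_gt0.
move=> y; rewrite ltr_pdivlMr// mulrC => xy; rewrite ltNge; apply/negP => ry.
move: xy; rewrite ltNge => /negP; apply; apply: le_trans (h x y).
by apply: powRe_le; [exact: ltW|exact: le_trans (cV x) (V_le x ry)].
Qed.

Let deformed_quasisymmetric : qs_equivalent d deformed.
Proof.
split; first exact: mspace_homeomorphism.
have [A1 A10 hA1] := th_V; have [A2 A20 hA2] := V_th.
have [Au [al [Au0 al0 hu]]] := power_up.
have [Ad [be [Ad0 be0 hd]]] := power_down.
pose M := A1 * A2 * (Au `^ e + Ad `^ e).
have M0 : 0 < M by rewrite !mulr_gt0// addr_gt0// powR_gt0.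
exists (fun t => M * Num.max (t `^ (al * e)) (t `^ (be * e))).
  by apply: max_powR_homeomorphism => //; exact: mulr_gt0.
move=> x y z xz.
have r0 : 0 < d x z by exact: dist_gt0.
have th0 : 0 < th x z by exact: (@dist_gt0 R X deformed).
have t0 : 0 <= d x y / d x z by rewrite divr_ge0 ?dist_ge0.
have tr : d x y = d x y / d x z * d x z by rewrite divfK ?gt_eqF.
move: t0 tr; set t := _ / _; rewrite -/t => t0 tr.
change (th x y / th x z <= M * Num.max (t `^ (al * e)) (t `^ (be * e))).
rewrite ler_pdivrMr//; apply: le_trans (hA1 x y) _.
have V1 : V x (d x y) `^ e <= (Au `^ e + Ad `^ e) *
    Num.max (t `^ (al * e)) (t `^ (be * e)) * V x (d x z) `^ e.
  rewrite tr.
  have [t1|t1] := leP 1 t.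
    apply: (@le_trans _ _ ((Au * t `^ al * V x (d x z)) `^ e)).
      by apply: powRe_le => //; exact: hu.
    rewrite powRM ?mulr_ge0 ?powR_ge0 ?(ltW Au0)// powRM ?powR_ge0 ?(ltW Au0)//.
    rewrite ler_wpM2r ?powR_ge0// -powRrM.
    by rewrite ler_pM ?powR_ge0// ?lerDl ?powR_ge0// le_max lexx.
  apply: (@le_trans _ _ ((Ad * t `^ be * V x (d x z)) `^ e)).
    by apply: powRe_le => //; apply: hd => //; exact: ltW.
  rewrite powRM ?mulr_ge0 ?powR_ge0 ?(ltW Ad0)// powRM ?powR_ge0 ?(ltW Ad0)//.
  rewrite ler_wpM2r ?powR_ge0// -powRrM.
  by rewrite ler_pM ?powR_ge0// ?lerDr ?powR_ge0// le_max lexx orbT.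
apply: (le_trans (ler_wpM2l (ltW A10) V1)).
apply: (@le_trans _ _ (A1 * ((Au `^ e + Ad `^ e) *
    Num.max (t `^ (al * e)) (t `^ (be * e)) * (A2 * th x z)))).
  rewrite ler_wpM2l ?(ltW A10)// ler_wpM2l// mulr_ge0 ?addr_ge0 ?powR_ge0//.
  by rewrite le_max powR_ge0.
by rewrite le_eqVlt; apply/orP; left; apply/eqP; rewrite /M; ring.
Qed.

(** Halving down from [Delta] finds where the mass passes [t]. The alternative [s = Delta] arises
    when even the whole space has mass at most [t]. *)
Let radius x t : 0 < t -> exists s, [/\ 0 < s, s <= Delta, V x s <= t &
  s = Delta \/ t < V x (2 * s)].
Proof.
move=> t0; have [s s0 Vs] := V_small t0.
have ex : exists j, V x (Delta / 2 ^+ j) <= t.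
  have [j hj] := exists_exp2_ge (Delta / s); exists j.
  apply: le_trans (Vs x); apply: V_le.
  by rewrite ler_pdivrMr ?exprn_gt0// mulrC -ler_pdivrMr.
have [j hj mj] := ex_minnP ex.
exists (Delta / 2 ^+ j); split => //.
- by rewrite divr_gt0// exprn_gt0.
- by rewrite ler_pdivrMr ?exprn_gt0// ler_peMr ?(ltW Delta_gt0)// exprn_ege1// ler1n.
case: j hj mj => [|j] hj mj; first by left; rewrite expr0 divr1.
right; rewrite ltNge; apply/negP => h.
have /mj : V x (Delta / 2 ^+ j) <= t.
  apply: le_trans h; apply: V_le; rewrite exprS le_eqVlt; apply/orP; left.
  by apply/eqP; field; rewrite gt_eqF// exprn_gt0.
by rewrite ltnn.
Qed.

Let compact_deformed : compact [set: mspace deformed].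
Proof.
have := @continuous_compact (mspace d) (mspace deformed) (fun x => x) setT.
rewrite image_id; apply => //; exact/continuous_subspaceT.
Qed.

Let deformed_ahlfors : ahlfors_regular (mspace deformed) p.
Proof.
have [mu [rmu muV muK]] := radon_of_content (T := mspace deformed)
  compact_deformed F_ge0 F_add.
have [A1 A10 h1] := th_small; have [A2 A20 h2] := th_large.
have [A3 A30 h3] := th_V.
have [E E1 VE] := scale 4; have E0 : 0 < E by exact: lt_le_trans E1.
have [E' E'1 VE'] := scale 2; have E'0 : 0 < E' by exact: lt_le_trans E'1.
have up x r : 0 < r -> F (ball (x : mspace deformed) r) <= E' * (A2 * r) `^ p.
  move=> r0; set t := (A2 * r) `^ p.
  have t0 : 0 < t by rewrite powR_gt0// mulr_gt0.
  have [s [s0 sD Vst [sE|ts]]] := radius x t0.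
    apply: (@le_trans _ _ t); last by rewrite ler_peMl// ltW.
    by apply: le_trans Vst; rewrite sE V_total//; exact: F_le.
  apply: (@le_trans _ _ (V x (2 * s))); last first.
    by apply: le_trans (VE' _ _ _ s0 (lexx _)) _; rewrite ler_wpM2l// ltW.
  apply: F_le => y; rewrite mspace_ballE /= /B /= => /h2 Vy.
  rewrite ltNge; apply/negP => sy.
  by have := le_lt_trans (le_trans (V_le x sy) Vy) ts; rewrite ltxx.
(* The measure is bounded below by [F] on closed sets only, so a closed [d]-ball of radius [s / 2]
   inside the ball is used. When [s = Delta], the points [y] and [z] bound [r] by the total mass,
   whence the term [2 * A3]. *)
have low x r : 0 < r -> (exists y z, th y z >= r / 2) ->
    exists2 c : set X, c `<=` ball (x : mspace deformed) r /\
      closed (c : set (mspace deformed)) &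
      (r / (A1 + 2 * A3)) `^ p <= E * F c.
  move=> r0 [y [z yz]]; set t := (r / A1) `^ p.
  have t0 : 0 < t by rewrite powR_gt0// divr_gt0.
  have [s [s0 sD Vst hs]] := radius x t0.
  exists [set y | d x y <= s / 2].
    split; last first.
      have := @mspace_closed_ball R X d x (s / 2).
      by move/continuous_closedP : deformed_continuous' => h /h.
    move=> w /= xw; rewrite mspace_ballE /=; apply: (h1 x w s) => //.
    by apply: le_lt_trans xw _; lra.
  apply: (@le_trans _ _ (E * V x (s / 2))); last first.
    rewrite ler_wpM2l ?(ltW E0)//; apply: F_le => w; rewrite /B /=; exact: ltW.
  case: hs => [sE|ts].
    apply: (@le_trans _ _ (V x s)); last by apply: VE; lra.
    rewrite sE V_total// -[leRHS]powRK'//; apply: powRp_le.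
      by rewrite divr_ge0 ?addr_ge0 ?mulr_ge0 ?ltW.
    have : th y z <= A3 * F setT `^ e.
      apply: le_trans (h3 y z) _; rewrite ler_wpM2l ?(ltW A30)//.
      by apply: powRe_le => //; exact: F_le.
    rewrite ler_pdivrMr ?addr_gt0 ?mulr_gt0// mulrDr.
    have := mulr_ge0 (powR_ge0 (F setT) e) (ltW A10); lra.
  apply: (@le_trans _ _ (V x (2 * s))); last by apply: VE; lra.
  apply: le_trans (ltW ts); apply: powRp_le.
    by rewrite divr_ge0 ?addr_ge0 ?mulr_ge0 ?ltW.
  by rewrite ler_wpM2l ?(ltW r0)// lef_pV2 ?posrE ?addr_gt0 ?mulr_gt0// lerDl mulr_ge0 ?(ltW A30).
pose C1 := E' * A2 `^ p; pose C2 := E * (A1 + 2 * A3) `^ p.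
have C10 : 0 < C1 by rewrite mulr_gt0// powR_gt0.
have A130 : 0 < A1 + 2 * A3 by rewrite addr_gt0// mulr_gt0.
have C20 : 0 < C2 by rewrite mulr_gt0// powR_gt0.
exists mu, (1 + C1 + C2); split => //; first lra.
move=> x r r0 rdiam.
have rp : 0 < r `^ p by rewrite powR_gt0.
have ob : open (ball (x : mspace deformed) r) by exact: mball_open.
have mub := muV _ ob.
(* The diameter is a supremum; two points at distance at least [r / 2] are all that is drawn from
   [rdiam]. *)
have [c [cb cc] Fc] : exists2 c : set X, c `<=` ball (x : mspace deformed) r /\
      closed (c : set (mspace deformed)) &
      (r / (A1 + 2 * A3)) `^ p <= E * F c.
  apply: low => //; apply: contrapT => no.
  have : (diam [set: mspace deformed] <= (r / 2)%:E)%E.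
    apply: ge_ereal_sup => _ [->|[y _ [z _ <-]]]; first by rewrite lee_fin; lra.
    rewrite lee_fin leNgt; apply/negP => h; apply: no; exists y, z; exact: ltW.
  by move=> /(le_trans rdiam); rewrite lee_fin; lra.
have cmu : (mu c <= mu (ball (x : mspace deformed) r))%E.
  apply: le_measure; rewrite ?inE//; last exact: sub_sigma_algebra.
  by rewrite -(setCK c); apply: measurableC; apply: sub_sigma_algebra; exact: closed_openC.
have Fmu := le_trans (muK _ cc) cmu.
have mufin : mu (ball (x : mspace deformed) r) \is a fin_num.
  by rewrite ge0_fin_numE// (le_lt_trans mub)// ltry.
rewrite -(fineK mufin) -EFinM !lee_fin.
move: mub Fmu; rewrite -(fineK mufin) !lee_fin; set m := fine _ => mub Fmu.
apply/andP; split.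
  rewrite ler_pdivlMr// ler_pdivrMl; last lra.
  apply: (@le_trans _ _ (C2 * F c)); last first.
    by apply: ler_pM => //; lra.
  move: Fc; rewrite powRM ?invr_ge0 ?(ltW r0) ?(ltW A130)//.
  rewrite -powR_inv1 ?(ltW A130)// -powRrM mulN1r powRN ler_pdivrMr ?powR_gt0//.
  by rewrite /C2; move=> h; apply: (le_trans h); rewrite le_eqVlt; apply/orP; left; apply/eqP; ring.
rewrite ler_pdivrMr//; apply: le_trans mub _; apply: (le_trans (up x r r0)).
rewrite powRM ?(ltW A20) ?(ltW r0)// mulrA -/C1 ler_wpM2r ?(ltW rp)//; lra.
Qed.

Lemma deformed_gauge : ar_gauge d deformed.
Proof. split; first exact: deformed_quasisymmetric.
by exists p => //; exact: deformed_ahlfors. Qed.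

Lemma deformed_ahlfors_regular : ahlfors_regular (mspace deformed) p /\
  compact [set: mspace deformed].
Proof. by split; [exact: deformed_ahlfors|exact: compact_deformed]. Qed.

End deformation.

(** * Regular distances of the gauge *)

(** A continuous injection of the half-line is strictly monotone. It cannot decrease, since the
    value [eta 0 + 1] is attained; small values are attained at points given by the inverse. *)
Lemma halfline_homeomorphism_gauge (R : realType) (eta : R -> R) :
  halfline_homeomorphism eta ->
  [/\ forall t, 0 <= t -> 0 <= eta t,
      forall s t, 0 <= s -> s <= t -> eta s <= eta t &
      forall e, 0 < e -> exists2 s, 0 < s & eta s <= e].
Proof.
move=> [zeta [eta0 zeta0 ek zk [ce _]]].
have mem t : 0 <= t -> t \in `[0, +oo[ by rewrite in_itv /= andbT.
have inj : {in `[0, +oo[ &, injective eta}.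
  by move=> s t sI tI /(congr1 zeta); rewrite !ek.
have incr s t : 0 <= s -> s < t -> eta s < eta t.
  move=> s0 st; have t0 : 0 <= t by apply: ltW; exact: le_lt_trans st.
  have [mono|mono] := itv_continuous_inj_mono ce inj.
    by apply: mono; rewrite ?mem.
  have z0 : 0 <= zeta (eta 0 + 1).
    by apply: zeta0; have := eta0 0 (lexx _); lra.
  have : eta (zeta (eta 0 + 1)) <= eta 0.
    move: z0; rewrite le_eqVlt => /predU1P[<-//|z0]; apply/ltW/mono => //.
    - by rewrite mem// ltW.
    - by rewrite mem.
  rewrite zk; last by rewrite mem//; have := eta0 0 (lexx _); lra.
  lra.
split=> //.
- by move=> s t s0; rewrite le_eqVlt => /predU1P[->//|/(incr _ _ s0)/ltW].
move=> e e0; exists (zeta e); last by rewrite zk// mem// ltW.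
have := zeta0 e (ltW e0); rewrite le_eqVlt => /predU1P[h|//].
have zz : 0 <= zeta (e / 2) by apply: zeta0; lra.
have : eta 0 <= eta (zeta (e / 2)).
  by move: zz; rewrite le_eqVlt => /predU1P[<-//|/(incr _ _ (lexx _))/ltW].
by rewrite h !zk ?mem//; lra.
Qed.

Lemma qs_equivalent_dist (R : realType) (X : pointedType) (d theta : distance R X) :
  qs_equivalent d theta ->
  exists eta : R -> R, [/\
    continuous (fun x : mspace d => x : mspace theta) /\
    continuous (fun x : mspace theta => x : mspace d),
    forall t, 0 <= t -> 0 <= eta t,
    forall e, 0 < e -> exists2 s, 0 < s & eta s <= e &
    forall x y z t, x <> z -> d x y <= t * d x z -> theta x y <= eta t * theta x z].
Proof.
move=> [[c1 [g [g1 g2 c2]]] [eta he qs]].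
have [eta0 mono small] := halfline_homeomorphism_gauge he.
exists eta; split => //.
  split => //; rewrite (_ : (fun x => _) = g)//.
  by apply/funext => x; rewrite -[LHS]g1 /=.
move=> x y z t xz xy.
have dz : 0 < d x z by exact: dist_gt0.
have := qs x y z xz.
change (theta x y / theta x z <= eta (d x y / d x z) -> theta x y <= eta t * theta x z).
rewrite ler_pdivrMr; last exact: dist_gt0.
move=> /le_trans; apply; rewrite ler_wpM2r ?dist_ge0// mono//.
  by rewrite divr_ge0 ?dist_ge0.
by rewrite ler_pdivrMr.
Qed.

(** Stands in for an attained maximum: the factor 2 only affects constants, and neither compactness
    nor continuity is involved. *)
Lemma half_sup (R : realType) (X : Type) (A : set X) (f : X -> R) (M : R) :
  A !=set0 -> (forall x, 0 <= f x) -> (forall x, f x <= M) ->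
  exists2 z, A z & forall y, A y -> f y <= 2 * f z.
Proof.
move=> [a Aa] f0 fM.
have hs : has_sup (f @` A).
  by split; [exists (f a), a|exists M => _ [y _ <-]].
have ub y : A y -> f y <= sup (f @` A).
  by move=> Ay; apply: (ub_le_sup hs.2); exists y.
have [s0|s0] := leP (sup (f @` A)) 0.
  exists a => // y Ay; apply: (le_trans (ub y Ay)); apply: (le_trans s0).
  by rewrite mulr_ge0.
have [_ [z Az <-] hz] := sup_adherent (divr_gt0 s0 (ltr0n R 2)) hs.
exists z => // y Ay; have := ub y Ay; lra.
Qed.

(** Regularity speaks of radii up to the diameter. The upper bound extends to all radii once [K] is
    enlarged by the total mass divided by the q-th power of [mdist y0 z0]. *)
Lemma ahlfors_content (R : realType) (T : pmetricType R) (q : R) (y0 z0 : T) :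
  y0 <> z0 -> 0 < q -> compact [set: T] -> ahlfors_regular T q ->
  exists (N : set T -> R) (K : R), [/\
    (forall A, 0 <= N A) /\ 0 < K,
    forall A A', open A -> open A' -> A `<=` A' -> N A <= N A',
    (forall A A', open A -> open A' -> A `&` A' = set0 ->
      N (A `|` A') = N A + N A') /\
    (forall F : nat -> set T, (forall i, open (F i)) -> \bigcup_i F i = setT ->
      ((N setT)%:E <= \sum_(0 <= i <oo) (N (F i))%:E)%E),
    forall x r, 0 < r -> N (ball x r) <= K * r `^ q &
    forall (x y z : T) r, 0 < r -> r <= mdist y z -> r `^ q <= K * N (ball x r)].
Proof.
move=> yz q0 cT [mu [K [[muK _ _] K1 ar]]].
have K0 : 0 < K by exact: lt_le_trans K1.
have mo (A : set (borel T)) : open (A : set T) -> measurable A.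
  by move=> oA; exact: sub_sigma_algebra.
have fin A : open (A : set T) -> mu A \is a fin_num.
  move=> oA; rewrite ge0_fin_numE//; apply: le_lt_trans (muK _ cT).
  by apply: le_measure; rewrite ?inE//; exact: mo.
have le A A' : open (A : set T) -> open (A' : set T) -> A `<=` A' ->
    fine (mu A) <= fine (mu A').
  move=> oA oA' AA; rewrite fine_le ?fin//.
  by apply: le_measure; rewrite ?inE//; exact: mo.
pose M := fine (mu setT); have M0 : 0 <= M by rewrite fine_ge0.
have diam_ge (y z : T) r : r <= mdist y z -> (r%:E <= diam [set: T])%E.
  move=> h; apply: (@le_trans _ _ (mdist y z)%:E); first by rewrite lee_fin.
  by apply: ereal_sup_ubound; right; exists y => //; exists z.
pose N A := fine (mu A).
have core (x y z : T) r : 0 < r -> r <= mdist y z ->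
    N (ball x r) <= K * r `^ q /\ r `^ q <= K * N (ball x r).
  move=> r0 ryz; have := ar x r r0 (diam_ge _ _ _ ryz).
  have rq : 0 < r `^ q by rewrite powR_gt0.
  have fb := fin (ball x r) (mball_open _ _).
  rewrite -(fineK fb) -EFinM !lee_fin -/(N _) => /andP[h1 h2]; split.
    by rewrite -ler_pdivrMr.
  by rewrite ler_pdivlMr// ler_pdivrMl// in h1.
have D0 : 0 < mdist y0 z0 by rewrite mdist_gt0; exact/eqP.
have Dq : 0 < mdist y0 z0 `^ q by rewrite powR_gt0.
have KM : K <= K + M / mdist y0 z0 `^ q by rewrite lerDl divr_ge0// ltW.
exists N, (K + M / mdist y0 z0 `^ q); split => //.
- by split; [move=> A; rewrite fine_ge0|exact: lt_le_trans KM].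
- split=> [A A' oA oA' AA|F oF UF].
    by rewrite /N -fineD ?fin// -measureU//; exact: mo.
  rewrite /N fineK; last by apply: fin; exact: openT.
  under eq_eseriesr do rewrite fineK ?fin//.
  by apply: measure_sigma_subadditive; rewrite ?UF// => i; exact: mo.
- move=> x r r0; have rq : 0 < r `^ q by rewrite powR_gt0.
  have [rD|rD] := leP r (mdist y0 z0).
    by apply: le_trans (core x _ _ _ r0 rD).1 _; rewrite ler_wpM2r// ltW.
  apply: (@le_trans _ _ M); first by apply: le => //; [exact: mball_open|exact: openT].
  apply: (@le_trans _ _ (M / mdist y0 z0 `^ q * r `^ q)); last first.
    by rewrite ler_wpM2r ?(ltW rq)// lerDr ltW.
  rewrite mulrAC ler_pdivlMr// ler_wpM2l//.
  by apply: ge0_ler_powR; rewrite ?nnegrE ?(ltW r0) ?(ltW D0)// ltW.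
- move=> x y z r r0 ryz; apply: le_trans (core x y z r r0 ryz).2 _.
  by rewrite ler_wpM2r ?fine_ge0.
Qed.

Lemma sum_disjoint_content (R : realType) (T : topologicalType) (J : eqType)
    (N : set T -> R) (U : J -> set T) (W : set T) (s : seq J) :
  (forall A, 0 <= N A) ->
  (forall A A', open A -> open A' -> A `<=` A' -> N A <= N A') ->
  (forall A A', open A -> open A' -> A `&` A' = set0 ->
    N (A `|` A') = N A + N A') ->
  uniq s -> (forall j, open (U j)) -> open W ->
  {in s, forall j, U j `<=` W} ->
  {in s &, forall i j, U i `&` U j !=set0 -> i = j} ->
  \sum_(j <- s) N (U j) <= N W.
Proof.
move=> N0 Nle Nadd us oU oW UW tU.
have oUs (t : seq J) : open (\bigcup_(j in [set` t]) U j).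
  by apply: bigcup_open => j _; exact: oU.
apply: (@le_trans _ _ (N (\bigcup_(j in [set` s]) U j))); last first.
  by apply: Nle => // x [j js Ujx]; exact: UW Ujx.
elim: s us UW tU => [|j s ih] /= us UW tU.
  by rewrite big_nil.
move: us => /andP[js us].
rewrite big_cons.
have -> : \bigcup_(i in [set` j :: s]) U i = U j `|` \bigcup_(i in [set` s]) U i.
  apply/seteqP; split=> x.
    by move=> [i /=]; rewrite inE => /predU1P[->|si] Ux; [left|right; exists i].
  move=> [Ux|[i /= si Ux]]; first by exists j => //=; rewrite inE eqxx.
  by exists i => //=; rewrite inE si orbT.
rewrite Nadd//.
  rewrite lerD2l; apply: ih => //.
  - by move=> i si; apply: UW; rewrite inE si orbT.
  - by move=> i i' si si'; apply: tU; rewrite inE ?si ?si' orbT.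
rewrite -subset0 => x [Ujx [i /= si Uix]].
have ij : j = i.
  by apply: tU; rewrite ?inE ?eqxx ?si ?orbT//; exists x.
by move: js; rewrite ij si.
Qed.

(** * Doubling and uniform perfectness carried from [theta] to [d] *)

Section gauge_member.
Context {R : realType} {X : pointedType} (d theta : distance R X).
Variables (N : set X -> R) (q K M : R) (eta : R -> R) (p0 p1 : X).
Let op (A : set X) : Prop := open (A : set (mspace theta)).
Hypothesis theta_d : continuous (fun x : mspace theta => x : mspace d).
Hypothesis eta_small : forall e, 0 < e -> exists2 s, 0 < s & eta s <= e.
Hypothesis qs : forall x y z t, x <> z -> d x y <= t * d x z ->
  theta x y <= eta t * theta x z.
Hypothesis p01 : p0 <> p1.
Hypothesis q_gt0 : 0 < q.
Hypothesis N_ge0 : forall A, 0 <= N A.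
Hypothesis K_gt0 : 0 < K.
Hypothesis N_le : forall A A', op A -> op A' -> A `<=` A' -> N A <= N A'.
Hypothesis N_up : forall x r, 0 < r -> N [set y | theta x y < r] <= K * r `^ q.
Hypothesis N_low : forall x y z r, 0 < r -> r <= theta y z ->
  r `^ q <= K * N [set y | theta x y < r].
Hypothesis theta_bounded : forall x y, theta x y <= M.

Let Bd x r : set X := [set y | d x y < r].
Let Bt x r : set X := [set y | theta x y < r].
Let V x r := N (Bd x r).

Let op_Bt x r : op (Bt x r).
Proof.
have -> : Bt x r = ball (x : mspace theta) r by rewrite mspace_ballE.
exact: mball_open.
Qed.

Lemma ball_open_transfer x r : op (Bd x r).
Proof.
have -> : Bd x r = (fun x : mspace theta => x : mspace d) @^-1` ball (x : mspace d) r.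
  by rewrite mspace_ballE.
by move/continuousP : theta_d; apply; exact: mball_open.
Qed.

Let op_Bd := ball_open_transfer.

Let N_upB x r : 0 < r -> N (Bt x r) <= K * r `^ q. Proof. exact: N_up. Qed.

(** For an almost farthest point [z] of the large [d]-ball, that ball lies in the [theta]-ball of
    radius [3 * theta x z], while quasisymmetry puts the [theta]-ball of radius
    [theta x z / (2 * h)] inside the small [d]-ball. Regularity compares the two. *)
Lemma gauge_doubling c : exists2 E, 1 <= E & forall x r, 0 < r ->
  V x (c * r) <= E * V x r.
Proof.
pose c' := Num.max c 1; pose h := Num.max (eta c') 1.
have c'1 : 1 <= c' by rewrite le_max lexx orbT.
have h1 : 1 <= h by rewrite le_max lexx orbT.
have h0 : 0 < h by exact: lt_le_trans h1.
have KE : 0 <= K * K * (6 * h) `^ q by rewrite !mulr_ge0 ?powR_ge0// ltW.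
exists (1 + K * K * (6 * h) `^ q); first by rewrite lerDl.
move=> x r r0; rewrite mulrDl mul1r.
have VV : V x (c * r) <= V x (c' * r).
  apply: N_le => // y; rewrite /Bd /= => /lt_le_trans; apply.
  by rewrite ler_wpM2r ?(ltW r0)// le_max lexx.
apply: le_trans VV _.
have Bx : Bd x (c' * r) !=set0.
  by exists x; rewrite /Bd /= distxx mulr_gt0// (lt_le_trans _ c'1).
have [z zB zmax] := half_sup Bx (dist_ge0 theta x) (theta_bounded x).
have [z0|zn0] := eqVneq (theta x z) 0.
  apply: (@le_trans _ _ (V x r)); last first.
    by rewrite lerDl; exact: mulr_ge0 KE (N_ge0 _).
  apply: N_le => // y yB; rewrite /Bd /=.
  have := zmax y yB; rewrite z0 mulr0 => y0.
  have xy : theta x y = 0 by apply/eqP; rewrite eq_le y0 dist_ge0.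
  by rewrite -(dist_eq0 xy) distxx.
have {}zn0 : 0 < theta x z by rewrite lt_neqAle eq_sym zn0 dist_ge0.
apply: (@le_trans _ _ (K * (3 * theta x z) `^ q)).
  apply: le_trans (N_upB x (mulr_gt0 (ltr0n R 3) zn0)).
  by apply: N_le => // y /zmax h'; rewrite /Bt /=; lra.
pose s := theta x z / (2 * h).
have s0 : 0 < s by rewrite divr_gt0// mulr_gt0.
have sz : s <= theta x z.
  rewrite ler_pdivrMr ?mulr_gt0// ler_peMr ?(ltW zn0)//; lra.
have sub : Bt x s `<=` Bd x r.
  move=> y; rewrite /Bt /Bd /= => xy; rewrite ltNge; apply/negP => ry.
  have xny : x <> y.
    by move=> xE; move: ry; rewrite -xE distxx leNgt r0.
  have : d x z <= c' * d x y.
    by apply: (le_trans (ltW zB)); rewrite ler_wpM2l// (le_trans _ c'1).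
  move=> /(qs xny) zy.
  have : eta c' * theta x y <= h * theta x y.
    by rewrite ler_wpM2r ?dist_ge0// le_max lexx.
  move: xy; rewrite ltr_pdivlMr ?mulr_gt0// => xy.
  have : 0 <= h * theta x y by rewrite mulr_ge0 ?dist_ge0// ltW.
  lra.
have Ns := N_low x s0 sz.
have : K * N (Bt x s) <= K * V x r by rewrite ler_wpM2l ?(ltW K_gt0)// N_le.
move=> /(le_trans Ns) h2.
have -> : 3 * theta x z = 6 * h * s by rewrite /s; field; rewrite gt_eqF.
have h6 : 0 <= 6 * h by rewrite mulr_ge0// ltW.
rewrite (powRM _ h6 (ltW s0)).
have h3 : K * (6 * h) `^ q * s `^ q <= K * (6 * h) `^ q * (K * V x r).
  by rewrite ler_wpM2l// mulr_ge0 ?powR_ge0// ltW.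
have : 0 <= V x r by exact: N_ge0.
by move: h3; rewrite !mulrA; lra.
Qed.

Lemma gauge_ball_gt0 x r : 0 < r -> 0 < V x r.
Proof.
move=> r0; have [s s0 sub] := (mspace_continuousP _ _).1 theta_d x r r0.
pose s' := Num.min s (theta p0 p1).
have s'0 : 0 < s' by rewrite lt_min s0 dist_gt0.
have : 0 < K * N (Bt x s').
  apply: lt_le_trans (powR_gt0 q s'0) _; apply: (N_low x s'0 (y := p0) (z := p1)).
  by rewrite ge_min lexx orbT.
rewrite pmulr_rgt0// => /lt_le_trans; apply; apply: N_le => // y.
by rewrite /Bt /Bd /= lt_min => /andP[/sub].
Qed.

(** Let [z] be an almost nearest point outside the [d]-ball. This ball contains the [theta]-ball of
    radius [theta x z / 2]; an empty annulus would squeeze it into a much smaller one, against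
    regularity. *)
Lemma gauge_perfect : exists sigma rho : R, [/\ 0 < sigma, 0 < rho &
  forall x r, 0 < r -> r <= rho -> exists y, sigma * r <= d x y < r].
Proof.
(* Makes K * K times the q-th power of 4 e equal to 1/2, where regularity would force at least 1. *)
pose e := (K * K * 2)^-1 `^ q^-1 / 4.
have KK : 0 < (K * K * 2)^-1 by rewrite invr_gt0 !mulr_gt0.
have e0 : 0 < e by rewrite divr_gt0// powR_gt0.
have [sigma sigma0 hs] := eta_small e0.
have D0 : 0 < d p0 p1 by exact: dist_gt0.
exists sigma, (d p0 p1 / 2); split => //; first exact: divr_gt0.
move=> x r r0 rr; apply: contrapT => no.
have Br : Bd x r `<=` Bd x (sigma * r).
  move=> y; rewrite /Bd /= => yr; rewrite ltNge; apply/negP => sy.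
  by apply: no; exists y; rewrite sy yr.
pose A : set X := [set z | r <= d x z].
have A0 : A !=set0.
  have [h|h] := leP r (d x p0); first by exists p0.
  exists p1; rewrite /A /=; have := dist_triangle d x p0 p1.
  by rewrite [d p0 x]distC; lra.
have [s s0 sub] := (mspace_continuousP _ _).1 theta_d x r r0.
(* An almost nearest point of [A] is an almost maximum of the inverse distance; the value 0 near [x]
   keeps [f] bounded and does not concern [A]. *)
pose f z := if theta x z < s then 0 else (theta x z)^-1.
have f0 z : 0 <= f z by rewrite /f; case: ifP => // _; rewrite invr_ge0 dist_ge0.
have fM z : f z <= s^-1.
  rewrite /f; case: ltP => h; first by rewrite invr_ge0 ltW.
  by rewrite lef_pV2 ?posrE// (lt_le_trans s0).
have [z Az zmin] := half_sup A0 f0 fM.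
have Af y : A y -> f y = (theta x y)^-1.
  move=> Ay; rewrite /f ifF//; apply/negbTE; rewrite -leNgt leNgt; apply/negP => /sub.
  by rewrite ltNge Ay.
have As y : A y -> 0 < theta x y.
  move=> Ay; apply: dist_gt0 => xy; move: Ay; rewrite /A /= -xy distxx.
  by rewrite leNgt r0.
have zn y : A y -> theta x z <= 2 * theta x y.
  move=> Ay; have := zmin y Ay; rewrite !Af//.
  by rewrite ler_pdivlMr ?As// ler_pdivrMl ?As// mulrC.
have z0 := As z Az.
have h1 : (theta x z / 2) `^ q <= K * V x r.
  apply: le_trans (N_low x (divr_gt0 z0 (ltr0n R 2)) (y := x) (z := z) _) _; first lra.
  rewrite ler_wpM2l ?(ltW K_gt0)//; apply: N_le; [exact: op_Bt|exact: op_Bd|move=> y].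
  rewrite /Bd /Bt /= => h; rewrite ltNge; apply/negP => Ay; have := zn y Ay; lra.
have h2 : V x r <= K * (2 * e * theta x z) `^ q.
  have ez : 0 < 2 * e * theta x z by rewrite mulr_gt0// mulr_gt0.
  apply: le_trans (N_upB x ez); apply: N_le => // y /Br; rewrite /Bd /Bt /= => h.
  have : theta x y <= eta sigma * theta x z.
    apply: qs; first by move=> xz; move: z0; rewrite -xz distxx ltxx.
    by apply: (le_trans (ltW h)); rewrite ler_wpM2l ?(ltW sigma0).
  move=> h'; apply: (le_lt_trans h').
  apply: (@le_lt_trans _ _ (e * theta x z)); first by rewrite ler_wpM2r ?(ltW z0).
  rewrite -mulrA ltr_pMl ?ltr1n//; exact: mulr_gt0.
have h3 := le_trans h1 (ler_wpM2l (ltW K_gt0) h2).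
have e4 : 2 * e * theta x z = (K * K * 2)^-1 `^ q^-1 * (theta x z / 2).
  by rewrite /e; field.
have z2 : 0 <= theta x z / 2 by rewrite divr_ge0// ltW.
move: h3; rewrite e4 [X in K * (K * X)]powRM ?powR_ge0//.
rewrite -powRrM mulVf ?gt_eqF// powRr1 ?(ltW KK)//.
set t := (theta x z / 2) `^ q.
have t0 : 0 < t by rewrite powR_gt0// divr_gt0.
have -> : K * (K * ((K * K * 2)^-1 * t)) = t / 2 by field; rewrite gt_eqF.
lra.
Qed.

End gauge_member.

(** * Exponential sums over separated points *)

Section exponential_sums.
Context {R : realType} {X : pointedType} (d : distance R X).
Variables (N : set X -> R) (op : set X -> Prop) (Md : R).
Let Bd x r : set X := [set y | d x y < r].
Hypothesis op_Bd : forall x r, op (Bd x r).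
Hypothesis N_le : forall A A', op A -> op A' -> A `<=` A' -> N A <= N A'.
Hypothesis N_sum : forall (J : eqType) (U : J -> set X) (W : set X) (s : seq J),
  uniq s -> (forall j, op (U j)) -> op W -> {in s, forall j, U j `<=` W} ->
  {in s &, forall i j, U i `&` U j !=set0 -> i = j} ->
  \sum_(j <- s) N (U j) <= N W.
Hypothesis N_double : forall c, exists2 E, 1 <= E & forall x r, 0 < r ->
  N (Bd x (c * r)) <= E * N (Bd x r).
Hypothesis N_gt0 : forall x r, 0 < r -> 0 < N (Bd x r).
Hypothesis d_bounded : forall x y, d x y <= Md.

(* At most [A * B ^ j] of the points lie within distance [j * rho] of [x], with [B]
   depending only on the doubling constant; any [L > ln B] works. *)
Lemma separated_exp_sum kappa : 1 < kappa -> exists L C : R, [/\ 0 < L, 1 <= C &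
  forall (J : eqType) (s : seq J) (c : J -> X) rho, 0 < rho -> uniq s ->
  {in s &, forall i j,
    Bd (c i) (kappa^-1 * rho) `&` Bd (c j) (kappa^-1 * rho) !=set0 -> i = j} ->
  forall x, \sum_(j <- s) expR (- (L * (d x (c j) / rho))) <= C].
Proof.
move=> k1; have k0 : 0 < kappa by exact: lt_trans k1.
have [D D1 ND] := N_double 2; have [E E1 NE] := N_double kappa.
have D0 : 0 < D by exact: lt_le_trans D1.
have E0 : 0 < E by exact: lt_le_trans E1.
pose L := ln (2 * D ^+ 2).
have D2 : 1 <= D ^+ 2 by exact: exprn_ege1.
have D20 : 0 < 2 * D ^+ 2 by rewrite mulr_gt0// exprn_gt0.
have L0 : 0 < L by rewrite ln_gt0//; lra.
pose C := D ^+ 2 * E * 2.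
have C1 : 1 <= C.
  have : 1 * 1 <= D ^+ 2 * E by rewrite ler_pM.
  by rewrite /C; lra.
exists L, C; split => // J s c rho rho0 us sep x.
have iter y i : N (Bd y (2 ^+ i * rho)) <= D ^+ i * N (Bd y rho).
  elim: i => [|i ih]; first by rewrite !expr0 !mul1r.
  rewrite exprS -mulrA; apply: le_trans (ND _ _ _) _.
    by rewrite mulr_gt0// exprn_gt0.
  by rewrite exprS -[leRHS]mulrA ler_wpM2l// ltW.
have j2 (j : nat) : (j%:R + 2 : R) <= 2 ^+ j.+1.
  elim: j => [|j ih]; first by rewrite expr1 add0r.
  rewrite exprS -natr1; have : 0 <= j%:R :> R by [].
  lra.
(* The disjoint balls about the counted centers lie in the ball of radius (j + 2) rho about [x], and
   doubling bounds each of them below by the same reference mass. *)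
have count (j : nat) : \sum_(w <- s | d x (c w) < (j%:R + 1) * rho) 1 <=
    (D ^+ 2) ^+ j * (D ^+ 2 * E).
  rewrite -(ler_pM2r (N_gt0 x rho0)) mulr_suml.
  under eq_bigr do rewrite mul1r.
  rewrite -big_filter; set s' := [seq w <- s | d x (c w) < (j%:R + 1) * rho].
  have wx w : w \in s' -> d x (c w) < (j%:R + 1) * rho.
    by rewrite mem_filter => /andP[].
  apply: (@le_trans _ _ (\sum_(w <- s') D ^+ j.+1 * (E * N (Bd (c w) (kappa^-1 * rho))))).
    rewrite big_seq [leRHS]big_seq; apply: ler_sum => w /wx xw.
    apply: (@le_trans _ _ (N (Bd (c w) (2 ^+ j.+1 * rho)))).
      apply: N_le => // y; rewrite /Bd /= => xy.
      have := ler_wpM2r (ltW rho0) (j2 j).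
      by have := dist_triangle d x (c w) y; have := distC d x (c w); lra.
    apply: (le_trans (iter _ _)); rewrite ler_wpM2l ?exprn_ge0 ?(ltW D0)//.
    have := NE (c w) (kappa^-1 * rho); rewrite mulVKf ?gt_eqF//; apply.
    by rewrite mulr_gt0// invr_gt0.
  rewrite -mulr_sumr -mulr_sumr.
  apply: (@le_trans _ _ (D ^+ j.+1 * (E * (D ^+ j.+1 * N (Bd x rho))))).
    rewrite ler_wpM2l ?exprn_ge0 ?(ltW D0)// ler_wpM2l ?(ltW E0)//.
    apply: le_trans (iter _ _).
    apply: (N_sum (U := fun w => Bd (c w) (kappa^-1 * rho))) => //.
    - exact: filter_uniq.
    - move=> w /wx xw y; rewrite /Bd /= => wy.
      have := ler_wpM2r (ltW rho0) (j2 j).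
      have := dist_triangle d (c w) x y.
      have : kappa^-1 * rho <= 1 * rho.
        by rewrite ler_wpM2r ?(ltW rho0)// invf_le1// ltW.
      lra.
    - by move=> w w'; rewrite !mem_filter => /andP[_ ws] /andP[_ ws']; exact: sep.
  rewrite le_eqVlt; apply/orP; left; apply/eqP.
  by rewrite -exprM mulnC exprM !exprS; ring.
have [J0 hJ0] : exists n : nat, forall w, d x (c w) / rho < n%:R.
  exists (Num.bound (`|Md / rho|)) => w.
  apply: le_lt_trans (archi_boundP (normr_ge0 _)); apply: le_trans (ler_norm _).
  by rewrite ler_wpM2r ?invr_ge0 ?(ltW rho0).
apply: (@le_trans _ _ (\sum_(w <- s) \sum_(j < J0)
    if d x (c w) < (j%:R + 1) * rho then expR (- (L * j%:R)) else 0)).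
  apply: ler_sum => w _.
  have t0 : 0 <= d x (c w) / rho by rewrite divr_ge0 ?dist_ge0// ltW.
  have ex : exists n : nat, d x (c w) / rho < n%:R by exists J0.
  have [[|j] hj mj] := ex_minnP ex.
    by move: hj; rewrite ltNge t0.
  have jJ : (j < J0)%N by exact: mj.
  have jt : j%:R <= d x (c w) / rho.
    by rewrite leNgt; apply/negP => /mj; rewrite ltnn.
  rewrite (bigD1 (Ordinal jJ)) //= ifT; last by rewrite natr1 -ltr_pdivrMr.
  rewrite -[leLHS]addr0 lerD//.
    by rewrite ler_expR lerN2 ler_wpM2l// ltW.
  by apply: sumr_ge0 => i _; case: ifP => // _; exact: expR_ge0.
rewrite exchange_big /=.
apply: (@le_trans _ _ (\sum_(j < J0) (2^-1) ^+ j * (D ^+ 2 * E))).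
  apply: ler_sum => j _; rewrite -big_mkcond /=.
  rewrite (eq_bigr (fun w => expR (- (L * j%:R)) * 1)); last by move=> *; rewrite mulr1.
  rewrite -mulr_sumr; apply: le_trans (ler_wpM2l (expR_ge0 _) (count j)) _.
  rewrite [leLHS]mulrA ler_wpM2r//.
    by rewrite mulr_ge0 ?exprn_ge0 ?(ltW D0) ?(ltW E0).
  have -> : expR (- (L * j%:R)) = (2 * D ^+ 2)^-1 ^+ j.
    by rewrite -mulNr mulrC expRM_natl expRN lnK ?posrE.
  rewrite -exprMn invfM -[X in X ^+ _ <= _]mulrA mulVf ?mulr1//.
  by rewrite gt_eqF// exprn_gt0.
rewrite -mulr_suml /C mulrC ler_wpM2l//.
  by rewrite mulr_ge0 ?exprn_ge0 ?(ltW D0) ?(ltW E0).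
have : \sum_(j < J0) (2^-1 : R) ^+ j = 2 - 2 * 2^-1 ^+ J0.
  elim: J0 {hJ0} => [|n ih]; first by rewrite big_ord0 expr0; lra.
  by rewrite big_ord_recr /= ih exprS; field.
move=> ->; rewrite gerBl mulr_ge0// exprn_ge0// invr_ge0//.
Qed.

End exponential_sums.

(** * Modulus bounds from a regular distance *)

Lemma sum_le_fsbig (R : realType) (J : choiceType) (A : set J) (f : J -> R)
    (s : seq J) :
  finite_set A -> uniq s -> {in s, forall j, A j} -> (forall j, A j -> 0 <= f j) ->
  \sum_(j <- s) f j <= \sum_(j \in A) f j.
Proof.
move=> fA us sA f0; rewrite fsbig_finite//=.
rewrite [leRHS](bigID (fun j => j \in s)) /=.
rewrite -[leLHS]addr0 lerD//.
  rewrite -[leRHS]big_filter le_eqVlt; apply/orP; left; apply/eqP.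
  apply: perm_big; apply: uniq_perm => //.
    by rewrite filter_uniq// finmap.fset_uniq.
  move=> j; rewrite mem_filter; have [js|//] := boolP (j \in s).
  have jE : (j \in finmap.enum_fset (fset_set A)) = (j \in A) := in_fset_set fA j.
  by rewrite /= jE mem_set//; exact: sA.
rewrite big_seq_cond; apply: sumr_ge0 => j /andP[jA _]; apply: f0.
by move: jA; rewrite in_fset_set// inE.
Qed.

Lemma fsbig_seq_le (R : realType) (J : choiceType) (f : J -> R) (s : seq J) :
  (forall j, j \in s -> 0 <= f j) ->
  \sum_(j \in [set` s]) f j <= \sum_(j <- s) f j.
Proof.
move=> f0; have -> : [set` s] = [set` undup s].
  by apply/seteqP; split=> j /=; rewrite mem_undup.
rewrite -fsbig_seq ?undup_uniq// -[leRHS](big_rmcond_in (fun=> true))//.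
elim: s f0 => [|j s ih] f0 /=; first by rewrite !big_nil.
have {}ih := ih (fun i si => f0 i (mem_behead (s := j :: s) si)).
rewrite big_cons; case: ifP => _; last by rewrite big_cons lerD2l.
by apply: (le_trans ih); rewrite lerDr f0// inE eqxx.
Qed.

Lemma limn_einf_eq0P (R : realType) (u : nat -> \bar R) :
  (forall k, (0 <= u k)%E) ->
  limn_einf u = 0%E <->
  forall e : R, 0 < e -> forall n, exists2 k, (n <= k)%N & (u k < e%:E)%E.
Proof.
move=> u0; rewrite limn_einf_lim.
have -> : limn (einfs u) = ereal_sup (range (einfs u)).
  by apply/cvg_lim => //; exact: cvg_einfs_sup.
have i0 n : (0 <= einfs u n)%E.
  by apply: le_ereal_inf_tmp => _ [k _ <-].
split=> [h e e0 n|h].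
  have : (einfs u n < e%:E)%E.
    apply: (@le_lt_trans _ _ 0%E); last by rewrite lte_fin.
    by rewrite -h; apply: ereal_sup_ubound; exists n.
  by move=> /ereal_inf_lt[_ [k nk <-] ke]; exists k.
apply/eqP; rewrite eq_le; apply/andP; split; last first.
  by apply: le_trans (i0 0%N) _; apply: ereal_sup_ubound; exists 0%N.
apply: ge_ereal_sup => _ [n _ <-]; apply/lee_addgt0Pr => e e0; rewrite add0e.
have [k nk ke] := h e e0 n; apply: le_trans (ltW ke).
by apply: ereal_inf_lbound; exists k.
Qed.

Section modulus_of_coverings.
Context {R : realType} {X : pointedType} (d : distance R X).
Variables (kappa b lambda : R).
Variables (U : nat -> set (set (mspace d))) (c : nat -> set (mspace d) -> mspace d).
Hypothesis covering : ball_coverings kappa b U c.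

Lemma Mod_ge0 (V : choiceType) p (Gamma : set (set V)) (G : graph V) :
  (0 <= Mod (R := R) p Gamma G)%E.
Proof.
apply: le_ereal_inf_tmp => _ [rho _ <-]; rewrite lee_fin.
by apply: fsumr_ge0 => v _; exact: powR_ge0.
Qed.

Lemma sup_modulus_ge0 p k : (0 <= sup_modulus kappa b lambda U c p k)%E.
Proof.
have : [set: mspace d] point by [].
rewrite -(bc_cover covering (leqnn 1)) => -[B UB _].
apply: le_trans (Mod_ge0 p (crossing_paths kappa b lambda U c k 1 B)
  (covering_graph kappa b lambda U c (1 + k))) _.
by apply: ereal_sup_ubound; exists 1%N, B.
Qed.

Lemma adj_dist k u w :
  u <> w /\ dilate kappa b c lambda k u `&` dilate kappa b c lambda k w !=set0 ->
  d (c k u) (c k w) < 2 * lambda * kappa * b ^- k.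
Proof.
move=> [_ [y []]]; rewrite /dilate !mspace_ballE /= => uy wy.
by have := dist_triangle d y (c k u) (c k w); have := distC d (c k w) y; lra.
Qed.

(** The prefix stops at the first center outside [2 . B], so a weight supported inside suffices; it
    has no repetition, so its sum is at most the sum over the vertex set [gamma]. *)
Lemma crossing_prefix k j B gamma : 1 < kappa -> 1 < b ->
  (1 <= j)%N -> U j B -> crossing_paths kappa b lambda U c k j B gamma ->
  exists x xs w, [/\ uniq (x :: xs), [set` x :: xs] `<=` gamma /\ gamma `<=` U (j + k),
    d (c j B) (c (j + k) x) < kappa * b ^- j,
    {in x :: xs, forall v, d (c j B) (c (j + k) v) < 2 * kappa * b ^- j} &
    path (fun u v => `[< adj (covering_graph kappa b lambda U c (j + k)) u v >])
      x (rcons xs w) /\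
    2 * kappa * b ^- j <= d (c j B) (c (j + k) w)].
Proof.
move=> k1 b1 j1 UB [x [s [[sU pth] xB far ->]]].
have r0 : 0 < kappa * b ^- j.
  by rewrite mulr_gt0 ?(lt_trans _ k1)// invr_gt0 exprn_gt0// (lt_trans _ b1).
have xB' : d (c j B) (c (j + k) x) < kappa * b ^- j.
  by have := (bc_ball covering j1 UB).2 _ xB; rewrite mspace_ballE.
have sE : [set` x :: s] `<=` U (j + k) by [].
move: far; rewrite /dilate mspace_ballE /=; move/shortenP: pth => [s' pth us' ss'].
move=> /negP; rewrite -leNgt => far.
have [xs [q [sq Pxs Pq]]] :=
  split_prefix (fun v => d (c j B) (c (j + k) v) < 2 * kappa * b ^- j) s'.
case: q sq Pq => [|w q] sq Pq.
  move: far; rewrite sq cats0 => far; exfalso.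
  have : all (fun v => d (c j B) (c (j + k) v) < 2 * kappa * b ^- j) (x :: xs).
    by rewrite /= Pxs andbT; lra.
  by move=> /allP /(_ _ (mem_last x xs)); rewrite ltNge far.
move: us' pth; rewrite sq -cat_rcons cat_path => us' /andP[pth _].
exists x, xs, w; split => //.
- by move: us'; rewrite -cat_cons -rcons_cons cat_uniq rcons_uniq => /andP[/andP[]].
- split => // v /=; rewrite !inE => /predU1P[->|vxs]; first by rewrite eqxx.
  by rewrite ss' ?orbT// sq mem_cat vxs.
- move=> v; rewrite inE => /predU1P[->|vxs]; first lra.
  by move/allP : Pxs; exact.
- by split => //; rewrite leNgt; exact: Pq.
Qed.

End modulus_of_coverings.

Section modulus_from_gauge.
Context {R : realType} {X : pointedType} (d theta : distance R X).
Variables (N : set X -> R) (q p K M : R) (eta : R -> R).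
Let op (A : set X) : Prop := open (A : set (mspace theta)).
Hypothesis eta_ge0 : forall t, 0 <= t -> 0 <= eta t.
Hypothesis eta_small : forall e, 0 < e -> exists2 s, 0 < s & eta s <= e.
Hypothesis qs : forall x y z t, x <> z -> d x y <= t * d x z ->
  theta x y <= eta t * theta x z.
Hypothesis q_gt0 : 0 < q.
Hypothesis qp : q < p.
Hypothesis N_ge0 : forall A, 0 <= N A.
Hypothesis K_gt0 : 0 < K.
Hypothesis N_le : forall A A', op A -> op A' -> A `<=` A' -> N A <= N A'.
Hypothesis N_add : forall A A', op A -> op A' -> A `&` A' = set0 ->
  N (A `|` A') = N A + N A'.
Hypothesis N_up : forall x r, 0 < r -> N [set y | theta x y < r] <= K * r `^ q.
Hypothesis N_low : forall x y z r, 0 < r -> r <= theta y z ->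
  r `^ q <= K * N [set y | theta x y < r].
Hypothesis theta_bounded : forall x y, theta x y <= M.
Variables (kappa b lambda : R).
Variables (U : nat -> set (set (mspace d))) (c : nat -> set (mspace d) -> mspace d).
Hypothesis kappa_gt1 : 1 < kappa.
Hypothesis b_gt1 : 1 < b.
Hypothesis lambda_ge32 : 32 <= lambda.
Hypothesis covering : ball_coverings kappa b U c.

Let Bd x r : set X := [set y | d x y < r].
Let Bt x r : set X := [set y | theta x y < r].

Let op_Bt x r : op (Bt x r).
Proof.
have -> : Bt x r = ball (x : mspace theta) r by rewrite mspace_ballE.
exact: mball_open.
Qed.

Section one_ball.
Variables (e t : R) (j k : nat) (B : set (mspace d)).
Hypothesis t_gt0 : 0 < t.
Hypothesis t_e : eta t <= e.
Hypothesis k_t : 4 * lambda * b ^- k <= t.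
Hypothesis k_small : 2 * lambda * b ^- k <= 1.
Hypothesis j_ge1 : (1 <= j)%N.
Hypothesis UB : U j B.

Let n := (j + k)%N.
Let rj := kappa * b ^- j.
Let delta := 2 * lambda * kappa * b ^- n.
Let h0 := Num.max (eta (2 * lambda * kappa ^+ 2)) 1.

Let kappa0 : 0 < kappa. Proof. exact: lt_trans kappa_gt1. Qed.
Let b0 i : 0 < b ^- i. Proof. by rewrite invr_gt0 exprn_gt0// (lt_trans _ b_gt1). Qed.
Let lambda0 : 0 < lambda. Proof. exact: lt_le_trans lambda_ge32. Qed.
Let rj0 : 0 < rj. Proof. exact: mulr_gt0. Qed.
Let delta0 : 0 < delta. Proof. by rewrite !mulr_gt0. Qed.
Let h01 : 1 <= h0. Proof. by rewrite le_max lexx orbT. Qed.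
Let h00 : 0 < h0. Proof. exact: lt_le_trans h01. Qed.
Let bn : b ^- n = b ^- j * b ^- k. Proof. by rewrite /n exprD invfM. Qed.
Let delta_rj : delta <= rj.
Proof.
have -> : delta = 2 * lambda * b ^- k * rj by rewrite /delta /rj bn; ring.
by rewrite ler_piMl// ltW.
Qed.

(** [delta] bounds the [d]-distance of adjacent centers, so [s] bounds the [theta]-length of edges.
    The witness [z] serves the converse estimates, which bound [s] from above by quasisymmetry. *)
Lemma vertex_scale : exists2 s : set (mspace d) -> R,
  forall w, 0 <= s w /\ (forall y, d (c n w) y < delta -> theta (c n w) y <= s w) &
  forall w, exists2 z, d (c n w) z < delta & s w = 2 * theta (c n w) z.
Proof.
have ex (w : set (mspace d)) : exists z, d (c n w) z < delta /\
    forall y, d (c n w) y < delta -> theta (c n w) y <= 2 * theta (c n w) z.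
  have A0 : Bd (c n w) delta !=set0 by exists (c n w); rewrite /Bd /= distxx.
  by have [z] := half_sup A0 (dist_ge0 theta (c n w)) (theta_bounded (c n w)); exists z.
have [z hz] := choice ex.
exists (fun w => 2 * theta (c n w) (z w)) => w.
  by split; [rewrite mulr_ge0 ?dist_ge0|exact: (hz w).2].
by exists (z w) => //; exact: (hz w).1.
Qed.

(** [2 * lambda * kappa ^+ 2] is the ratio of [delta] to the radius of the disjoint balls of the
    covering, and [h0] bounds [eta] at this ratio. *)
Lemma inner_ball w z y : d (c n w) z < delta ->
  theta (c n w) y < theta (c n w) z / h0 -> d (c n w) y < kappa^-1 * b ^- n.
Proof.
move=> zd yz; rewrite ltNge; apply/negP => hy.
have wy : c n w <> y.
  move=> wy; move: hy; rewrite -wy distxx leNgt => /negP; apply.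
  by apply: mulr_gt0 => //; rewrite invr_gt0.
have : d (c n w) z <= 2 * lambda * kappa ^+ 2 * d (c n w) y.
  apply: (le_trans (ltW zd)).
  have -> : delta = 2 * lambda * kappa ^+ 2 * (kappa^-1 * b ^- n).
    by rewrite /delta; move: (b ^- n) => B'; field; rewrite gt_eqF.
  by rewrite ler_wpM2l// !mulr_ge0// ltW.
move=> /(qs wy) h; move: yz; rewrite ltr_pdivlMr// ltNge => /negP; apply.
apply: (le_trans h); rewrite mulrC ler_wpM2l ?dist_ge0//.
by rewrite le_max lexx.
Qed.

Lemma modulus_le : (Mod p (crossing_paths kappa b lambda U c k j B)
    (covering_graph kappa b lambda U c n) <=
  ((4 * eta 4) `^ p * (4 * e) `^ (p - q) *
    ((2 * h0) `^ q * (K * (K * 2 `^ q))))%:E)%E.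
Proof.
have n1 : (1 <= n)%N by exact: leq_trans (leq_addr _ _).
have p0 : 0 < p by exact: lt_trans qp.
have fU : finite_set (U n) by exact: (bc_finite covering).
have e0 : 0 <= e by apply: le_trans t_e; exact: eta_ge0 (ltW t_gt0).
pose G := covering_graph kappa b lambda U c n.
pose cross := crossing_paths kappa b lambda U c k j B.
(* A crossing is what makes [S] positive below; if there is none, the zero weight is admissible. *)
have [[gamma hg]|no] := pselect (exists gamma, cross gamma); last first.
  apply: (@le_trans _ _ 0%E); last first.
    by rewrite lee_fin !mulr_ge0 ?powR_ge0// ltW.
  apply: ereal_inf_lbound; exists (fun=> 0).
    by split=> // gamma hg; exfalso; apply: no; exists gamma.
  by rewrite fsbig1// => v _; rewrite powR0// gt_eqF.
have [s hs hz] := vertex_scale.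
have A0 : Bd (c j B) (3 * rj) !=set0.
  by exists (c j B); rewrite /Bd /= distxx mulr_gt0.
have [zB zBr zBm] := half_sup A0 (dist_ge0 theta (c j B)) (theta_bounded (c j B)).
pose S := 2 * theta (c j B) zB.
have hS y : d (c j B) y < 3 * rj -> theta (c j B) y <= S by exact: zBm.
have chain x xs w : path (fun u v => `[< adj G u v >]) x (rcons xs w) ->
    theta (c n x) (c n w) <= \sum_(v <- x :: xs) s v.
  elim: xs x => [|y xs ih] x /= /andP[/asboolP /adj_dist xy].
    by move=> _; rewrite big_seq1; exact: (hs x).2.
  move=> /ih h; rewrite big_cons; apply: le_trans (dist_triangle theta (c n y) _ _) _.
  by rewrite lerD//; exact: (hs x).2.
(* The exit vertex is within [delta], at most [rj], of [2 . B], whence [3 * rj]. All points in play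
   are then within [4 * rj] of [c n x], and the crossing has length at least [rj]: this gives
   [eta 4], used twice and doubled in [S]. *)
have exit x xs w : d (c j B) (c n x) < rj ->
    {in x :: xs, forall v, d (c j B) (c n v) < 2 * kappa * b ^- j} ->
    path (fun u v => `[< adj G u v >]) x (rcons xs w) ->
    2 * kappa * b ^- j <= d (c j B) (c n w) ->
    [/\ rj <= d (c n x) (c n w), d (c j B) (c n w) < 3 * rj,
        theta (c n x) (c n w) <= 2 * S &
        S <= 4 * eta 4 * theta (c n x) (c n w)].
  move=> xB xsB pth wB.
  have rE : 2 * kappa * b ^- j = 2 * rj by rewrite /rj mulrA.
  have wB3 : d (c j B) (c n w) < 3 * rj.
    have : d (c n (last x xs)) (c n w) < delta.
      move: pth; rewrite rcons_path => /andP[_ /asboolP]; exact: adj_dist.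
    have := xsB _ (mem_last x xs); rewrite rE.
    by have := dist_triangle d (c n (last x xs)) (c j B) (c n w); have := delta_rj; lra.
  have xw : rj <= d (c n x) (c n w).
    by have := dist_triangle d (c n x) (c j B) (c n w); lra.
  have xnw : c n x <> c n w by move=> xE; move: xw; rewrite xE distxx leNgt rj0.
  have r3 : rj < 3 * rj by have := rj0; lra.
  split => //.
    have := hS _ wB3; have := hS _ (lt_trans xB r3).
    by have := dist_triangle theta (c j B) (c n x) (c n w);
      have := distC theta (c n x) (c j B); lra.
  have t4 y : d (c j B) y < 3 * rj -> theta (c n x) y <= eta 4 * theta (c n x) (c n w).
    move=> yB; apply: (qs xnw).
    by have := dist_triangle d (c j B) (c n x) y; have := distC d (c n x) (c j B); lra.
  have := t4 zB zBr; have : d (c j B) (c j B) < 3 * rj by rewrite distxx; have := rj0; lra.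
  move=> /t4; have := dist_triangle theta (c n x) (c j B) zB.
  by rewrite [theta (c n x) (c j B)]distC /S; lra.
have [x0 [xs0 [w0 [_ _ x0B xs0B [pth0 w0B]]]]] :=
  crossing_prefix covering kappa_gt1 b_gt1 j_ge1 UB hg.
have [x0w0 w0B3 xwS Sxw] := exit _ _ _ x0B xs0B pth0 w0B.
have S0 : 0 < S.
  have : 0 < theta (c n x0) (c n w0).
    by apply: dist_gt0 => xE; move: x0w0; rewrite xE distxx leNgt rj0.
  lra.
pose A v := d (c j B) (c n v) < 2 * kappa * b ^- j.
pose rho v := if A v then 4 * eta 4 * s v / S else 0.
have e40 : 0 <= 4 * eta 4 by rewrite mulr_ge0// eta_ge0.
have rho0 v : 0 <= rho v.
  by rewrite /rho; case: ifP => // _; rewrite divr_ge0 ?(ltW S0)// mulr_ge0// (hs v).1.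
have sS v : A v -> s v / S <= 4 * e.
  move=> Av; have [z zv ->] := hz v; rewrite ler_pdivrMr//.
  have rE : 2 * kappa * b ^- j = 2 * rj by rewrite /rj mulrA.
  have x0B3 : d (c j B) (c n x0) < 3 * rj by have := rj0; lra.
  (* The ends of the fixed crossing are at least [rj] apart, so one of them is at least [rj / 2]
     away from [v]. *)
  have [u hu uB] : exists2 u, rj / 2 <= d (c n v) (c n u) & d (c j B) (c n u) < 3 * rj.
    have [h|h] := leP (rj / 2) (d (c n v) (c n x0)); first by exists x0.
    exists w0 => //.
    by have := dist_triangle d (c n v) (c n x0) (c n w0);
      have := distC d (c n v) (c n x0); lra.
  have vnu : c n v <> c n u.
    by move=> vE; move: hu; rewrite vE distxx leNgt divr_gt0.
  have dE : delta = 4 * lambda * b ^- k * (rj / 2) by rewrite /delta /rj bn; lra.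
  have : d (c n v) z <= t * d (c n v) (c n u).
    apply: (le_trans (ltW zv)); rewrite dE ler_pM//.
      by rewrite !mulr_ge0// ltW.
    by rewrite divr_ge0// ltW.
  move=> /(qs vnu) h.
  have vS : theta (c n v) (c n u) <= 2 * S.
    have vB : d (c j B) (c n v) < 3 * rj by move: Av; rewrite /A rE; have := rj0; lra.
    have := hS _ vB; have := hS _ uB.
    by have := dist_triangle theta (c j B) (c n v) (c n u);
      have := distC theta (c n v) (c j B); lra.
  have : theta (c n v) z <= e * (2 * S).
    by apply: (le_trans h); rewrite ler_pM ?dist_ge0// eta_ge0// ltW.
  lra.
apply: (@le_trans _ _ (\sum_(v \in U n) rho v `^ p)%:E).
  apply: ereal_inf_lbound; exists rho => //; split=> // gamma' hg'.
  have [x [xs [w [us [sub sU] xB xsB [pth wB]]]]] :=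
    crossing_prefix covering kappa_gt1 b_gt1 j_ge1 UB hg'.
  have [xw _ _ Sle] := exit _ _ _ xB xsB pth wB.
  apply: le_trans (sum_le_fsbig (sub_finite_set sU fU) us _ _) => //.
  have -> : \sum_(v <- x :: xs) rho v = 4 * eta 4 / S * \sum_(v <- x :: xs) s v.
    rewrite mulr_sumr big_seq [RHS]big_seq; apply: eq_bigr => v /xsB Av.
    by rewrite /rho /A Av mulrAC.
  apply: (@le_trans _ _ (4 * eta 4 / S * theta (c n x) (c n w))).
    by rewrite mulrAC ler_pdivlMr// mul1r.
  by rewrite ler_wpM2l ?chain// divr_ge0// ltW.
rewrite lee_fin fsbig_finite//=.
set l := finmap.enum_fset _.
have lE v : v \in l -> U n v.
  have jE : (v \in l) = (v \in U n) := in_fset_set fU v.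
  by rewrite jE inE.
(* [N_low] needs a positive radius; a vertex with [s v = 0] contributes nothing. *)
pose l' := [seq v <- l | A v && (0 < s v)].
pose V v := Bt (c n v) (s v / (2 * h0)).
have VE v y : V v y -> d (c n v) y < kappa^-1 * b ^- n.
  have [z zv sv] := hz v; rewrite /V /Bt /= sv => vy; apply: inner_ball zv _.
  by apply: (lt_le_trans vy); rewrite le_eqVlt; apply/orP; left; apply/eqP;
    field; rewrite gt_eqF.
have NV : \sum_(v <- l') N (V v) <= N (Bt (c j B) (2 * S)).
  apply: (@sum_disjoint_content _ (mspace theta)) => //.
  - exact: filter_uniq (finmap.fset_uniq _).
  - by move=> v; exact: op_Bt.
  - exact: op_Bt.
  - move=> v; rewrite mem_filter => /andP[/andP[Av _] _] y /VE vy.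
    suff : d (c j B) y < 3 * rj by move=> /hS; rewrite /Bt /=; have := S0; lra.
    have kr : kappa^-1 * b ^- n <= rj.
      apply: le_trans delta_rj; rewrite /delta ler_wpM2r ?(ltW (b0 _))//.
      apply: (@le_trans _ _ 1); first by rewrite invf_le1// ltW.
      by apply: (@le_trans _ _ (2 * lambda * 1)); [have := lambda_ge32; lra|
        rewrite ler_wpM2l ?(ltW kappa_gt1)// mulr_ge0// ltW].
    move: Av; rewrite /A; have -> : 2 * kappa * b ^- j = 2 * rj by rewrite /rj mulrA.
    by have := dist_triangle d (c n v) (c j B) y; lra.
  - move=> u v; rewrite !mem_filter => /andP[_ /lE uU] /andP[_ /lE vU] [y [yu yv]].
    apply: (bc_disjoint covering n1 uU vU).
    by exists y; rewrite !mspace_ballE; split; exact: VE.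
have h1 v : v \in l -> rho v `^ p <= if A v && (0 < s v) then
    (4 * eta 4) `^ p * (4 * e) `^ (p - q) * (2 * h0) `^ q * K / S `^ q * N (V v)
    else 0.
  move=> vl; rewrite /rho; case: ifP => Av /=; last by rewrite powR0// gt_eqF.
  case: ltP => [s0|s0]; last first.
    have -> : s v = 0 by apply/eqP; rewrite eq_le s0 (hs v).1.
    by rewrite mulr0 mul0r powR0// gt_eqF.
  have [z zv sv] := hz v.
  have s20 : 0 < s v / (2 * h0) by rewrite divr_gt0// mulr_gt0.
  have hN : (s v / (2 * h0)) `^ q <= K * N (V v).
    apply: (N_low (c n v) s20 (y := c n v) (z := z)); rewrite sv.
    have z0 := dist_ge0 theta (c n v) z.
    rewrite ler_pdivrMr ?mulr_gt0//; rewrite mulrCA [leRHS]mulrA mulrC -mulrA.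
    by rewrite ler_wpM2l// ler_peMr.
  have -> : 4 * eta 4 * s v / S = 4 * eta 4 * (s v / S) by rewrite mulrA.
  have sS0 : 0 < s v / S by exact: divr_gt0.
  rewrite (powRM _ e40 (ltW sS0)).
  have -> : (s v / S) `^ p = (s v / S) `^ (p - q) * (s v / S) `^ q.
    have sSn : s v / S != 0 by rewrite gt_eqF.
    by rewrite -powRD ?subrK// sSn implybT.
  have -> : (s v / S) `^ q = (2 * h0) `^ q * (s v / (2 * h0)) `^ q / S `^ q.
    rewrite -powRM ?(ltW s20)//; last by rewrite mulr_ge0// ltW.
    have -> : 2 * h0 * (s v / (2 * h0)) = s v by field; rewrite gt_eqF.
    by rewrite powRM ?(ltW s0) ?invr_ge0 ?(ltW S0)// -powR_inv1 ?(ltW S0)// -powRrM mulN1r powRN.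
  have h2 : (s v / S) `^ (p - q) <= (4 * e) `^ (p - q).
    apply: ge0_ler_powR; rewrite ?nnegrE ?subr_ge0 ?(ltW qp) ?(ltW sS0) ?sS//.
    exact: mulr_ge0.
  set a1 := (4 * eta 4) `^ p; set a2 := (2 * h0) `^ q.
  have -> : a1 * (4 * e) `^ (p - q) * a2 * K / S `^ q * N (V v) =
    a1 * ((4 * e) `^ (p - q) * (a2 * (K * N (V v)) / S `^ q)) by ring.
  rewrite ler_wpM2l ?powR_ge0// ler_pM ?powR_ge0//.
    by rewrite !mulr_ge0 ?invr_ge0 ?powR_ge0.
  by rewrite ler_wpM2r ?invr_ge0 ?powR_ge0// ler_wpM2l ?powR_ge0.
apply: (@le_trans _ _ (\sum_(v <- l | A v && (0 < s v))
    (4 * eta 4) `^ p * (4 * e) `^ (p - q) * (2 * h0) `^ q * K / S `^ q * N (V v))).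
  by rewrite [leRHS]big_mkcond /= big_seq [leRHS]big_seq; exact: ler_sum h1.
rewrite -mulr_sumr -big_filter.
have S20 : 0 < 2 * S by exact: mulr_gt0.
have := le_trans NV (N_up (c j B) S20); rewrite (powRM _ (ler0n _ 2) (ltW S0)) => h2.
have Sq : 0 < S `^ q by rewrite powR_gt0.
set P := (4 * eta 4) `^ p * _ * _ * K.
have P0 : 0 <= P by rewrite !mulr_ge0 ?powR_ge0// ltW.
apply: (le_trans (ler_wpM2l (divr_ge0 P0 (ltW Sq)) h2)).
by rewrite le_eqVlt; apply/orP; left; apply/eqP; rewrite /P; field; rewrite gt_eqF.
Qed.

End one_ball.

Lemma gauge_liminf_modulus : liminf_modulus kappa b lambda U c p = 0%E.
Proof.
apply/limn_einf_eq0P => [k|e e0 n]; first exact: (sup_modulus_ge0 lambda covering).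
pose C := (4 * eta 4) `^ p *
  ((2 * Num.max (eta (2 * lambda * kappa ^+ 2)) 1) `^ q * (K * (K * 2 `^ q))).
have C0 : 0 <= C by rewrite !mulr_ge0 ?powR_ge0// ltW.
have eC : 0 < e / (2 * (C + 1)) by rewrite divr_gt0// mulr_gt0//; lra.
have pq : 0 < p - q by rewrite subr_gt0.
(* Turns the small factor of [modulus_le] into [e / (2 * (C + 1))]; [C + 1] is positive even if [C]
   vanishes. *)
pose e' := (e / (2 * (C + 1))) `^ (p - q)^-1 / 4.
have e'0 : 0 < e' by rewrite divr_gt0// powR_gt0.
have [t t0 te] := eta_small e'0.
have tm : 0 < Num.min t 1 by rewrite lt_min t0 ltr01.
have b0 : 0 < b by exact: lt_trans b_gt1.
have [k0 hk0] : exists k0, forall k, (k0 <= k)%N -> 4 * lambda * b ^- k <= Num.min t 1.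
  have : b^-1 ^+ k @[k --> \oo] --> (0 : R).
    by apply: cvg_expr; rewrite ger0_norm ?invr_ge0 ?(ltW b0)// invf_lt1.
  move=> /cvgrPdist_lt /(_ (Num.min t 1 / (4 * lambda))).
  have l0 : 0 < 4 * lambda by rewrite mulr_gt0// (lt_le_trans _ lambda_ge32).
  rewrite divr_gt0// => /(_ isT) [k0 _ hk]; exists k0 => k /hk /=.
  rewrite sub0r normrN exprVn ger0_norm ?invr_ge0 ?exprn_ge0 ?(ltW b0)//.
  by rewrite ltr_pdivlMr// mulrC => /ltW.
exists (maxn n k0); first exact: leq_maxl.
have := hk0 _ (leq_maxr n k0); set k := maxn n k0; rewrite le_min => /andP[kt k1].
apply: (@le_lt_trans _ _ (e / 2)%:E); last by rewrite lte_fin; lra.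
apply: ge_ereal_sup => _ [j [B [j1 UB ->]]].
have k1' : 2 * lambda * b ^- k <= 1.
  have : 0 <= lambda * b ^- k.
    by rewrite mulr_ge0 ?invr_ge0 ?exprn_ge0 ?(ltW b0)//; have := lambda_ge32; lra.
  by move: k1; rewrite -!mulrA; lra.
apply: le_trans (modulus_le t0 te kt k1' j1 UB) _; rewrite lee_fin.
have -> : 4 * e' = (e / (2 * (C + 1))) `^ (p - q)^-1 by rewrite /e'; field.
rewrite -powRrM mulVf ?gt_eqF// powRr1 ?(ltW eC)// mulrAC -/C.
have -> : C * (e / (2 * (C + 1))) = e / 2 * (C / (C + 1)).
  by field; rewrite gt_eqF//; lra.
by rewrite ger_pMr ?divr_gt0// ler_pdivrMr; lra.
Qed.

End modulus_from_gauge.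

(** * Hausdorff dimension of regular spaces *)

Section hausdorff_dimension.
Context {R : realType} {T : metricType R}.

Lemma diam_ge0 (A : set T) : (0 <= diam A)%E.
Proof. by apply: ereal_sup_ubound; left. Qed.

Lemma diam_le (A : set T) r : 0 <= r ->
  (forall x y, A x -> A y -> mdist x y <= r) -> (diam A <= r%:E)%E.
Proof.
move=> r0 Ar; apply: ge_ereal_sup => _ [->|[x Ax [y Ay <-]]]; rewrite lee_fin//.
exact: Ar.
Qed.

Lemma diam_set0 : diam (set0 : set T) = 0%E.
Proof. by apply/eqP; rewrite eq_le diam_ge0 diam_le. Qed.

Lemma hausdorff_content_finite s delta n (r : R) (F : nat -> set T) : 0 < s ->
  0 <= r -> r <= delta -> (forall i, (i < n)%N -> (diam (F i) <= r%:E)%E) ->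
  [set: T] `<=` \bigcup_(i < n) F i ->
  (hausdorff_content s delta [set: T] <= (n%:R * r `^ s)%:E)%E.
Proof.
move=> s0 r0 rd Fr FT; pose G i := if (i < n)%N then F i else set0.
apply: (@le_trans _ _ (\sum_(0 <= i <oo) diam (G i) `^ s)%E).
  apply: ereal_inf_lbound; exists G => //; split.
    by move=> x /FT[i /= ni Fx]; exists i => //; rewrite /G ni.
  move=> i; apply: (@le_trans _ _ r%:E); last by rewrite lee_fin.
  by rewrite /G; case: ifP => [/Fr//|_]; rewrite diam_set0 lee_fin.
rewrite (nneseries_split 0 n); last by move=> *; exact: poweR_ge0.
rewrite add0n eseries0 ?adde0; last first.
  by move=> i ni _; rewrite /G ltnNge ni /= diam_set0 poweR0r// gt_eqF.
apply: (@le_trans _ _ (\sum_(0 <= i < n) (r `^ s)%:E)%E).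
  rewrite big_nat [leRHS]big_nat; apply: lee_sum => i ni.
  rewrite -poweR_EFin gt0_ler_poweR ?(ltW s0) ?in_itv /= ?diam_ge0 ?lee_fin ?leey//.
  - by rewrite r0.
  - by move: ni => /= ni; rewrite /G ni Fr.
by rewrite sumEFin sumr_const_nat subn0 mulr_natl.
Qed.

Lemma hausdorff_dim_singleton : (forall x y : T, x = y) -> [set: T] !=set0 ->
  hausdorff_dim T = 0%E.
Proof.
move=> T1 [x0 _]; apply/eqP; rewrite eq_le; apply/andP; split; last first.
  by apply: le_ereal_inf_tmp => _ [s [s0 _] <-]; rewrite lee_fin ltW.
apply/lee_addgt0Pr => e e0; rewrite add0e; apply: ereal_inf_lbound.
exists e => //; split => //; apply/eqP; rewrite eq_le; apply/andP; split.
  apply: ge_ereal_sup => _ [delta /= d0 <-].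
  apply: le_trans (@hausdorff_content_finite e delta 1 0 (fun=> setT) _ _ _ _ _) _ => //.
  - exact: ltW.
  - by move=> i _; apply: diam_le => // x y _ _; rewrite (T1 x y) mdistxx.
  - by move=> x _; exists 0%N.
  - by rewrite mul1r powR0// gt_eqF.
apply: (@le_trans _ _ (hausdorff_content e 1 [set: T])); last first.
  by apply: ereal_sup_ubound; exists 1 => //; exact: ltr01.
apply: le_ereal_inf_tmp => _ [F _ <-]; apply: nneseries_ge0 => i _ _; exact: poweR_ge0.
Qed.

End hausdorff_dimension.

Lemma ahlfors_hausdorff_dim (R : realType) (T : pmetricType R) (q : R) (y0 z0 : T) :
  y0 <> z0 -> 0 < q -> compact [set: T] -> ahlfors_regular T q ->
  hausdorff_dim T = q%:E.
Proof.
move=> yz q0 cT ar.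
have [N [K [[N0 K0] Nle [Nadd Nsub] Nup Nlow]]] := ahlfors_content yz q0 cT ar.
have D0 : 0 < mdist y0 z0 by rewrite mdist_gt0; exact/eqP.
have NT0 : 0 < N setT.
  have := Nlow y0 y0 z0 _ D0 (lexx _); have : 0 < mdist y0 z0 `^ q by rewrite powR_gt0.
  move=> h1 /(lt_le_trans h1); rewrite pmulr_rgt0// => /lt_le_trans; apply.
  by apply: Nle => //; [exact: mball_open|exact: openT].
apply/eqP; rewrite eq_le; apply/andP; split; last first.
  apply: le_ereal_inf_tmp => _ [s [s0 Hs] <-]; rewrite lee_fin leNgt; apply/negP => sq.
  have Hc : (hausdorff_content s 1 [set: T] <= 0)%E.
    by rewrite -Hs; apply: ereal_sup_ubound; exists 1 => //; exact: ltr01.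
  have small e : 0 < e -> e <= 1 -> N setT <= K * 2 `^ q * (e + e).
    move=> e0 e1.
    have : (hausdorff_content s 1 [set: T] < e%:E)%E.
      by apply: le_lt_trans Hc _; rewrite lte_fin.
    move=> /ereal_inf_lt[_ [F [FT F1] <-] Fe].
    have tE i : exists t : R, diam (F i) = t%:E /\ 0 <= t <= 1.
      have := F1 i; have := diam_ge0 (F i); case: (diam (F i)) => [t| |] //.
      by rewrite !lee_fin => t0 t1; exists t; rewrite ?t0.
    have [t tF] := choice tE.
    have xE i : exists x : T, forall y, F i y -> mdist x y <= t i.
      have [[x Fx]|no] := pselect (F i !=set0); last first.
        by exists point => y Fy; exfalso; apply: no; exists y.
      exists x => y Fy; rewrite -lee_fin -(tF i).1.
      by apply: ereal_sup_ubound; right; exists x => //; exists y.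
    have [x Fx] := choice xE.
    (* The diameters [t i] may vanish. Enlarging them by [v i], whose s-th powers [w i] sum to [e],
       gives an open cover; as [t i] and [v i] are at most 1 and s < q, their q-th powers are
       bounded by their s-th powers. *)
    pose w i := e / (2 ^ i.+1)%:R.
    have w0 i : 0 < w i by rewrite divr_gt0// ltr0n expn_gt0.
    have w1 i : w i <= 1.
      by rewrite ler_pdivrMr ?ltr0n ?expn_gt0// mul1r (le_trans e1)// ler1n expn_gt0.
    pose v i := w i `^ s^-1.
    have v0 i : 0 < v i by rewrite powR_gt0.
    have vs i : v i `^ s = w i by rewrite -powRrM mulVf ?gt_eqF// powRr1// ltW.
    have v1 i : v i <= 1.
      have -> : 1 = 1 `^ s^-1 :> R by rewrite powR1.
      by apply: ge0_ler_powR; rewrite ?nnegrE ?invr_ge0 ?(ltW s0) ?(ltW (w0 i)).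
    have ball_le i : N (ball (x i) (t i + v i)) <= K * 2 `^ q * (t i `^ s + w i).
      have /andP[t0 t1] := (tF i).2.
      have r0 : 0 < t i + v i by exact: ltr_wpDl.
      apply: (@le_trans _ _ (K * (t i + v i) `^ q)); first exact: Nup.
      rewrite -mulrA ler_wpM2l ?(ltW K0)//.
      pose m := Num.max (t i) (v i).
      have m0 : 0 < m by rewrite lt_max v0 orbT.
      have m1 : m <= 1 by rewrite ge_max t1 v1.
      have tm : t i <= m by rewrite le_max lexx.
      have vm : v i <= m by rewrite le_max lexx orbT.
      apply: (@le_trans _ _ ((2 * m) `^ q)).
        apply: ge0_ler_powR; rewrite ?nnegrE ?(ltW q0) ?(ltW r0)//; last lra.
        by rewrite mulr_ge0// ltW.
      rewrite powRM ?(ltW m0)// ler_wpM2l ?powR_ge0//.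
      apply: (@le_trans _ _ (m `^ s)).
        by apply: ger_powR; rewrite ?m0 ?m1// ltW.
      have ts0 : 0 <= t i `^ s by exact: powR_ge0.
      have := vs i; have := w0 i; rewrite /m; case: (ltP (t i) (v i)) => _; lra.
    pose B i : set T := ball (x i) (t i + v i).
    have oB i : open (B i) by exact: mball_open.
    have BT : \bigcup_i B i = setT.
      apply/seteqP; split=> // y _; have [i _ Fy] := FT y I.
      exists i => //; rewrite /B ballEmdist /=; apply: le_lt_trans (Fx i y Fy) _.
      by rewrite ltrDl.
    have := Nsub B oB BT; rewrite -lee_fin => hsub; apply: le_trans hsub _.
    apply: (@le_trans _ _ (\sum_(0 <= i <oo)
        (K * 2 `^ q)%:E * (diam (F i) `^ s + (w i)%:E))%E).
      apply: lee_nneseries => [i _ _|i _]; first by rewrite lee_fin.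
      by rewrite (tF i).1 poweR_EFin -EFinD -EFinM lee_fin ball_le.
    rewrite nneseriesZl; last first.
      by move=> i _; rewrite adde_ge0 ?poweR_ge0// lee_fin ltW.
    have C0 : (0 <= (K * 2 `^ q)%:E)%E by rewrite lee_fin mulr_ge0 ?powR_ge0// ltW.
    rewrite [leRHS]EFinM; apply: lee_wpmul2l => //.
    apply: le_trans (epsilon_trick _ _ (ltW e0)) _; first by move=> i; exact: poweR_ge0.
    by rewrite EFinD leeD2r// ltW.
  pose C := K * 2 `^ q.
  have C0 : 0 < C by rewrite mulr_gt0// powR_gt0.
  pose e := Num.min 1 (N setT / (4 * C)).
  have e0 : 0 < e by rewrite lt_min ltr01 divr_gt0// mulr_gt0.
  have e1 : e <= 1 by rewrite ge_min lexx.
  have := small e e0 e1; rewrite -/C.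
  have : e <= N setT / (4 * C) by rewrite ge_min lexx orbT.
  by rewrite ler_pdivlMr ?mulr_gt0//; lra.
apply/lee_addgt0Pr => e e0; rewrite -EFinD; apply: ereal_inf_lbound.
have s0 : 0 < q + e by rewrite addr_gt0.
exists (q + e) => //; split => //; apply/eqP; rewrite eq_le; apply/andP; split; last first.
  apply: (@le_trans _ _ (hausdorff_content (q + e) 1 [set: T])).
    by apply: le_ereal_inf_tmp => _ [F _ <-]; apply: nneseries_ge0 => i _ _; exact: poweR_ge0.
  by apply: ereal_sup_ubound; exists 1 => //; exact: ltr01.
apply: ge_ereal_sup => _ [delta /= d0 <-].
apply/lee_addgt0Pr => e' e'0; rewrite add0e.
pose C := K * N setT * 4 `^ q.
have C0 : 0 < C by rewrite !mulr_gt0// powR_gt0.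
pose r := Num.min (Num.min delta (mdist y0 z0)) ((e' / C) `^ e^-1).
have eC : 0 < e' / C by rewrite divr_gt0.
have r0 : 0 < r by rewrite !lt_min d0 D0 powR_gt0.
have rd : r <= delta by rewrite !ge_min lexx.
have rD : r / 4 <= mdist y0 z0.
  have : r <= mdist y0 z0 by rewrite !ge_min lexx orbT.
  by have := ltW r0; lra.
have re : r `^ e <= e' / C.
  have -> : e' / C = ((e' / C) `^ e^-1) `^ e.
    by rewrite -powRrM mulVf ?gt_eqF// powRr1// ltW.
  apply: ge0_ler_powR; rewrite ?nnegrE ?powR_ge0 ?(ltW e0) ?(ltW r0)//.
  by rewrite !ge_min lexx !orbT.
(* The balls of radius [r / 4] about such points are disjoint, which bounds their number; for a
   longest list the balls of radius [r / 2], of diameter at most [r], cover. *)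
pose sep (xs : seq T) := uniq xs /\ {in xs &, forall x y, mdist x y < r / 2 -> x = y}.
have sep_size xs : sep xs -> (size xs)%:R * r `^ (q + e) <= e'.
  move=> [us sx]; have r4 : 0 < r / 4 by rewrite divr_gt0.
  have : \sum_(x <- xs) N (ball x (r / 4)) <= N setT.
    apply: sum_disjoint_content => //.
    - by move=> x; exact: mball_open.
    - exact: openT.
    - move=> x y xX yX [z []]; rewrite !ballEmdist /= => xz yz'.
      apply: sx => //; have := metric_triangle x z y; rewrite [mdist z y]metric_sym; lra.
  have h : (size xs)%:R * (r / 4) `^ q <= K * \sum_(x <- xs) N (ball x (r / 4)).
    have -> : (size xs)%:R * (r / 4) `^ q = \sum_(x <- xs) (r / 4) `^ q.
      by rewrite big_const_seq count_predT iter_addr_0 mulr_natl.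
    by rewrite mulr_sumr; apply: ler_sum => x _; exact: Nlow r4 rD.
  move=> h'; have := le_trans h (ler_wpM2l (ltW K0) h') => {}h.
  have -> : r `^ (q + e) = 4 `^ q * (r / 4) `^ q * r `^ e.
    rewrite -powRM ?(ltW r4)// [4 * _]mulrC divfK// -powRD//.
    by rewrite gt_eqF.
  apply: (@le_trans _ _ (K * N setT * 4 `^ q * (e' / C))); last first.
    by rewrite -/C mulrCA divff ?mulr1// gt_eqF.
  rewrite mulrA [X in X * _ <= _](_ : _ = (size xs)%:R * (r / 4) `^ q * 4 `^ q).
    rewrite ler_pM ?mulr_ge0 ?powR_ge0//.
    by rewrite ler_wpM2r ?powR_ge0.
  by ring.
have [m mP mmax] : exists2 m : nat, (exists2 xs, sep xs & size xs = m) &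
    forall xs, sep xs -> (size xs <= m)%N.
  have rq : 0 < r `^ (q + e) by rewrite powR_gt0.
  pose P m := `[< exists2 xs, sep xs & size xs = m >].
  have P0 : exists m, P m by exists 0%N; apply/asboolP; exists [::].
  have Pm m : P m -> (m <= Num.bound (e' / r `^ (q + e)))%N.
    move=> /asboolP[xs /sep_size h xsm].
    rewrite -(ler_nat R) ltW// (le_lt_trans _ (archi_boundP _))//.
      by rewrite ler_pdivlMr// -xsm.
    by rewrite divr_ge0// ltW.
  have [m /asboolP mP mmax] := ex_maxnP P0 Pm; exists m => // xs sx.
  by apply: mmax; apply/asboolP; exists xs.
have [xs sx xsm] := mP.
apply: le_trans (@hausdorff_content_finite _ _ (q + e) delta m r
  (fun i => ball (nth y0 xs i) (r / 2)) s0 (ltW r0) rd _ _) _.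
- move=> i _; apply: diam_le (ltW r0) _ => x y; rewrite !ballEmdist /= => xi yi.
  by have := metric_triangle x (nth y0 xs i) y; have := metric_sym x (nth y0 xs i); lra.
- move=> y _; apply: contrapT => no.
  have xy x : x \in xs -> r / 2 <= mdist x y.
    move=> xX; rewrite leNgt; apply/negP => xy; apply: no; exists (index x xs).
      by rewrite /= -xsm index_mem.
    by rewrite nth_index// ballEmdist.
  have : sep (y :: xs).
    split=> /=.
      rewrite sx.1 andbT; apply/negP => /xy; rewrite mdistxx leNgt.
      by rewrite divr_gt0.
    move=> u v; rewrite !inE => /predU1P[->|ux] /predU1P[->|vx] //.
    - by rewrite metric_sym ltNge xy.
    - by rewrite ltNge xy.
    - exact: sx.2.
  by move=> /mmax /=; rewrite xsm ltnn.
- by rewrite lee_fin -xsm; exact: sep_size.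
Qed.

(** * A regular distance from small modulus *)

Lemma ler_sum_uniq_sub (R : realType) (J : choiceType) (f : J -> R) (s t : seq J) :
  uniq s -> {subset s <= t} -> (forall j, j \in t -> 0 <= f j) ->
  \sum_(j <- s) f j <= \sum_(j <- t) f j.
Proof.
move=> us st f0; apply: le_trans (fsbig_seq_le f0).
by apply: sum_le_fsbig => //; exact: finite_seq.
Qed.

(** Bounding each term by the p-th root of the sum of p-th powers works for every p > 0, whereas
    convexity would ask for 1 <= p. *)
Lemma powR_sum_le (R : realType) (J : eqType) (f : J -> R) (s : seq J) p D : 0 < p ->
  (forall j, 0 <= f j) -> (size s)%:R <= D ->
  (\sum_(j <- s) f j) `^ p <= D `^ p * \sum_(j <- s) f j `^ p.
Proof.
move=> p0 f0 sD; set S := \sum_(j <- s) f j `^ p.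
have S0 : 0 <= S by apply: sumr_ge0 => j _; exact: powR_ge0.
have D0 : 0 <= D by exact: le_trans sD.
have -> : S = (S `^ p^-1) `^ p by rewrite -powRrM mulVf ?gt_eqF// powRr1.
rewrite -powRM ?powR_ge0//; apply: ge0_ler_powR; rewrite ?nnegrE ?(ltW p0)//.
- exact: sumr_ge0.
- by rewrite mulr_ge0// powR_ge0.
apply: (@le_trans _ _ ((size s)%:R * S `^ p^-1)); last by rewrite ler_wpM2r ?powR_ge0.
have fS j : j \in s -> f j <= S `^ p^-1.
  move=> js; have -> : f j = (f j `^ p) `^ p^-1.
    by rewrite -powRrM mulfV ?gt_eqF// powRr1.
  apply: ge0_ler_powR; rewrite ?nnegrE ?powR_ge0 ?invr_ge0 ?(ltW p0)//.
  by rewrite /S (big_rem j)//= lerDl; apply: sumr_ge0 => i _; exact: powR_ge0.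
apply: (@le_trans _ _ (\sum_(j <- s) S `^ p^-1)).
  by rewrite big_seq [leRHS]big_seq; exact: ler_sum.
by rewrite big_const_seq count_predT iter_addr_0 mulr_natl.
Qed.

(** * Weights from almost optimal densities *)

Section modulus_weights.
Context {R : realType} {X : pointedType} (d : distance R X).
Variables (kappa b lambda : R).
Variables (U : nat -> set (set (mspace d))) (c : nat -> set (mspace d) -> mspace d).
Hypothesis kappa_gt1 : 1 < kappa.
Hypothesis b_gt1 : 1 < b.
Hypothesis lambda_ge32 : 32 <= lambda.
Hypothesis covering : ball_coverings kappa b U c.
Let r n : R := kappa * b ^- n.
Let W n : seq (set (mspace d)) := finmap.enum_fset (fset_set (U n)).
Variables (L C : R).
Hypothesis L_gt0 : 0 < L.
Hypothesis C_ge1 : 1 <= C.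
Hypothesis sum_expR : forall n x, (1 <= n)%N ->
  \sum_(w <- W n) expR (- (L * (d x (c n w) / r n))) <= C.

Let r0 n : 0 < r n.
Proof.
by rewrite mulr_gt0 ?(lt_trans _ kappa_gt1)// invr_gt0 exprn_gt0// (lt_trans _ b_gt1).
Qed.

Lemma radius_step m k : r m = b ^+ k * r (m + k).
Proof.
have b0 : b ^+ k != 0 by rewrite gt_eqF// exprn_gt0// (lt_trans _ b_gt1).
have b0' : b ^+ m != 0 by rewrite gt_eqF// exprn_gt0// (lt_trans _ b_gt1).
by rewrite /r exprD; field; rewrite b0.
Qed.

Lemma mem_level n w : (1 <= n)%N -> (w \in W n) <-> U n w.
Proof.
move=> n1; have fU : finite_set (U n) by exact: (bc_finite covering).
have -> : (w \in W n) = (w \in U n) := in_fset_set fU w.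
by rewrite inE.
Qed.

Lemma count_level n x t : (1 <= n)%N ->
  (size [seq w <- W n | d x (c n w) <= t * r n])%:R <= C * expR (L * t).
Proof.
move=> n1; rewrite -ler_pdivrMr ?expR_gt0// -expRN.
apply: le_trans (sum_expR x n1).
rewrite (bigID (fun w => d x (c n w) <= t * r n)) /= -[leLHS]addr0 lerD//; last first.
  by apply: sumr_ge0 => w _; exact: expR_ge0.
rewrite -big_filter; set s := [seq w <- _ | _].
have -> : (size s)%:R * expR (- (L * t)) = \sum_(w <- s) expR (- (L * t)).
  by rewrite big_const_seq count_predT iter_addr_0 mulr_natl.
rewrite big_seq [leRHS]big_seq; apply: ler_sum => w; rewrite mem_filter => /andP[wt _].
by rewrite ler_expR lerN2 ler_wpM2l ?(ltW L_gt0)// ler_pdivrMr.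
Qed.

Section one_weight.
Variables (p e eta : R) (j k : nat) (B : set (mspace d)).
Hypothesis p_gt0 : 0 < p.
Hypothesis eta_gt0 : 0 < eta.
Hypothesis j_ge1 : (1 <= j)%N.
Hypothesis UB : U j B.
Hypothesis small : (sup_modulus kappa b lambda U c p k < e%:E)%E.
Let n := (j + k)%N.
Let n1 : (1 <= n)%N. Proof. exact: leq_trans (leq_addr _ _). Qed.
Let D := C * expR (L * 16).
Let near w := d (c j B) (c n w) < 2 * r j.

Lemma crossing_density : exists rho : set (mspace d) -> R, [/\
  forall w, 0 <= rho w,
  \sum_(w <- W n) rho w `^ p <= e &
  forall w0 ws z, uniq (w0 :: rcons ws z) -> {subset w0 :: rcons ws z <= W n} ->
    B (c n w0) -> path (fun w w' => d (c n w) (c n w') <= 16 * r n) w0 (rcons ws z) ->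
    2 * r j <= d (c j B) (c n z) ->
    1 <= \sum_(w <- w0 :: rcons ws z) rho w].
Proof.
have fU : finite_set (U n) by exact: (bc_finite covering).
have : (Mod p (crossing_paths kappa b lambda U c k j B)
    (covering_graph kappa b lambda U c n) < e%:E)%E.
  by apply: le_lt_trans small; apply: ereal_sup_ubound; exists j, B.
move=> /ereal_inf_lt[_ [rho [rho0 adm] <-]]; rewrite lte_fin fsbig_finite//= => rhoe.
exists (fun w => if w \in W n then rho w else 0); split.
- by move=> w; case: ifP => // /(mem_level _ n1); exact: rho0.
- apply/ltW; apply: le_lt_trans rhoe.
  by rewrite big_seq [leRHS]big_seq; apply: ler_sum => w ->.
move=> w0 ws z us sW Bw0 pth far.
have sU w : w \in w0 :: rcons ws z -> U n w by move=> /sW /(mem_level _ n1).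
have : 1 <= \sum_(w \in [set` w0 :: rcons ws z]) rho w.
  apply: adm; exists w0, (rcons ws z); split => //.
  - split; first by move=> w /sU.
    move: us pth; move: (rcons ws z) w0 {sW Bw0 sU}.
    elim=> [//|y s ih] x /= /andP[xs us] /andP[xy pth].
    apply/andP; split; last exact: ih.
    apply/asboolP; split.
      by move=> xE; move: xs; rewrite xE inE eqxx.
    (* The center of [y] lies in both dilates because 16 < 32 <= lambda. *)
    have l0 : 0 < lambda * r n by rewrite mulr_gt0// (lt_le_trans _ lambda_ge32).
    exists (c n y); rewrite /dilate !mspace_ballE /= distxx -!mulrA; split=> //.
    apply: (le_lt_trans xy); rewrite ltr_pM2r//.
    by apply: lt_le_trans lambda_ge32; rewrite ltr_nat.
  - rewrite last_rcons /dilate mspace_ballE /= => /lt_geF.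
    by rewrite -mulrA far.
move=> /le_trans; apply; apply: le_trans (fsbig_seq_le _) _.
  by move=> w /sU; exact: rho0.
by rewrite big_seq [leRHS]big_seq; apply: ler_sum => w /sW ->.
Qed.

(** [eta] is a floor that keeps the mass of a child comparable to that of its parent; it costs the
    second summand. In the first, the power of [D] comes from raising sums of at most [D] terms to
    the power [p], and the factor [D] from double counting. *)
Lemma crossing_weight : exists T : set (mspace d) -> R, [/\
  forall w, 0 <= T w,
  forall w, ~~ near w -> T w = 0,
  forall w, near w -> eta <= T w,
  \sum_(w <- W n) T w <= D `^ p * (D * e) + eta * (C * expR (L * (2 * b ^+ k))) &
  forall w0 ws z, {subset w0 :: rcons ws z <= W n} -> B (c n w0) ->
    path (fun w w' => d (c n w) (c n w') <= 16 * r n) w0 (rcons ws z) ->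
    all near (w0 :: ws) -> ~~ near z ->
    1 <= \sum_(w <- w0 :: ws) T w `^ p^-1].
Proof.
have [rho [rho0 rhoe rhoc]] := crossing_density.
pose nb w := [seq w' <- W n | d (c n w) (c n w') <= 16 * r n].
(* Summing over the neighbours lets the last vertex of a crossing account for the
   exit vertex, which lies outside the support of the weight. *)
pose rho' w := \sum_(w' <- nb w) rho w'.
have rho'0 w : 0 <= rho' w by exact: sumr_ge0.
have D0 : 0 <= D by rewrite mulr_ge0 ?expR_ge0// (le_trans _ C_ge1).
exists (fun w => if near w then rho' w `^ p + eta else 0); split.
- by move=> w; case: ifP => // _; rewrite addr_ge0 ?powR_ge0 ?(ltW eta_gt0).
- by move=> w /negbTE ->.
- by move=> w ->; rewrite lerDr powR_ge0.
- rewrite -big_mkcond big_split /=; apply: lerD.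
    apply: (@le_trans _ _ (\sum_(w <- W n) D `^ p * \sum_(w' <- nb w) rho w' `^ p)).
      rewrite big_mkcond; apply: ler_sum => w _.
      have := powR_sum_le p_gt0 rho0 (count_level (c n w) 16 n1).
      case: ifP => // _ _; rewrite mulr_ge0 ?powR_ge0//.
      by apply: sumr_ge0 => w' _; exact: powR_ge0.
    rewrite -mulr_sumr ler_wpM2l ?powR_ge0//.
    under eq_bigr do rewrite big_filter big_mkcond.
    rewrite exchange_big /=.
    apply: (@le_trans _ _ (\sum_(w <- W n) D * rho w `^ p)).
      apply: ler_sum => w _; rewrite -big_mkcond /=.
      apply: le_trans (ler_wpM2r (powR_ge0 _ _) (count_level (c n w) 16 n1)).
      rewrite -sum1_size natr_sum mulr_suml big_filter.
      under [leLHS]eq_bigl do rewrite distC.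
      by under [leRHS]eq_bigr do rewrite mul1r.
    by rewrite -mulr_sumr ler_wpM2l.
  rewrite big_const_seq iter_addr_0 -[leLHS]mulr_natr; apply: ler_wpM2l; first exact: ltW.
  apply: le_trans (count_level (c j B) (2 * b ^+ k) n1).
  rewrite ler_nat size_filter; apply: sub_count => w /ltW.
  by rewrite -mulrA -radius_step.
move=> w0 ws z sW Bw0 pth nws nz.
have : last w0 (rcons ws z) = z by rewrite last_rcons.
(* Adjacent vertices of the covering graph are distinct, so repetitions must go before the density
   is applied. *)
move/shortenP : (pth) => [s' pth' us' ss'].
have sz' : {subset s' <= rcons ws z} by exact: ss'.
have w0z : w0 != z.
  by apply/eqP => wE; move: nws nz; rewrite /= wE => /andP[->].
case/lastP : s' pth' us' ss' sz' => [_ _ _ _ /= w0E|s' z' pth' us' _ sz'].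
  by move: w0z; rewrite w0E eqxx.
rewrite last_rcons => zE; subst z'.
have us : uniq (w0 :: s') /\ z \notin w0 :: s'.
  by move: us'; rewrite -rcons_cons rcons_uniq => /andP[].
have sub : {subset w0 :: s' <= w0 :: ws}.
  move=> w; rewrite !inE => /predU1P[->|ws']; first by rewrite eqxx.
  have wz : w != z by apply: contraNneq us.2 => <-; rewrite inE ws' orbT.
  have := sz' w; rewrite !mem_rcons !inE ws' orbT => /(_ isT).
  by rewrite (negbTE wz) /= => ->; rewrite orbT.
have sW' : {subset w0 :: rcons s' z <= W n}.
  move=> w; rewrite inE => /predU1P[->|/sz' h]; apply: sW; rewrite inE ?eqxx//.
  by rewrite h orbT.
have far : 2 * r j <= d (c j B) (c n z) by rewrite leNgt.
apply: (le_trans (rhoc _ _ _ us' sW' Bw0 pth' far)).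
have rho_le w : w \in W n -> rho w <= rho' w.
  move=> wW; rewrite /rho' (big_rem w) /=; last first.
    by rewrite mem_filter distxx wW andbT mulr_ge0// ltW.
  by rewrite lerDl; exact: sumr_ge0.
have rho_le2 w : w \in W n -> w != z -> d (c n w) (c n z) <= 16 * r n ->
    rho w + rho z <= rho' w.
  move=> wW wz wz16; have zW : z \in W n by apply: sW; rewrite inE mem_rcons inE eqxx orbT.
  have -> : rho w + rho z = \sum_(v <- [:: w; z]) rho v by rewrite big_cons big_seq1.
  apply: ler_sum_uniq_sub => //; first by rewrite /= inE wz.
  move=> v; rewrite !inE => /predU1P[->|/eqP ->].
    by rewrite mem_filter distxx wW andbT mulr_ge0// ltW.
  by rewrite mem_filter wz16 zW.
apply: (@le_trans _ _ (\sum_(w <- w0 :: s') rho' w)).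
  rewrite -rcons_cons lastI -[rcons (rcons _ _) z]cats1 big_cat big_seq1 /=.
  rewrite -cats1 !big_cat !big_seq1 /= -addrA lerD//.
    rewrite big_seq [leRHS]big_seq; apply: ler_sum => w ws'; apply: rho_le; apply: sW'.
    by rewrite -rcons_cons mem_rcons inE (mem_belast ws') orbT.
  apply: rho_le2.
  - by apply: sW'; rewrite -rcons_cons mem_rcons inE mem_last orbT.
  - by apply: contraNneq us.2 => <-; exact: mem_last.
  - by move: pth'; rewrite rcons_path => /andP[].
apply: (@le_trans _ _ (\sum_(w <- w0 :: ws) rho' w)).
  by apply: ler_sum_uniq_sub => //; exact: us.1.
rewrite big_seq [leRHS]big_seq; apply: ler_sum => w wws.
rewrite (allP nws _ wws).
rewrite [leLHS](_ : _ = (rho' w `^ p) `^ p^-1); last by rewrite -powRrM mulfV ?gt_eqF// powRr1.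
apply: ge0_ler_powR; rewrite ?nnegrE ?invr_ge0 ?addr_ge0 ?powR_ge0 ?(ltW p_gt0) ?(ltW eta_gt0)//.
by rewrite lerDl ltW.
Qed.

End one_weight.
End modulus_weights.

Section gauge_from_modulus.
Context {R : realType} {X : pointedType} (d : distance R X).
Variables (kappa b lambda : R).
Variables (U : nat -> set (set (mspace d))) (c : nat -> set (mspace d) -> mspace d).
Hypothesis cX : compact [set: mspace d].
Hypothesis kappa_gt1 : 1 < kappa.
Hypothesis b_gt1 : 1 < b.
Hypothesis lambda_ge32 : 32 <= lambda.
Hypothesis covering : ball_coverings kappa b U c.
Let rad n : R := kappa * b ^- n.
Let W n : seq (set (mspace d)) := finmap.enum_fset (fset_set (U n)).
Variables (L C sigma rho0 p : R).
Hypothesis L_gt0 : 0 < L.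
Hypothesis C_ge1 : 1 <= C.
Hypothesis sum_expR : forall n x, (1 <= n)%N ->
  \sum_(w <- W n) expR (- (L * (d x (c n w) / rad n))) <= C.
Hypothesis sigma_gt0 : 0 < sigma.
Hypothesis rho0_gt0 : 0 < rho0.
Hypothesis perfect : forall x r, 0 < r -> r <= rho0 -> exists y, sigma * r <= d x y < r.
Hypothesis p_gt0 : 0 < p.
Hypothesis Mp0 : liminf_modulus kappa b lambda U c p = 0%E.

Let C_gt0 : 0 < C. Proof. exact: lt_le_trans C_ge1. Qed.
Let rad_gt0 n : 0 < rad n.
Proof.
by rewrite mulr_gt0 ?(lt_trans _ kappa_gt1)// invr_gt0 exprn_gt0// (lt_trans _ b_gt1).
Qed.

Lemma modulus_gauge : exists2 theta, ar_gauge d theta &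
  ahlfors_regular (mspace theta) p /\ compact [set: mspace theta].
Proof.
pose D := C * expR (L * 16).
have D0 : 0 < D by rewrite mulr_gt0 ?expR_gt0.
have Dp0 : 0 < D `^ p by rewrite powR_gt0.
(* With [eta] below, each of the two summands of [crossing_weight] becomes 1/2 after multiplication
   by [C]. *)
pose e := (2 * C * (D `^ p * D))^-1.
have e0 : 0 < e by rewrite invr_gt0 !mulr_gt0 ?expR_gt0.
have b0 : 0 < b by exact: lt_trans b_gt1.
have [k1 hk1] : exists k1, forall k, (k1 <= k)%N -> 14 <= b ^+ k.
  have : b^-1 ^+ k @[k --> \oo] --> (0 : R).
    by apply: cvg_expr; rewrite ger0_norm ?invr_ge0 ?(ltW b0)// invf_lt1.
  have i14 : 0 < (14 : R)^-1 by rewrite invr_gt0.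
  move=> /cvgrPdist_lt /(_ _ i14) [k1 _ hk]; exists k1 => k /hk /=.
  rewrite sub0r normrN exprVn ger0_norm ?invr_ge0 ?exprn_ge0 ?(ltW b0)//.
  by rewrite ltf_pV2 ?posrE ?exprn_gt0// => /ltW.
(* Since [e] does not depend on [k], the liminf allows [k] to be so large that also 14 <= b ^+ k. *)
have [k kk1 smallk] := (limn_einf_eq0P (fun k => sup_modulus_ge0 lambda covering p k)).1
  Mp0 e e0 (maxn k1 1).
have k1' : (1 <= k)%N by exact: leq_trans (leq_maxr _ _) kk1.
pose a := b ^+ k; have a14 : 14 <= a by apply: hk1; exact: leq_trans (leq_maxl _ _) kk1.
pose M := C * expR (L * (2 * a)).
have M0 : 0 < M by rewrite mulr_gt0 ?expR_gt0.
pose eta := (2 * C * M)^-1.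
have eta0 : 0 < eta by rewrite invr_gt0 !mulr_gt0 ?expR_gt0.
(* Starts at [k] and not at 0, because coverings exist from level 1 on. *)
pose lev n := iter n (addn^~ k) k.
have lev1 n : (1 <= lev n)%N.
  by elim: n => //= n ih; exact: leq_trans (leq_addr _ _).
pose S n := W (lev n); pose ctr n v : X := c (lev n) v.
pose inn (n : nat) (v : set X) x := v x.
pose r n := rad (lev n).
have r0 n : 0 < r n by exact: rad_gt0.
have rS n : r n = a * r n.+1 by exact: radius_step.
have SU n v : v \in S n <-> U (lev n) v by exact: (mem_level covering).
have Scov n x : exists2 v, v \in S n & inn n v x.
  have : [set: mspace d] x by [].
  by rewrite -(bc_cover covering (lev1 n)) => -[v Uv vx]; exists v => //; exact/SU.
have inn_d n v x : v \in S n -> inn n v x -> d (ctr n v) x < r n.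
  move=> /SU Uv vx; have := (bc_ball covering (lev1 n) Uv).2 x vx.
  by rewrite mspace_ballE.
have Scov' n x : exists2 v, v \in S n & d (ctr n v) x < r n.
  by have [v Sv vx] := Scov n x; exists v => //; exact: inn_d.
have sumS n x : \sum_(v <- S n) expR (- (L * (d x (ctr n v) / r n))) <= C.
  exact: sum_expR.
have tauE (nv : nat * set X) : exists T : set X -> R, [/\
    forall w, 0 <= T w,
    forall w, 2 * r nv.1 <= d (ctr nv.1 nv.2) (ctr nv.1.+1 w) -> T w = 0,
    forall w, d (ctr nv.1 nv.2) (ctr nv.1.+1 w) < 2 * r nv.1 -> eta <= T w &
    nv.2 \in S nv.1 -> C * \sum_(w <- S nv.1.+1) T w <= 1 /\
    forall w0 ws z, {subset w0 :: rcons ws z <= S nv.1.+1} ->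
      inn nv.1 nv.2 (ctr nv.1.+1 w0) ->
      path (fun w w' => d (ctr nv.1.+1 w) (ctr nv.1.+1 w') <= 16 * r nv.1.+1) w0 (rcons ws z) ->
      all (fun w => d (ctr nv.1 nv.2) (ctr nv.1.+1 w) < 2 * r nv.1) (w0 :: ws) ->
      2 * r nv.1 <= d (ctr nv.1 nv.2) (ctr nv.1.+1 z) ->
      1 <= \sum_(w <- w0 :: ws) T w `^ p^-1].
  (* The near and far conditions are asked for every index, so the bare floor is used off the
     level. *)
  case: nv => n v /=; have [Sv|nSv] := boolP (v \in S n); last first.
    exists (fun w => if d (ctr n v) (ctr n.+1 w) < 2 * r n then eta else 0); split => //.
    - by move=> w; case: ifP => // _; exact: ltW.
    - by move=> w; rewrite leNgt => /negbTE ->.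
    - by move=> w ->.
  have [T [T0 Tfar Tnear Tsum Tcross]] := crossing_weight kappa_gt1 b_gt1 lambda_ge32
    covering L_gt0 C_ge1 sum_expR p_gt0 eta0 (lev1 n) ((SU n v).1 Sv) smallk.
  exists T; split => //.
  - by move=> w; rewrite leNgt; exact: Tfar.
  - move=> _; split.
      apply: le_trans (ler_wpM2l (ltW C_gt0) Tsum) _.
      rewrite -/D -/a -/M mulrDr.
      have -> : C * (D `^ p * (D * e)) = 2^-1.
        by rewrite /e; field; rewrite !gt_eqF.
      have -> : C * (eta * M) = 2^-1 by rewrite /eta; field; rewrite !gt_eqF.
      lra.
    move=> w0 ws z sS iw0 pth nr far; apply: Tcross sS iw0 pth nr _.
    by rewrite -leNgt.
have [tau tauP] := choice tauE.
pose tau' n v := tau (n, v).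
have tau_ge0 n v w : 0 <= tau' n v w by have [h _ _ _] := tauP (n, v); exact: h.
have tau_far n v w : 2 * r n <= d (ctr n v) (ctr n.+1 w) -> tau' n v w = 0.
  by have [_ h _ _] := tauP (n, v); exact: h.
have tau_near n v w : d (ctr n v) (ctr n.+1 w) < 2 * r n -> eta <= tau' n v w.
  by have [_ _ h _] := tauP (n, v); exact: h.
have tau_sum n v : v \in S n -> C * \sum_(w <- S n.+1) tau' n v w <= 1.
  by move=> Sv; have [_ _ _ /(_ Sv)[]] := tauP (n, v).
(* As 14 <= a, the exponent (a - 13) Q - 2 a is at least Q - 2 a, which the second term makes large
   enough; 3 gives 18 <= 6 Q. *)
pose Q := Num.max 3 (2 * a + ln (2 * C / eta ^+ 2) / L).
have Q3 : 3 <= Q by rewrite le_max lexx.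
have Q2 : 2 <= Q by lra.
have Ql : 2 * C / eta ^+ 2 <= expR (L * ((a - 13) * Q - 2 * a)).
  have Ce : 0 < 2 * C / eta ^+ 2 by rewrite divr_gt0 ?exprn_gt0// mulr_gt0.
  rewrite -[leLHS]lnK ?posrE// ler_expR -ler_pdivrMl// mulrC.
  have : 2 * a + ln (2 * C / eta ^+ 2) / L <= Q by rewrite le_max lexx orbT.
  have : 0 <= (a - 14) * Q by rewrite mulr_ge0//; lra.
  lra.
pose m := mass d S ctr r L Q tau'.
have [F [F0 Fadd FT Fm]] := mass_content a14 r0 rS Scov' L_gt0 C_ge1 sumS eta0
  tau_ge0 tau_far tau_near tau_sum Q2 Ql.
pose H := expR (L * (6 * Q)) + 1; pose C' := C * expR (L * (5 * Q)) * H.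
have H0 : 0 <= H by rewrite addr_ge0 ?expR_ge0.
have C'0 : 0 <= C' by rewrite !mulr_ge0 ?expR_ge0// ltW.
have Fm' n v x : v \in S n -> d x (ctr n v) <= r n ->
    m n v <= F [set y | d x y < 3 * Q * r n] <= C' * m n v.
  by move=> Sv xv; rewrite /C' -[C * _ * H * _]mulrA; exact: Fm.
have Fle A B : A `<=` B -> F A <= F B.
  move=> AB; rewrite -(setDUK AB) Fadd ?lerDl//.
  exact: setDIK.
have F00 : F set0 = 0.
  by have := Fadd set0 set0 (set0I _); rewrite setU0; have := F0 set0; lra.
have FTN : F setT <= (size (S 0%N))%:R by rewrite FT.
have FT0 : 0 < F setT.
  by rewrite FT ltr0n; have [v] := Scov 0%N point; case: (S 0%N).
have m_gt0 n v : v \in S n -> 0 < m n v.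
  exact: (mass_gt0 a14 r0 rS Scov' sumS eta0 tau_ge0 tau_far tau_near tau_sum Q2).
have m_near n v w : v \in S n -> w \in S n.+1 ->
    d (ctr n v) (ctr n.+1 w) < 2 * r n -> eta * m n v <= m n.+1 w.
  exact: (mass_near a14 r0 rS Scov' sumS eta0 tau_ge0 tau_far tau_near tau_sum Q2).
have m_harnack n v v' : v \in S n -> v' \in S n ->
    d (ctr n v) (ctr n v') <= 18 * r n -> m n v <= H * m n v'.
  move=> Sv Sv' vv'; apply: (mass_harnack a14 r0 rS Scov' L_gt0 C_ge1 sumS eta0
    tau_ge0 tau_far tau_near tau_sum Q2 Ql) => //.
  by apply: (le_trans vv'); rewrite ler_wpM2r ?(ltW (r0 n))//; lra.
have m_cross n v w0 ws z : v \in S n -> {subset w0 :: rcons ws z <= S n.+1} ->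
    inn n v (ctr n.+1 w0) ->
    path (fun w w' => d (ctr n.+1 w) (ctr n.+1 w') <= 16 * r n.+1) w0 (rcons ws z) ->
    all (fun w => d (ctr n v) (ctr n.+1 w) < 2 * r n) (w0 :: ws) ->
    2 * r n <= d (ctr n v) (ctr n.+1 z) ->
    m n v `^ p^-1 <= \sum_(w <- w0 :: ws) m n.+1 w `^ p^-1.
  move=> Sv sS iw0 pth nr far; have [_ _ _ /(_ Sv)[_ h]] := tauP (n, v).
  have mv0 : 0 <= m n v by exact/ltW/m_gt0.
  have := ler_wpM2l (powR_ge0 (m n v) p^-1) (h w0 ws z sS iw0 pth nr far).
  rewrite mulr1 => /le_trans; apply; rewrite mulr_sumr big_seq [leRHS]big_seq.
  apply: ler_sum => w wws; rewrite -(powRM _ mv0 (tau_ge0 n v w)).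
  have Sw : w \in S n.+1.
    by apply: sS; rewrite -rcons_cons mem_rcons inE wws orbT.
  apply: ge0_ler_powR; rewrite ?nnegrE ?invr_ge0 ?mulr_ge0 ?(ltW p_gt0)//.
    exact/ltW/m_gt0.
  exact: (mass_tau a14 r0 rS Scov' sumS eta0 tau_ge0 tau_far tau_near tau_sum Q2).
have m0 v : m 0%N v = 1 by [].
have [DD hDD] := content_doubling a14 r0 rS Scov inn_d eta0 Q3 C'0 m0 m_near F0 Fle FTN Fm'.
have [K K0 hK] := content_chain a14 r0 rS Scov inn_d eta0 Q3 p_gt0 H0 C'0 m0 m_gt0
  m_near m_harnack m_cross F0 Fle F00 FTN Fm'.
have [Delta Delta0 hDelta] := mspace_bounded cX.
exists (deformed hDelta F0 Fadd FT0 hDD K0 hK).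
  exact: (deformed_gauge cX Delta0 _ _ _ _ _ sigma_gt0 rho0_gt0 perfect p_gt0).
exact: (deformed_ahlfors_regular cX Delta0 _ _ _ _ _ sigma_gt0 rho0_gt0 perfect p_gt0).
Qed.

End gauge_from_modulus.

(** * Equality of the exponents *)

Lemma mspace_compact_transfer (R : realType) (X : pointedType) (d theta : distance R X) :
  continuous (fun x : mspace d => x : mspace theta) ->
  compact [set: mspace d] -> compact [set: mspace theta].
Proof.
move=> dt cX; have -> : [set: mspace theta] =
    (fun x : mspace d => x : mspace theta) @` [set: mspace d].
  by rewrite image_id.
by apply: continuous_compact => //; exact: continuous_subspaceT.
Qed.

Lemma critical_exponent_singleton (R : realType) (X : pointedType) (d : distance R X)
    (kappa b lambda : R)
    (U : nat -> set (set (mspace d))) (c : nat -> set (mspace d) -> mspace d) :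
  (forall x y : X, x = y) -> 1 < kappa -> 1 < b -> ball_coverings kappa b U c ->
  critical_exponent kappa b lambda U c = 0%E.
Proof.
move=> X1 k1 b1 covering; apply/eqP; rewrite eq_le; apply/andP; split; last first.
  by apply: le_ereal_inf_tmp => _ [s [s0 _] <-]; rewrite lee_fin ltW.
apply/lee_addgt0Pr => e e0; rewrite add0e; apply: ereal_inf_lbound.
exists e => //; split => //.
apply/limn_einf_eq0P => [k|e' e'0 n]; first exact: (sup_modulus_ge0 lambda covering).
exists n => //; apply: (@le_lt_trans _ _ 0%E); last by rewrite lte_fin.
apply: ge_ereal_sup => _ [j [B [j1 UB ->]]]; apply: ereal_inf_lbound; exists (fun=> 0).
  split=> // gamma [x [s [_ _ + _]]]; rewrite /dilate mspace_ballE /=.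
  rewrite (X1 (c _ _) (c j B)) distxx => /negP; rewrite -leNgt.
  by rewrite leNgt mulr_gt0 ?mulr_gt0 ?invr_gt0 ?exprn_gt0 ?(lt_trans _ k1) ?(lt_trans _ b1).
by rewrite fsbig1// => v _; rewrite powR0// gt_eqF.
Qed.

Theorem theorem1p2 (R : realType) (X : pointedType) (d : distance R X)
  (kappa b lambda : R)
  (U : nat -> set (set (mspace d))) (c : nat -> set (mspace d) -> mspace d) :
  compact [set: mspace d] ->
  ar_gauge d !=set0 ->
  1 < kappa -> 1 < b -> 32 <= lambda ->
  ball_coverings kappa b U c ->
  dimAR d = critical_exponent kappa b lambda U c.
Proof.
move=> cX [theta0 g0] k1 b1 l32 covering.
(* On a one-point space there is no positive scale to compare masses with; both sides are 0. *)
have [[x0 [x1 x01]]|no] := pselect (exists x0 x1 : X, x0 <> x1); last first.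
  have X1 x y : x = y :> X by apply: contrapT => xy; apply: no; exists x, y.
  rewrite (critical_exponent_singleton lambda X1 k1 b1 covering).
  have dim0 (theta : distance R X) : hausdorff_dim (mspace theta) = 0%E :> \bar R.
    by apply: hausdorff_dim_singleton => //; exists (point : X).
  apply/eqP; rewrite eq_le; apply/andP; split.
    by rewrite -(dim0 theta0); apply: ereal_inf_lbound; exists theta0.
  by apply: le_ereal_inf_tmp => _ [theta _ <-]; rewrite dim0.
apply/eqP; rewrite eq_le; apply/andP; split; last first.
  apply: le_ereal_inf_tmp => _ [theta [qsE [q q0 ar]] <-].
  have [eta [[dt td] eta0 eta_small qs]] := qs_equivalent_dist qsE.
  have cT := mspace_compact_transfer dt cX.
  have [N [K [[N0 K0] Nle [Nadd _] Nup Nlow]]] :=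
    @ahlfors_content _ (mspace theta) _ _ _ x01 q0 cT ar.
  have [M M0 tM] := mspace_bounded cT.
  rewrite (@ahlfors_hausdorff_dim _ (mspace theta) _ _ _ x01 q0 cT ar).
  apply/lee_addgt0Pr => e e0; rewrite -EFinD; apply: ereal_inf_lbound.
  exists (q + e) => //; split; first exact: addr_gt0.
  apply: (@gauge_liminf_modulus _ _ d theta N q (q + e) K M eta) => //.
  - by rewrite ltrDl.
  - by move=> x y; exact: ltW.
(* The given [theta0] only supplies doubling and uniform perfectness of [d]; its dimension [q] is
   unrelated to [p]. *)
have [qsE [q q0 ar]] := g0.
have [eta [[dt td] eta0 eta_small qs]] := qs_equivalent_dist qsE.
have cT := mspace_compact_transfer dt cX.
have [N [K [[N0 K0] Nle [Nadd _] Nup Nlow]]] :=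
  @ahlfors_content _ (mspace theta0) _ _ _ x01 q0 cT ar.
have [M M0 tM] := mspace_bounded cT.
have tM' x y : theta0 x y <= M by exact: ltW.
have [Md Md0 dM] := mspace_bounded cX.
have dM' x y : d x y <= Md by exact: ltW.
have Nup' x r : 0 < r -> N [set y | theta0 x y < r] <= K * r `^ q.
  by move=> r0; have := Nup x r r0; rewrite mspace_ballE.
have Nlow' x y z r : 0 < r -> r <= theta0 y z ->
    r `^ q <= K * N [set w | theta0 x w < r].
  by move=> r0 ryz; have := Nlow x y z r r0 ryz; rewrite mspace_ballE.
have [sigma [rho0 [sigma0 rho00 perfect]]] :=
  gauge_perfect td eta_small qs x01 q0 K0 Nle Nup' Nlow'.
have [L [C [L0 C1 expsum]]] := separated_exp_sum
  (fun x r => ball_open_transfer td (x := x) (r := r)) Nle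
  (fun J U W s => @sum_disjoint_content _ (mspace theta0) J N U W s N0 Nle Nadd)
  (gauge_doubling td qs N0 K0 Nle Nup' Nlow' tM')
  (gauge_ball_gt0 td x01 K0 Nle Nlow') dM' k1.
have kappa0 : 0 < kappa by exact: lt_trans k1.
apply: le_ereal_inf_tmp => _ [p [p0 Mp] <-].
(* [expsum] measures distances in units of [b ^- n], the masses in units of [kappa * b ^- n]; the
   rate [L * kappa] makes up for it. *)
have sumW n x : (1 <= n)%N ->
    \sum_(w <- finmap.enum_fset (fset_set (U n)))
      expR (- (L * kappa * (d x (c n w) / (kappa * b ^- n)))) <= C.
  move=> n1.
  have fU : finite_set (U n) by exact: (bc_finite covering).
  have rho0' : 0 < b ^- n by rewrite invr_gt0 exprn_gt0// (lt_trans _ b1).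
  have sepW : {in finmap.enum_fset (fset_set (U n)) &, forall v w,
      [set y | d (c n v) y < kappa^-1 * b ^- n] `&`
      [set y | d (c n w) y < kappa^-1 * b ^- n] !=set0 -> v = w}.
    move=> v w /(mem_level covering _ n1) Uv /(mem_level covering _ n1) Uw vw.
    by apply: (bc_disjoint covering n1 Uv Uw); rewrite !mspace_ballE.
  apply: le_trans (expsum _ _ (c n) _ rho0' (finmap.fset_uniq _) sepW x).
  rewrite le_eqVlt; apply/orP; left; apply/eqP; apply: eq_bigr => w _.
  congr expR; congr (- _); rewrite invfM -mulrA [d x _ * _]mulrCA mulrA.
  by rewrite -mulrA [kappa * _]mulrA divff ?mul1r// gt_eqF.
have [theta gt [art ct]] := modulus_gauge cX k1 b1 l32 covering (mulr_gt0 L0 kappa0) C1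
  sumW sigma0 rho00 perfect p0 Mp.
rewrite -(@ahlfors_hausdorff_dim _ (mspace theta) _ _ _ x01 p0 ct art).
by apply: ereal_inf_lbound; exists theta.
Qed.
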